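(* Let $r\ge0$ and let $z,\omega_1,\dots,\omega_r$ lie in the open upper half plane $\mathfrak{H}$; write $\boldsymbol{\omega}=(\omega_1,\dots,\omega_r)$. Then for all integers $m\ge1$, $$\frac{\partial\xi_{r+1}}{\partial s}(1-m,z\mid-1;\boldsymbol{\omega})=\frac{(m-1)!}{(2\pi i)^{m-1}}\sum_{n=1}^\infty\frac{e^{2\pi i n z}}{n^m(1-e^{2\pi i n\omega_1})\cdots(1-e^{2\pi i n\omega_r})}.$$ In particular, with $x=e^{2\pi i z}$, $q_k=e^{2\pi i\omega_k}$ and $\boldsymbol{q}=(q_1,\dots,q_r)$, $$\exp\Big(-\frac{\partial\xi_{r+1}}{\partial s}(0,z\mid-1;\boldsymbol{\omega})\Big)=(x;\boldsymbol{q})_{r,\infty}.$$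
   Context: Conventions: for $w\in\mathbf{C}\setminus\{0\}$, $\arg w\in(-\pi,\pi]$ and $w^{-s}=\exp(-s(\log|w|+i\arg w))$. For $z,\omega_1,\dots,\omega_r\in\mathfrak{H}$ the bilateral zeta function with first parameter $-1=e^{\pi i}$ is $$\xi_{r+1}(s,z\mid-1;\boldsymbol{\omega})=\sum_{n\in\mathbf{Z}}\sum_{m_1,\dots,m_r\ge0}(z+n+m_1\omega_1+\cdots+m_r\omega_r)^{-s}\qquad(\operatorname{Re}(s)>r+1),$$ continued analytically to an entire function of $s$. (In the paper it is written as $\zeta_{r+1}(s,z-1\mid-1,\boldsymbol{\omega})+\zeta_{r+1}(s,z\mid1,\boldsymbol{\omega})$ with $\zeta_{r+1}$ the Barnes multiple zeta function.) The $r$-ple $q$-shifted factorial is $(x;\boldsymbol{q})_{r,\infty}=\prod_{m_1,\dots,m_r\ge0}(1-q_1^{m_1}\cdots q_r^{m_r}x)$, equal to $1-x$ if $r=0$. *)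

(* Defs.v *)
From HB Require Import structures.
From mathcomp Require Import all_boot all_order all_algebra.
From mathcomp Require Import finmap complex.
From mathcomp Require Import all_classical all_reals all_analysis.
From mathcomp Require Import summability.

Set Implicit Arguments.
Unset Strict Implicit.
Unset Printing Implicit Defensive.

Import Order.TTheory GRing.Theory Num.Theory numFieldNormedType.Exports.

Local Open Scope classical_set_scope.
Local Open Scope ring_scope.
Local Open Scope complex_scope.

(* Complex numbers are written R[i]^o: this alias of R[i] carries the topology
   of the modulus and the one-dimensional normed R[i]-module structure, so that
   [derivable], [is_derive] and [f^`()] at R[i]^o are complex derivatives.
   [complex.Re], [complex.Im] and [Normc.normc] are R-valued. *)

Section ComplexFunctions.
Context {R : realType}.

Definition cexp (w : R[i]^o) : R[i]^o :=
  (expR (complex.Re w) * cos (complex.Im w)) +i*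
  (expR (complex.Re w) * sin (complex.Im w)).

Definition two_pi_i : R[i]^o := 0 +i* (2 * pi).

(* For w != 0 this is the argument in ]-pi, pi]: [acos] takes values in [0, pi],
   and the negative real axis, where Im w = 0, is sent to pi. *)
Definition carg (w : R[i]^o) : R :=
  let theta := acos (complex.Re w / Normc.normc w) in
  if 0 <= complex.Im w then theta else - theta.

Definition clog (w : R[i]^o) : R[i]^o := ln (Normc.normc w) +i* carg w.

(* w^(-s), used only for w != 0 *)
Definition cpowN (w s : R[i]^o) : R[i]^o := cexp (- (s * clog w)).

Definition entire (f : R[i]^o -> R[i]^o) := forall s, derivable f s 1.

(* Unordered infinite product, the multiplicative analogue of
   [summability.sum]: the limit of the finite products along the directed set
   of finite subsets of I. *)
Definition uprod (I : choiceType) (f : I -> R[i]^o) : R[i]^o :=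
  lim ((fun A : {fset I} => \prod_(i : A) f (val i) : R[i]^o) @ totally).

End ComplexFunctions.

Section BilateralZeta.
Context {R : realType} {r : nat}.

(* The double index (n, m) with n in Z and m = (m_1, ..., m_r) in N^r; the sum
   is the unordered one. *)
Definition bilateral_zeta_series (z : R[i]^o) (omega : 'I_r -> R[i]^o)
    (s : R[i]^o) : R[i]^o :=
  summability.sum (fun nm : int * {ffun 'I_r -> nat} =>
    cpowN (z + nm.1%:~R + \sum_(k < r) (nm.2 k)%:R * omega k) s).

Definition is_bilateral_zeta (z : R[i]^o) (omega : 'I_r -> R[i]^o)
    (xi : R[i]^o -> R[i]^o) : Prop :=
  entire xi /\
  (forall s, r.+1%:R < complex.Re s -> xi s = bilateral_zeta_series z omega s).

(* xi_{r+1}(s, z | -1; omega), the entire continuation of the series, picked by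
   classical choice (it is unique by the identity theorem); the default value 0
   is only a placeholder for parameters without such a continuation. *)
Definition bilateral_zeta (z : R[i]^o) (omega : 'I_r -> R[i]^o) :
    R[i]^o -> R[i]^o :=
  xget (fun=> 0) [set xi | is_bilateral_zeta z omega xi].

(* (x; q)_{r,oo}; for r = 0 the only index is the empty tuple and the product
   is 1 - x. *)
Definition q_shifted_factorial (x : R[i]^o) (q : 'I_r -> R[i]^o) : R[i]^o :=
  uprod (fun m : {ffun 'I_r -> nat} => 1 - (\prod_(k < r) q k ^+ m k) * x).

End BilateralZeta.

(* Main.v *)
Require Import Defs.
From HB Require Import structures.
From mathcomp Require Import all_boot all_order all_algebra.
From mathcomp Require Import finmap complex.
From mathcomp Require Import all_classical all_reals all_analysis.
From mathcomp Require Import ring lra zify summability.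

Set Implicit Arguments.
Unset Strict Implicit.
Unset Printing Implicit Defensive.

Import Order.TTheory GRing.Theory Num.Theory numFieldNormedType.Exports.

Local Open Scope classical_set_scope.
Local Open Scope ring_scope.
Local Open Scope complex_scope.

(* For Im u > 0 and Re s > 1, u |-> sum_{n in Z} (u + n)^(-s) is 1-periodic and
   its k-th Fourier coefficient is, by Cauchy's theorem, the integral of
   w^(-s) e^(-2 pi i k w) over a horizontal line.  It is zero for k <= 0 and
   scales like k^(s-1), whence Lipschitz's formula
     sum_{n in Z} (u + n)^(-s) = c(s) sum_{k >= 1} k^(s-1) e^(2 pi i k u).
   The constant is never compared with (-2 pi i)^s / Gamma(s): it is holomorphic,
   being a quotient of the two series, it satisfies 2 pi i c(s) = - s c(s+1) by
   integration by parts, and c(2) = (2 pi i)^2 by letting u = i y -> 0.  So c is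
   entire, c(-n) = 0 and c'(-n) = n! / (2 pi i)^n.
   Taking u = z + m_1 omega_1 + ... + m_r omega_r and summing geometric series
   over m gives xi(s) = c(s) F(s - 1) with the entire function
     F(t) = sum_{k >= 1} k^t e^(2 pi i k z) / prod_j (1 - e^(2 pi i k omega_j)),
   and xi'(-n) = c'(-n) F(-n-1).  For n = 0, expanding the geometric series back
   turns F(-1) into - sum_m log (1 - x q^m). *)

(** The zeta function is picked by choice among entire continuations, so an entire candidate needs a
    uniqueness theorem: [entire_vanishing] supplies it from an estimate on one circle, without power
    series. Integrals over a horizontal line are never improper; they are limits over [-N, N], the
    form in which unfolding produces them, and the factor |w|^(- Re s) makes the vertical sides of
    Cauchy's rectangle negligible. Lipschitz's formula is proved at each fixed s, which says nothing
    about its constant as a function of s. Holomorphy of c comes from fixing a point u so high that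
    the exponential series is nonzero, and dividing. The recursion needs one known value of c. The
    point s = 2 is convenient: the double pole at u = 0 is compared there with the closed form q /
    (1 - q)^2. From - n, exactly n + 2 steps lead to 2: the first n factors give n! / (2 pi i)^n,
    the next one has a simple zero at - n, and its derivative together with the last factor cancels
    c(2). The vanishing of c(-n) is also what removes the derivative of F from the final formula. *)

(** * The modulus and complex derivatives *)

(* The [R]-valued modulus; [`|z|] would be [R[i]]-valued. *)
Definition nm {R : realType} (z : R[i]^o) : R := Normc.normc z.
Arguments nm : simpl never.
Notation "x %:Co" := (real_complex _ x : (complex _)^o) (at level 2, format "x %:Co", only parsing) : ring_scope.

Section EpsilonDelta.

(** The error is measured against [|h|] instead of dividing by h, so h = 0 needs no separate
    treatment in later estimates. *)
Lemma is_derive_epsilon (K : numFieldType) (V W : normedModType K)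
    (f : V -> W) (x v : V) (d : W) :
  (forall e : K, 0 < e -> exists2 D : K, 0 < D &
     forall h : K, `|h| < D -> `|f (x + h *: v) - f x - h *: d| <= e * `|h|) ->
  is_derive x v f d.
Proof.
move=> H.
have cv : (fun h => h^-1 *: ((f \o shift x) (h *: v) - f x)) @ 0^' --> d.
  apply/cvgrPdist_le => e e0.
  have [D D0 HD] := H e e0.
  near=> h.
  have h0 : h != 0 by near: h; exact: nbhs_dnbhs_neq.
  rewrite -(@ler_pM2r _ `|h|) ?normr_gt0//.
  rewrite [X in X <= _]mulrC -normrZ scalerBr scalerA divff// scale1r /=.
  rewrite distrC [h *: v + x]addrC; apply: HD.
  near: h; apply: dnbhs0_lt => //.
apply: DeriveDef; first by apply/cvg_ex; exists d.
exact/cvg_lim.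
Unshelve. all: by end_near. Qed.

Lemma epsilon_is_derive (K : numFieldType) (V W : normedModType K)
    (f : V -> W) (x v : V) (d : W) :
  is_derive x v f d ->
  (forall e : K, 0 < e -> exists2 D : K, 0 < D &
     forall h : K, `|h| < D -> `|f (x + h *: v) - f x - h *: d| <= e * `|h|).
Proof.
move=> [df <-] e e0.
have /cvgrPdist_le/(_ _ e0) := df.
move=> /nbhs_ballP[D /= D0 HD].
exists D => // h hD.
have [->|h0] := eqVneq h 0.
  by rewrite !scale0r addr0 !subrr !normr0 mulr0.
have /= := HD h; rewrite /ball /= sub0r normrN => /(_ hD h0).
rewrite -(@ler_pM2r _ `|h|) ?normr_gt0//.
rewrite [X in X <= _]mulrC -normrZ scalerBr scalerA divff// scale1r /=.
by rewrite distrC [h *: v + x]addrC.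
Qed.

End EpsilonDelta.

Section ComplexBasics.
Context {R : realType}.
Implicit Types (z w h : R[i]^o).

Lemma normC_nm z : `|z| = (nm z)%:C. Proof. by []. Qed.
Lemma nm_ge0 z : 0 <= nm z.
Proof. by case: z => a b; exact: sqrtr_ge0. Qed.
Lemma nm0 : nm (0 : R[i]^o) = 0. Proof. exact: Normc.normc0. Qed.
Lemma nm1 : nm (1 : R[i]^o) = 1. Proof. exact: Normc.normc1. Qed.
Lemma nmM z w : nm (z * w) = nm z * nm w. Proof. exact: Normc.normcM. Qed.
Lemma nmV z : nm z^-1 = (nm z)^-1. Proof. exact: Normc.normcV. Qed.
Lemma nmN z : nm (- z) = nm z. Proof. exact: normcN. Qed.
Lemma ler_nmD z w : nm (z + w) <= nm z + nm w. Proof. exact: le_normcD. Qed.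
Lemma nmB z w : nm (z - w) = nm (w - z). Proof. by rewrite -nmN opprB. Qed.
Lemma ler_nmB z w : nm (z - w) <= nm z + nm w.
Proof. by rewrite -(nmN w); exact: ler_nmD. Qed.
Lemma ler_nm_sub z w : nm z - nm w <= nm (z - w).
Proof. by rewrite lerBlDr (le_trans _ (ler_nmD _ _))// subrK. Qed.
Lemma nm_eq0 z : (nm z == 0) = (z == 0).
Proof.
by apply/eqP/eqP => [/Normc.eq0_normc//|->]; exact: nm0.
Qed.
Lemma nm_gt0 z : (0 < nm z) = (z != 0).
Proof. by rewrite lt_def nm_ge0 andbT nm_eq0. Qed.
Lemma nmX z n : nm (z ^+ n) = nm z ^+ n.
Proof. by elim: n => [|n IH]; rewrite ?expr0 ?nm1// !exprS nmM IH. Qed.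
Lemma nm_real (x : R) : nm x%:Co = `|x|.
Proof. by rewrite /nm /= expr0n addr0 sqrtr_sqr. Qed.
Lemma natrC n : (n%:R : R[i]) = (n%:R : R)%:C.
Proof. by rewrite rmorph_nat. Qed.
Lemma nm_nat n : nm (n%:R : R[i]^o) = n%:R.
Proof. by rewrite natrC nm_real ger0_norm. Qed.
Lemma ler_nm_sum (I : Type) (r : seq I) (P : pred I) (F : I -> R[i]^o) :
  nm (\sum_(i <- r | P i) F i) <= \sum_(i <- r | P i) nm (F i).
Proof.
elim/big_ind2: _ => [|x y x' y' hx hy|//]; first by rewrite nm0.
exact: le_trans (ler_nmD _ _) (lerD hx hy).
Qed.
Lemma nm_prod (I : Type) (r : seq I) (P : pred I) (F : I -> R[i]^o) :
  nm (\prod_(i <- r | P i) F i) = \prod_(i <- r | P i) nm (F i).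
Proof. exact: (big_morph _ nmM nm1). Qed.

Lemma cReD z w : complex.Re (z + w) = complex.Re z + complex.Re w.
Proof. by case: z w => [a b] [c d]. Qed.
Lemma cImD z w : complex.Im (z + w) = complex.Im z + complex.Im w.
Proof. by case: z w => [a b] [c d]. Qed.
Lemma cReN z : complex.Re (- z) = - complex.Re z.
Proof. by case: z. Qed.
Lemma cImN z : complex.Im (- z) = - complex.Im z.
Proof. by case: z. Qed.
Lemma cReB z w : complex.Re (z - w) = complex.Re z - complex.Re w.
Proof. by rewrite cReD cReN. Qed.
Lemma cImB z w : complex.Im (z - w) = complex.Im z - complex.Im w.
Proof. by rewrite cImD cImN. Qed.
Lemma cReM z w : complex.Re (z * w) =
  complex.Re z * complex.Re w - complex.Im z * complex.Im w.
Proof. by case: z w => [a b] [c d]. Qed.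
Lemma cImM z w : complex.Im (z * w) =
  complex.Re z * complex.Im w + complex.Im z * complex.Re w.
Proof. by case: z w => [a b] [c d]. Qed.
Lemma Re_nat n : complex.Re (n%:R : R[i]^o) = n%:R. Proof. by rewrite natrC. Qed.
Lemma Im_nat n : complex.Im (n%:R : R[i]^o) = 0. Proof. by rewrite natrC. Qed.
Lemma Re_sum (I : Type) (r : seq I) (P : pred I) (F : I -> R[i]^o) :
  complex.Re (\sum_(i <- r | P i) F i) = \sum_(i <- r | P i) complex.Re (F i).
Proof. exact: (big_morph _ cReD). Qed.
Lemma Im_sum (I : Type) (r : seq I) (P : pred I) (F : I -> R[i]^o) :
  complex.Im (\sum_(i <- r | P i) F i) = \sum_(i <- r | P i) complex.Im (F i).
Proof. exact: (big_morph _ cImD). Qed.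
Lemma sumC (I : Type) (r : seq I) (P : pred I) (F : I -> R) :
  (\sum_(i <- r | P i) (F i)%:C : R[i]) = (\sum_(i <- r | P i) F i)%:C.
Proof. by rewrite rmorph_sum. Qed.
Lemma complexP z w : complex.Re z = complex.Re w -> complex.Im z = complex.Im w -> z = w.
Proof. by case: z w => [a b] [c d] /= -> ->. Qed.

Lemma nmE z : nm z = Num.sqrt (complex.Re z ^+ 2 + complex.Im z ^+ 2).
Proof. by case: z. Qed.
Lemma nm_sqr z : nm z ^+ 2 = complex.Re z ^+ 2 + complex.Im z ^+ 2.
Proof. by rewrite nmE sqr_sqrtr// addr_ge0// sqr_ge0. Qed.
Lemma Re_le_nm z : `|complex.Re z| <= nm z.
Proof.
by rewrite nmE -(sqrtr_sqr (complex.Re z)) ler_wsqrtr// lerDl sqr_ge0.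
Qed.
Lemma Im_le_nm z : `|complex.Im z| <= nm z.
Proof.
by rewrite nmE -(sqrtr_sqr (complex.Im z)) ler_wsqrtr// lerDr sqr_ge0.
Qed.
Lemma nm_le z : nm z <= `|complex.Re z| + `|complex.Im z|.
Proof.
rewrite -ler_sqr ?nnegrE ?nm_ge0 ?addr_ge0// nm_sqr sqrrD !real_normK ?num_real//.
by rewrite lerD2r lerDl mulrn_wge0// mulr_ge0.
Qed.

(** Epsilon, delta and modulus are real, so estimates stay in the ordered field R; [cderivP]
    translates to [is_derive]. *)
Definition cderiv (f : R[i]^o -> R[i]^o) z d := forall e : R, 0 < e ->
  exists2 D : R, 0 < D & forall h, nm h < D -> nm (f (z + h) - f z - h * d) <= e * nm h.

Lemma cderivP f z d : cderiv f z d <-> is_derive z 1 f d.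
Proof.
split => [H|H].
  apply: is_derive_epsilon => -[e e'] /=; rewrite ltcE/= => /andP[/eqP -> e0].
  have [D D0 HD] := H e e0.
  exists (D%:C); first by rewrite ltcR.
  move=> h; rewrite /= !normC_nm ltcR => hD.
  have := HD h hD; rewrite -lecR rmorphM /= !complexr0 => Q.
  by rewrite [h *: 1]mulr1.
move=> e e0.
have [|[D D'] /=] := epsilon_is_derive H (e := e%:C); first by rewrite ltcR.
rewrite ltcE/= => /andP[/eqP -> D0] HD.
exists D => // h hD.
have := HD h; rewrite !normC_nm ltcR => /(_ hD).
rewrite [h *: 1]mulr1 -rmorphM lecR; exact.
Qed.

Lemma cderiv_cont f z d : cderiv f z d -> forall e : R, 0 < e ->
  exists2 D : R, 0 < D & forall h, nm h < D -> nm (f (z + h) - f z) <= e.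
Proof.
move=> H e e0; have [D D0 HD] := H 1 ltr01.
have q0 : 0 < 1 + nm d by rewrite ltr_wpDr ?nm_ge0.
exists (Num.min D (e / (1 + nm d))) => [|h].
  by rewrite lt_min D0 divr_gt0.
rewrite lt_min => /andP[hD he].
have -> : f (z + h) - f z = (f (z + h) - f z - h * d) + h * d by ring.
apply: le_trans (ler_nmD _ _) _; rewrite nmM.
apply: le_trans (lerD (HD h hD) (lexx _)) _.
move: he; rewrite ltr_pdivlMr// => /ltW; apply: le_trans.
by rewrite mul1r mulrDr mulr1.
Qed.

End ComplexBasics.

(** * The exponential *)

Section RealEstimates.
Context {R : realType}.

Lemma mean_value_bound (f f' : R -> R) (a b M : R) : a <= b ->
  (forall x : R, is_derive x 1 f (f' x)) ->
  (forall x, a <= x <= b -> `|f' x| <= M) -> `|f b - f a| <= M * (b - a).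
Proof.
move=> ab df f'M.
have cf : continuous f.
  by move=> x; apply/differentiable_continuous/derivable1_diffP; have [] := df x.
have [c] := @MVT_segment R f f' a b ab (fun x _ => df x) (continuous_subspaceT cf).
rewrite in_itv /= => cab ->.
by rewrite normrM (ger0_norm (x := b - a)) ?subr_ge0// ler_wpM2r ?subr_ge0// f'M.
Qed.

(** Applied repeatedly to derivatives of remainders, this gives the Taylor bounds for exp, sin and
    cos on both sides of 0. *)
Lemma mean_value_bound0 (f f' : R -> R) (a M : R) :
  (forall x : R, is_derive x 1 f (f' x)) ->
  (forall x, `|x| <= `|a| -> `|f' x| <= M) -> `|f a - f 0| <= M * `|a|.
Proof.
move=> df f'M.
have [a0|a0] := leP 0 a.
  rewrite (ger0_norm a0) -{2}(subr0 a).
  apply: mean_value_bound df _ => // x /andP[x0 xa]; apply: f'M.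
  by rewrite !ger0_norm.
rewrite distrC (ltr0_norm a0) -(sub0r a).
apply: mean_value_bound df _ => [|x /andP[x0 xa]]; first exact: ltW.
by apply: f'M; rewrite ler0_norm// ler0_norm ?lerN2// ltW.
Qed.

Lemma expR_sub1_bound (x : R) : `|expR x - 1| <= `|x| * expR `|x|.
Proof.
rewrite mulrC -expR0; apply: (@mean_value_bound0 expR expR) => y yx.
by rewrite ger0_norm ?expR_ge0// ler_expR (le_trans (ler_norm _)).
Qed.

Lemma expR_sub1x_bound (x : R) : `|expR x - 1 - x| <= `|x| ^+ 2 * expR `|x|.
Proof.
have /(_ x) := @mean_value_bound0 (fun y => expR y - y) (fun y => expR y - 1) _.
move=> /(_ (`|x| * expR `|x|)); rewrite expR0 subr0 => H.
have -> : expR x - 1 - x = expR x - x - 1 by ring.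
rewrite expr2 -mulrA [in leRHS]mulrC; apply: H => y yx.
apply: le_trans (expR_sub1_bound _) _.
by rewrite ler_pM ?expR_ge0// ler_expR.
Qed.

Lemma sin_bound (x : R) : `|sin x| <= `|x|.
Proof.
have := @mean_value_bound0 sin cos x 1 (fun y => is_derive_sin y).
by rewrite sin0 subr0 mul1r; apply => y _; exact: cos_max.
Qed.

Lemma cos_sub1_bound (x : R) : `|cos x - 1| <= `|x| ^+ 2.
Proof.
rewrite -(@cos0 R) expr2.
apply: (@mean_value_bound0 cos (fun y => - sin y)) => y yx.
by rewrite normrN (le_trans (sin_bound _)).
Qed.

Lemma sin_subx_bound (x : R) : `|sin x - x| <= `|x| ^+ 2 * `|x|.
Proof.
have /(_ x) := @mean_value_bound0 (fun y => sin y - y) (fun y => cos y - 1) _.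
move=> /(_ (`|x| ^+ 2)); rewrite sin0 !subr0; apply => y yx.
by apply: le_trans (cos_sub1_bound _) _; rewrite lerXn2r ?nnegrE.
Qed.

End RealEstimates.

Section ComplexExp.
Context {R : realType}.
Implicit Types (z w h : R[i]^o).

Lemma cexpD z w : cexp (z + w) = cexp z * cexp w.
Proof.
case: z w => [a b] [c d]; rewrite /cexp /=; apply: complexP => /=;
  rewrite expRD ?cosD ?sinD; ring.
Qed.
Lemma cexp0 : cexp 0 = 1 :> R[i]^o.
Proof. by rewrite /cexp /= expR0 cos0 sin0 mulr0 mulr1. Qed.
Lemma nm_cexp z : nm (cexp z) = expR (complex.Re z).
Proof.
by rewrite nmE /= !exprMn -mulrDr cos2Dsin2 mulr1 sqrtr_sqr ger0_norm ?expR_ge0.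
Qed.
Lemma cexp_neq0 z : cexp z != 0.
Proof. by rewrite -nm_gt0 nm_cexp expR_gt0. Qed.
Lemma cexpN z : cexp (- z) = (cexp z)^-1.
Proof.
by apply: (mulfI (cexp_neq0 z)); rewrite -cexpD subrr cexp0 divff// cexp_neq0.
Qed.
Lemma cexpMn n z : cexp (n%:R * z) = cexp z ^+ n.
Proof.
elim: n => [|n IH]; first by rewrite mul0r cexp0.
by rewrite exprS -IH -cexpD; congr cexp; rewrite -natr1; ring.
Qed.
Lemma cexp_sum (I : Type) (r : seq I) (P : pred I) (F : I -> R[i]^o) :
  cexp (\sum_(i <- r | P i) F i) = \prod_(i <- r | P i) cexp (F i).
Proof. exact: (big_morph _ cexpD cexp0). Qed.
Lemma cexp_real (x : R) : cexp x%:Co = (expR x)%:C.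
Proof. by rewrite /cexp /= cos0 sin0 mulr1 mulr0. Qed.

(** The bound is global: in [dirichlet_cderiv] the argument is a small number times an unbounded
    frequency. The real and the imaginary part split into two terms each, and each term is at most
    |h|^2 exp |h|, whence the 4. *)
Lemma cexp_sub1x_bound h : nm (cexp h - 1 - h) <= 4 * nm h ^+ 2 * expR (nm h).
Proof.
apply: le_trans (nm_le _) _.
have ha : `|complex.Re h| <= nm h := Re_le_nm h.
have hb : `|complex.Im h| <= nm h := Im_le_nm h.
set a := complex.Re h in ha *; set b := complex.Im h in hb *.
set n := nm h in ha hb *; set E := expR n.
have n0 : 0 <= n by exact: nm_ge0.
have E1 : 1 <= E by rewrite /E -expR0 ler_expR.
have Ea : expR a <= E by rewrite ler_expR (le_trans (ler_norm _)).
have Eaa : expR `|a| <= E by rewrite ler_expR.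
have a2 : `|a| ^+ 2 <= n ^+ 2 by rewrite lerXn2r ?nnegrE.
have b2 : `|b| ^+ 2 <= n ^+ 2 by rewrite lerXn2r ?nnegrE.
have -> : complex.Re (cexp h - 1 - h) = (expR a - 1 - a) + expR a * (cos b - 1).
  by rewrite !cReB /cexp /= -/a -/b; ring.
have -> : complex.Im (cexp h - 1 - h) = expR a * (sin b - b) + (expR a - 1) * b.
  by rewrite !cImB /cexp /= -/a -/b; ring.
have k1 : `|expR a - 1 - a| <= n ^+ 2 * E.
  apply: le_trans (expR_sub1x_bound _) _; rewrite ler_pM ?expR_ge0//.
have k2 : `|expR a * (cos b - 1)| <= E * n ^+ 2.
  rewrite normrM ger0_norm ?expR_ge0// ler_pM ?expR_ge0//.
  exact: le_trans (cos_sub1_bound _) _.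
(* The cubic Taylor bound is enough only for |b| <= 1; beyond that, |cos y - 1| <= |b| for |y| <=
   |b| gives |b|^2. *)
have sb : `|sin b - b| <= n ^+ 2.
  have [b1|b1] := leP `|b| 1.
    apply: le_trans (sin_subx_bound _) _.
    by apply: le_trans b2; rewrite ler_piMr// exprn_ge0.
  have /(_ b) := @mean_value_bound0 R (fun y => sin y - y) (fun y => cos y - 1) _.
  move=> /(_ (`|b|)); rewrite sin0 !subr0 => H.
  apply: le_trans b2; rewrite expr2; apply: H => y yb.
  have [y1|y1] := leP `|y| 1.
    apply: le_trans (cos_sub1_bound _) _; rewrite expr2.
    by apply: le_trans yb; rewrite ler_piMr.
  have := @mean_value_bound0 R cos (fun y => - sin y) y 1.
  rewrite cos0 mul1r => H2; apply: le_trans yb; apply: H2 => t _.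
  by rewrite normrN sin_max.
have k3 : `|expR a * (sin b - b)| <= E * n ^+ 2.
  by rewrite normrM ger0_norm ?expR_ge0// ler_pM ?expR_ge0.
have k4 : `|(expR a - 1) * b| <= n * E * n.
  rewrite normrM ler_pM//; apply: le_trans (expR_sub1_bound _) _.
  by rewrite ler_pM ?expR_ge0.
apply: le_trans (lerD (ler_normD _ _) (ler_normD _ _)) _.
apply: le_trans (lerD (lerD k1 k2) (lerD k3 k4)) _.
by rewrite le_eqVlt; apply/orP; left; apply/eqP; ring.
Qed.

Lemma cexp_cderiv z : cderiv cexp z (cexp z).
Proof.
move=> e e0.
have c0 : 0 < nm (cexp z) * 4 * expR 1.
  by rewrite !mulr_gt0 ?expR_gt0// nm_gt0 cexp_neq0.
exists (Num.min 1 (e / (nm (cexp z) * 4 * expR 1))).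
  by rewrite lt_min ltr01 divr_gt0.
move=> h; rewrite lt_min => /andP[h1]; rewrite ltr_pdivlMr// => he.
have -> : cexp (z + h) - cexp z - h * cexp z = cexp z * (cexp h - 1 - h).
  by rewrite cexpD; ring.
rewrite nmM; apply: le_trans (ler_wpM2l (nm_ge0 _) (cexp_sub1x_bound _)) _.
have -> : nm (cexp z) * (4 * nm h ^+ 2 * expR (nm h)) =
  (nm h * (nm (cexp z) * 4 * expR (nm h))) * nm h by ring.
apply: ler_wpM2r; first exact: nm_ge0.
apply: le_trans (ltW he); rewrite ler_wpM2l ?nm_ge0// ler_wpM2l ?mulr_ge0 ?nm_ge0//.
by rewrite ler_expR ltW.
Qed.

Lemma cderiv_comp (f g : R[i]^o -> R[i]^o) z a b :
  cderiv f (g z) a -> cderiv g z b -> cderiv (f \o g) z (a * b).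
Proof.
move=> df dg e e0.
have b1 : 0 < nm b + 1 by rewrite ltr_wpDl ?nm_ge0.
have a1 : 0 < nm a + 1 by rewrite ltr_wpDl ?nm_ge0.
have [D1 D10 H1] := df (e / 2 / (nm b + 1)) ltac:(by rewrite !divr_gt0).
have [D2 D20 H2] := dg (Num.min 1 (e / 2 / (nm a + 1)))
  ltac:(by rewrite lt_min ltr01 !divr_gt0).
exists (Num.min D2 (D1 / (nm b + 1))); first by rewrite lt_min D20 divr_gt0.
move=> h; rewrite lt_min => /andP[hD2]; rewrite ltr_pdivlMr// => hD1 /=.
have := H2 h hD2; set k := g (z + h) - g z => H2h.
have kb : nm k <= (nm b + 1) * nm h.
  have -> : k = (k - h * b) + h * b by ring.
  apply: le_trans (ler_nmD _ _) _; rewrite nmM [leRHS]mulrDl [leRHS]addrC mul1r.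
  rewrite [nm h * _]mulrC lerD2r; apply: le_trans H2h _.
  by rewrite -{2}(mul1r (nm h)) ler_wpM2r ?nm_ge0// ge_min lexx.
have kD : nm k < D1 by apply: le_lt_trans kb _; rewrite mulrC.
have -> : g (z + h) = g z + k by rewrite /k; ring.
have -> : f (g z + k) - f (g z) - h * (a * b) =
  (f (g z + k) - f (g z) - k * a) + a * (k - h * b) by ring.
apply: le_trans (ler_nmD _ _) _; rewrite nmM.
have -> : e * nm h = e / 2 / (nm b + 1) * ((nm b + 1) * nm h) +
     (nm a + 1) * (e / 2 / (nm a + 1) * nm h).
  by field; rewrite !gt_eqF.
apply: lerD.
  apply: le_trans (H1 k kD) _; apply: ler_wpM2l kb.
  by rewrite !divr_ge0 ?ltW// addr_ge0 ?nm_ge0.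
apply: ler_pM; rewrite ?nm_ge0 ?lerDl//.
apply: le_trans H2h _; rewrite ler_wpM2r ?nm_ge0//.
by rewrite ge_min lexx orbT.
Qed.

Lemma cderivM (f g : R[i]^o -> R[i]^o) z a b :
  cderiv f z a -> cderiv g z b ->
  cderiv (fun w => f w * g w) z (f z * b + g z * a).
Proof. by move=> /cderivP df /cderivP dg; apply/cderivP. Qed.
Lemma cderivD (f g : R[i]^o -> R[i]^o) z a b :
  cderiv f z a -> cderiv g z b -> cderiv (fun w => f w + g w) z (a + b).
Proof. by move=> /cderivP df /cderivP dg; apply/cderivP. Qed.
Lemma cderivB (f g : R[i]^o -> R[i]^o) z a b :
  cderiv f z a -> cderiv g z b -> cderiv (fun w => f w - g w) z (a - b).
Proof. by move=> /cderivP df /cderivP dg; apply/cderivP. Qed.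
Lemma cderiv_cst (c : R[i]^o) z : cderiv (fun=> c) z 0.
Proof. by apply/cderivP. Qed.
Lemma cderiv_id z : cderiv id z 1.
Proof. by apply/cderivP. Qed.
Lemma cderivMl (f : R[i]^o -> R[i]^o) z a c :
  cderiv f z a -> cderiv (fun w => c * f w) z (c * a).
Proof.
by move=> df; have := cderivM (cderiv_cst c z) df; rewrite mulr0 addr0.
Qed.
Lemma cderiv_affine (a b z : R[i]^o) : cderiv (fun w => a * w + b) z a.
Proof.
have := cderivD (cderivMl a (cderiv_id z)) (cderiv_cst b z).
by rewrite mulr1 addr0.
Qed.
Lemma cderiv_ext (f g : R[i]^o -> R[i]^o) z a :
  f =1 g -> cderiv f z a -> cderiv g z a.
Proof. by move=> /funext ->. Qed.
Lemma cderiv_eq (f : R[i]^o -> R[i]^o) z a b :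
  cderiv f z a -> a = b -> cderiv f z b.
Proof. by move=> ? <-. Qed.
Lemma cderiv_near (f g : R[i]^o -> R[i]^o) z a (D : R) : 0 < D ->
  (forall h, nm h < D -> f (z + h) = g (z + h)) -> cderiv f z a -> cderiv g z a.
Proof.
move=> D0 fg df e e0; have [D' D'0 H] := df e e0.
exists (Num.min D D') => [|h]; rewrite lt_min ?D0// => /andP[h1 h2].
have fz : f z = g z by have := fg 0; rewrite nm0 addr0; exact.
by rewrite -fg// -fz; exact: H.
Qed.

End ComplexExp.

(** * The logarithm and complex powers *)

Section ComplexLog.
Context {R : realType}.
Implicit Types (z w h s : R[i]^o).

Lemma Re_div_nm_itv w : w != 0 -> -1 <= complex.Re w / nm w <= 1.
Proof.
rewrite -nm_gt0 => w0; rewrite -ler_norml normrM normfV (ger0_norm (nm_ge0 _)).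
by rewrite ler_pdivrMr// mul1r Re_le_nm.
Qed.

Lemma Im_gt0_neq0 w : 0 < complex.Im w -> w != 0.
Proof. by apply: contraTneq => ->; rewrite ltxx. Qed.

Lemma Re_div_nm_itv_strict w : 0 < complex.Im w -> -1 < complex.Re w / nm w < 1.
Proof.
move=> w0; have := Im_gt0_neq0 w0; rewrite -nm_gt0 => n0.
rewrite -ltr_norml normrM normfV (ger0_norm (nm_ge0 _)).
rewrite ltr_pdivrMr// mul1r -ltr_sqr ?nnegrE ?nm_ge0//.
by rewrite nm_sqr real_normK ?num_real// ltrDl exprn_gt0.
Qed.

Lemma carg_upper w : 0 <= complex.Im w -> w != 0 -> 0 <= carg w <= pi.
Proof.
by move=> w0 w1; rewrite /carg w0 acos_ge0 ?acos_lepi ?Re_div_nm_itv.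
Qed.

Lemma cexp_clog w : 0 <= complex.Im w -> w != 0 -> cexp (clog w) = w.
Proof.
move=> w0 w1; have n0 : 0 < nm w by rewrite nm_gt0.
have r1 := Re_div_nm_itv w1.
rewrite /cexp /clog /= -!/(nm _) lnK ?posrE// /carg w0 -/(nm _).
rewrite acosK ?in_itv//= sin_acos//; apply: complexP => /=.
  by rewrite mulrC divfK// gt_eqF.
have -> : 1 - (complex.Re w / nm w) ^+ 2 = (complex.Im w / nm w) ^+ 2.
  rewrite !exprMn !exprVn nm_sqr; field.
  by rewrite -nm_sqr expf_neq0// gt_eqF.
rewrite sqrtr_sqr ger0_norm ?divr_ge0 ?nm_ge0//.
by rewrite mulrC divfK// gt_eqF.
Qed.

Lemma clog_real_mul (c : R) w : 0 < c -> w != 0 ->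
  clog (c%:Co * w) = (ln c)%:Co + clog w.
Proof.
move=> c0 w0; have n0 : 0 < nm w by rewrite nm_gt0.
have Re_c : complex.Re (c%:Co * w) = c * complex.Re w by rewrite cReM /=; ring.
have Im_c : complex.Im (c%:Co * w) = c * complex.Im w by rewrite cImM /=; ring.
have nm_c : nm (c%:Co * w) = c * nm w by rewrite nmM nm_real gtr0_norm.
apply: complexP; rewrite ?cReD ?cImD /= -?/(nm _) ?nm_c.
  by rewrite lnM ?posrE.
rewrite add0r /carg -!/(nm _) Re_c Im_c nm_c pmulr_rge0// -mulf_div divff ?mul1r//.
by rewrite gt_eqF.
Qed.

(** The quotient is the cosine of the argument; composed with [acos], this estimate yields
    continuity of [carg]. *)
Lemma Re_div_nm_lipschitz w h : w != 0 -> w + h != 0 ->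
  `|complex.Re (w + h) / nm (w + h) - complex.Re w / nm w| <= 2 * nm h / nm w.
Proof.
rewrite -!nm_gt0 => n0 m0.
have -> : complex.Re (w + h) / nm (w + h) - complex.Re w / nm w =
  ((complex.Re (w + h) - complex.Re w) * nm (w + h) +
   complex.Re (w + h) * (nm w - nm (w + h))) / (nm (w + h) * nm w).
  by field; rewrite !gt_eqF.
rewrite normrM normfV (gtr0_norm (x := nm (w + h) * _)) ?mulr_gt0//.
rewrite ler_pdivrMr ?mulr_gt0//.
have -> : 2 * nm h / nm w * (nm (w + h) * nm w) = nm h * nm (w + h) + nm (w + h) * nm h.
  by field; rewrite gt_eqF.
apply: le_trans (ler_normD _ _) _; rewrite !normrM lerD//.
  rewrite (ger0_norm (nm_ge0 _)) ler_wpM2r ?nm_ge0//.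
  by rewrite cReD addrAC subrr add0r Re_le_nm.
apply: ler_pM => //; first exact: Re_le_nm.
rewrite ler_norml; apply/andP; split.
  rewrite lerNl opprB; apply: le_trans (ler_nm_sub _ _) _.
  by rewrite addrAC subrr add0r.
by apply: le_trans (ler_nm_sub _ _) _; rewrite opprD addrA subrr sub0r nmN.
Qed.

(** In the open upper half plane the cosine of the argument lies strictly between -1 and 1, where
    [acos] is continuous. A displacement shorter than Im w does not leave the half plane. *)
Lemma clog_continuous w : 0 < complex.Im w -> forall e : R, 0 < e ->
  exists2 D : R, 0 < D & forall h, nm h < D -> nm (clog (w + h) - clog w) <= e.
Proof.
move=> w0 e e0; have w1 := Im_gt0_neq0 w0; have n0 : 0 < nm w by rewrite nm_gt0.
have e20 : 0 < e / 2 by rewrite divr_gt0.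
have cl := @continuous_ln R _ n0.
have ca := @continuous_acos R _ (Re_div_nm_itv_strict w0).
move/cvgrPdist_le/(_ _ e20)/nbhs_ballP : cl => -[D1 /= D10 H1].
move/cvgrPdist_le/(_ _ e20)/nbhs_ballP : ca => -[D2 /= D20 H2].
exists (Num.min (complex.Im w) (Num.min D1 (D2 * nm w / 2))).
  by rewrite !lt_min w0 D10 divr_gt0// mulr_gt0.
move=> h; rewrite !lt_min => /and3P[h0 h1 h2].
have Ih : 0 < complex.Im (w + h).
  rewrite cImD -ltrBlDl sub0r; apply: lt_le_trans (_ : - nm h <= _); rewrite ?ltrN2//.
  by rewrite lerNl (le_trans _ (Im_le_nm h))// -normrN ler_norm.
have wh0 := Im_gt0_neq0 Ih.
apply: le_trans (nm_le _) _; rewrite cReB cImB /= (splitr e) lerD//.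
  rewrite distrC; apply: H1 => /=.
  have k1 : w + h - w = h by ring.
  have k2 : w - (w + h) = - h by ring.
  have := ler_nm_sub w (w + h); have := ler_nm_sub (w + h) w.
  rewrite k1 k2 nmN.
  by rewrite /ball /= -?/(nm _) ltr_norml; move: h1 => u1 u2 u3; apply/andP; split; lra.
rewrite /carg (ltW Ih) (ltW w0) /= -?/(nm _) distrC; apply: H2; rewrite /ball /= distrC.
apply: le_lt_trans (Re_div_nm_lipschitz w1 wh0) _.
by rewrite ltr_pdivrMr// mulrC -ltr_pdivlMr.
Qed.

(** Inverse function argument: for u = clog (w + h) - clog w, differentiability of [cexp] at clog w
    bounds h - u w by a small multiple of u, and continuity of [clog] makes u small enough for
    that. *)
Lemma clog_cderiv w : 0 < complex.Im w -> cderiv (@clog R) w w^-1.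
Proof.
move=> w0 e e0; have w1 := Im_gt0_neq0 w0; have n0 : 0 < nm w by rewrite nm_gt0.
(* The first bound yields |u| <= 2 |h| / |w|; with this, the second makes the final error e |h|
   after division by w. *)
pose e1 := Num.min (nm w / 2) (e * nm w ^+ 2 / 2).
have e10 : 0 < e1 by rewrite lt_min !divr_gt0// mulr_gt0// exprn_gt0.
have [D1 D10 H1] := cexp_cderiv (clog w) e10.
have D120 : 0 < D1 / 2 by rewrite divr_gt0.
have [D2 D20 H2] := clog_continuous w0 D120.
exists (Num.min (complex.Im w) D2); first by rewrite lt_min w0.
move=> h; rewrite lt_min => /andP[h0 hD].
have Ih : 0 < complex.Im (w + h).
  rewrite cImD -ltrBlDl sub0r; apply: lt_le_trans (_ : - nm h <= _); rewrite ?ltrN2//.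
  by rewrite lerNl (le_trans _ (Im_le_nm h))// -normrN ler_norm.
have wh0 := Im_gt0_neq0 Ih.
have := H2 h hD; set u := clog (w + h) - clog w => uD.
have := H1 u (le_lt_trans uD _); rewrite ltr_pdivrMr// mulr_natr mulr2n ltrDl => /(_ D10).
have -> : clog w + u = clog (w + h) by rewrite /u; ring.
rewrite !cexp_clog ?(ltW Ih) ?(ltW w0) // (addrAC w h) subrr add0r => H.
have u2 : nm u <= 2 * nm h / nm w.
  rewrite ler_pdivlMr// -nmM.
  have k1 : nm (u * w) <= nm h + e1 * nm u.
    have -> : u * w = h - (h - u * w) by ring.
    exact: le_trans (ler_nmB _ _) (lerD (lexx _) H).
  have k2 : e1 * nm u <= nm (u * w) / 2.
    by rewrite nmM mulrAC -mulrA mulrC ler_wpM2l ?nm_ge0// /e1 ge_min mulrC lexx.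
  by move: k1 k2; lra.
have -> : u - h * w^-1 = - (h - u * w) / w by field.
rewrite nmM nmN nmV ler_pdivrMr//.
apply: le_trans H _.
have k3 : e1 * nm u <= (e * nm w ^+ 2 / 2) * (2 * nm h / nm w).
  apply: ler_pM; rewrite ?nm_ge0 ?(ltW e10) //.
  by rewrite /e1 ge_min lexx orbT.
apply: le_trans k3 _.
by rewrite le_eqVlt; apply/orP; left; apply/eqP; field; rewrite gt_eqF.
Qed.

Lemma nm_cpowN w s : nm (cpowN w s) =
  expR (complex.Im s * carg w) * expR (- complex.Re s * ln (nm w)).
Proof. by rewrite /cpowN nm_cexp -expRD cReN cReM /=; congr expR; ring. Qed.

(** The argument lies in [0, pi] here, so the imaginary part of s costs only a constant factor. *)
Lemma nm_cpowN_le w s : 0 <= complex.Im w -> w != 0 ->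
  nm (cpowN w s) <= expR (pi * `|complex.Im s|) * (nm w) `^ (- complex.Re s).
Proof.
move=> w0 w1; rewrite nm_cpowN /powR nm_eq0 (negbTE w1).
rewrite ler_wpM2r ?expR_ge0// ler_expR.
have /andP[c0 c1] := carg_upper w0 w1.
apply: le_trans (ler_norm _) _; rewrite normrM (ger0_norm c0) mulrC.
exact: ler_wpM2r.
Qed.

Lemma cpowND w s t : cpowN w (s + t) = cpowN w s * cpowN w t.
Proof. by rewrite /cpowN -cexpD; congr cexp; ring. Qed.

Lemma cpowN_nat w n : 0 <= complex.Im w -> w != 0 -> cpowN w n%:R = w ^- n.
Proof.
by move=> w0 w1; rewrite /cpowN cexpN cexpMn cexp_clog.
Qed.

Lemma cpowN_real_mul (c : R) w s : 0 < c -> w != 0 ->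
  cpowN (c%:Co * w) s = cexp (- (s * (ln c)%:Co)) * cpowN w s.
Proof.
by move=> c0 w0; rewrite /cpowN clog_real_mul// -cexpD; congr cexp; ring.
Qed.

Lemma cpowN_cderiv w s : 0 < complex.Im w ->
  cderiv (cpowN ^~ s) w (- s * cpowN w (s + 1)).
Proof.
move=> w0; have w1 := Im_gt0_neq0 w0.
have := @cderiv_comp R cexp (fun w => - s * clog w) w _ _ (cexp_cderiv _)
  (cderivMl (- s) (clog_cderiv w0)).
move=> H; apply: (cderiv_eq (cderiv_ext _ H)) => [x /=|].
  by rewrite /cpowN mulNr.
have -> : cpowN w (s + 1) = cpowN w s / w.
  by rewrite cpowND -[1]/(1%:R) cpowN_nat ?(ltW w0) // expr1.
rewrite /cpowN mulNr; ring.
Qed.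

End ComplexLog.

(** * Integrals of complex-valued functions of a real variable *)

Section RealPrimitive.
Context {R : realType}.
Implicit Types (f g F : R -> R) (a b c x : R).

Lemma derive_eq_near f g F x (e : R) : 0 < e -> (forall y, `|x - y| < e -> F y = g y) ->
  is_derive x 1 g (f x) -> is_derive x 1 F (f x).
Proof.
move=> e0 H; apply: near_eq_is_derive; apply/nbhs_ballP; exists e => // y /=.
by rewrite /ball /= => /H.
Qed.

Lemma primitive_unique_itv f F G (N y : R) :
  (forall x, - N < x < N -> is_derive x 1 F (f x)) ->
  (forall x, - N < x < N -> is_derive x 1 G (f x)) ->
  F 0 = G 0 -> - N < y < N -> F y = G y.
Proof.
move=> dF dG FG0 /andP[Ny yN].
have N0 : 0 < N by lra.
have dFG x : - N < x < N -> is_derive x 1 (F - G) 0.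
  move=> xN; have := dF x xN; have := dG x xN => h1 h2.
  by rewrite -(subrr (f x)); exact: is_deriveB.
have cFG u v : - N < u -> v < N -> {within `[u, v], continuous (F - G)}.
  move=> uN vN; apply: derivable_within_continuous => t; rewrite in_itv /= => /andP[ut tv].
  by have [] := dFG t ltac:(apply/andP; split; lra).
have mvt u v : - N < u -> u <= v -> v < N -> (F - G) v = (F - G) u.
  move=> uN uv vN.
  have dI t : t \in `]u, v[ -> is_derive t 1 (F - G) ((fun=> 0) t).
    by rewrite in_itv /= => /andP[ut tv]; apply: dFG; apply/andP; split; lra.
  have [t _] := MVT_segment uv dI (cFG _ _ uN vN).
  by rewrite mul0r => /eqP; rewrite subr_eq0 => /eqP.
have : (F - G) y = (F - G) 0.
  have [y0|y0] := leP 0 y; first by apply: mvt => //; lra.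
  by apply/esym; apply: mvt => //; lra.
rewrite -[(F - G) y]/(F y - G y) -[(F - G) 0]/(F 0 - G 0) FG0 subrr.
by move/eqP; rewrite subr_eq0 => /eqP.
Qed.

(** The fundamental theorem works from a fixed base point, here - n, and gives a primitive on ]-n,
    n[. Normalised at 0, these primitives agree where they overlap and can be glued. *)
Lemma primitive_exists f : continuous f -> exists F, forall x : R, is_derive x 1 F (f x).
Proof.
move=> cf.
pose G0 (n : nat) x := (\int[lebesgue_measure]_(t in `[- n%:R, x]) f t)%R.
have loc x : forall n : nat, - n%:R < x < n%:R -> is_derive x 1 (G0 n) (f x).
  move=> n /andP[nx xn].
  have intf : lebesgue_measure.-integrable
      [set` Interval (BLeft (- n%:R)) (BRight n%:R)] (EFin \o f).
    apply: continuous_compact_integrable; first exact: segment_compact.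
    exact: continuous_subspaceT.
  have [|dF eF] := @continuous_FTC1 R f (BLeft (- n%:R)) x n%:R xn intf _ (cf x).
    by rewrite lte_fin.
  by apply: (DeriveDef dF); rewrite -derive1E.
pose G (n : nat) x := G0 n x - G0 n 0.
have dG n x : - n%:R < x < n%:R -> is_derive x 1 (G n) (f x).
  move=> /loc H; have : is_derive x 1 (G0 n - cst (G0 n 0)) (f x - 0).
    exact: is_deriveB.
  by rewrite subr0.
have GG n m x : (n <= m)%N -> - n%:R < x < n%:R -> G n x = G m x.
  move=> nm xn; apply: (@primitive_unique_itv f _ _ n%:R) => //.
  - move=> y /andP[y1 y2]; apply: dG; have : n%:R <= m%:R :> R by rewrite ler_nat.
    by move=> ?; apply/andP; split; lra.
  - by rewrite /G !subrr.
pose N x := (Num.truncn `|x|).+1.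
have NP x : - (N x)%:R < x < (N x)%:R.
  rewrite -ltr_norml; exact: truncnS_gt.
exists (fun x => G (N x) x) => x.
apply: (@derive_eq_near f (G (N x)) _ x ((N x)%:R - `|x|)).
- by rewrite subr_gt0 ltr_norml NP.
- move=> y xy.
  have yN : - (N x)%:R < y < (N x)%:R.
    rewrite -ltr_norml; apply: le_lt_trans (_ : `|x| + `|x - y| < _); last by lra.
    by rewrite -{1}(subKr x y) (le_trans (ler_normB _ _)).
  by have [/GG->|/ltnW/GG->] := leqP (N x) (N y).
exact: dG.
Qed.

(* Only used for continuous [f]; the default value is a placeholder. *)
Definition primitive f : R -> R := xget (fun=> 0) [set F | forall x : R, is_derive x 1 F (f x)].

Lemma primitiveP f F : (forall x : R, is_derive x 1 F (f x)) ->
  forall x : R, is_derive x 1 (primitive f) (f x).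
Proof.
move=> dF; rewrite /primitive.
by have := @xgetPex _ (fun=> 0) [set F | forall x : R, is_derive x 1 F (f x)]
  (ex_intro _ _ dF).
Qed.

Lemma primitive_sub f F a b : (forall x : R, is_derive x 1 F (f x)) ->
  primitive f b - primitive f a = F b - F a.
Proof.
move=> dF; have dp := primitiveP dF.
have : (primitive f - F) b = (primitive f - F) a.
  apply: is_derive_0_is_cst => x; have h1 := dF x; have h2 := dp x.
  by rewrite -(subrr (f x)); exact: is_deriveB.
rewrite -[(primitive f - F) b]/(primitive f b - F b) -[(primitive f - F) a]/(primitive f a - F a).
by lra.
Qed.

End RealPrimitive.

Section ComplexIntegral.
Context {R : realType}.
Implicit Types (f g F phi psi : R -> R[i]^o) (a b c x : R).

Definition ccont f := continuous (fun x => complex.Re (f x)) /\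
  continuous (fun x => complex.Im (f x)).

(** Componentwise, so that the real mean value theorem applies to each part. *)
Definition rderiv F x (d : R[i]^o) :=
  is_derive x 1 (fun x => complex.Re (F x)) (complex.Re d) /\
  is_derive x 1 (fun x => complex.Im (F x)) (complex.Im d).

Definition cprim f x : R[i]^o :=
  primitive (fun x => complex.Re (f x)) x +i* primitive (fun x => complex.Im (f x)) x.

(** With the integral as increment of a primitive, Chasles' relation is algebra and the fundamental
    theorem is uniqueness of primitives up to a constant. *)
Definition cint f a b : R[i]^o := cprim f b - cprim f a.

Lemma cint_FTC f F a b : (forall x, rderiv F x (f x)) -> cint f a b = F b - F a.
Proof.
move=> dF; apply: complexP; rewrite /cint !(cReB, cImB) /=.
  exact: (primitive_sub _ _ (fun x => (dF x).1)).
exact: (primitive_sub _ _ (fun x => (dF x).2)).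
Qed.

Lemma cprimP f : ccont f -> forall x, rderiv (cprim f) x (f x).
Proof.
move=> [/primitive_exists[F dF] /primitive_exists[G dG]] x.
by split; [exact: primitiveP dF x|exact: primitiveP dG x].
Qed.

Lemma cint_chasles f a b c : cint f a b + cint f b c = cint f a c.
Proof. by rewrite /cint; ring. Qed.

Lemma cintxx f a : cint f a a = 0.
Proof. by rewrite /cint subrr. Qed.

Lemma eq_cint f g a b : f =1 g -> cint f a b = cint g a b.
Proof. by move=> /funext ->. Qed.

Lemma is_derive_ext (f g : R -> R) x (d e : R) : f =1 g -> d = e ->
  is_derive x 1 f d -> is_derive x 1 g e.
Proof. by move=> fg <-; rewrite (_ : f = g)//; apply/funext => y; exact: fg. Qed.

Lemma rderivD F G x d e : rderiv F x d -> rderiv G x e ->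
  rderiv (fun x => F x + G x) x (d + e).
Proof.
move=> [F1 F2] [G1 G2]; split.
  by apply: is_derive_ext (is_deriveD F1 G1) => [y|]; rewrite ?cReD.
by apply: is_derive_ext (is_deriveD F2 G2) => [y|]; rewrite ?cImD.
Qed.

Lemma rderivZ F x d (c : R[i]^o) : rderiv F x d -> rderiv (fun x => c * F x) x (c * d).
Proof.
move=> [F1 F2]; split.
  apply: is_derive_ext (is_deriveB (is_deriveZ (complex.Re c) F1)
    (is_deriveZ (complex.Im c) F2)) => [y|]; by rewrite ?cReM.
apply: is_derive_ext (is_deriveD (is_deriveZ (complex.Re c) F2)
    (is_deriveZ (complex.Im c) F1)) => [y|]; by rewrite ?cImM.
Qed.

Lemma rderiv_affine F x d (c e : R) : rderiv F (c * x + e) d ->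
  rderiv (fun x => F (c * x + e)) x (c%:Co * d).
Proof.
have da : is_derive x 1 (fun x => c * x + e) c.
  apply: is_derive_ext (is_deriveD (is_deriveZ c (is_derive_id x 1))
    (is_derive_cst e x 1)) => [//|].
  by rewrite addr0 /GRing.scale /= mulr1.
move=> [F1 F2]; split.
  apply: is_derive_ext (@is_derive1_comp _ (fun x => complex.Re (F x))
    (fun x => c * x + e) x _ _ F1 da) => [//|].
  by rewrite cReM /= mul0r subr0 mulrC.
apply: is_derive_ext (@is_derive1_comp _ (fun x => complex.Im (F x))
    (fun x => c * x + e) x _ _ F2 da) => [//|].
by rewrite cImM /= mul0r addr0 mulrC.
Qed.

Lemma cintD f g a b : ccont f -> ccont g ->
  cint (fun x => f x + g x) a b = cint f a b + cint g a b.
Proof.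
move=> cf cg; rewrite (@cint_FTC _ (fun x => cprim f x + cprim g x)).
  by rewrite /cint; ring.
by move=> x; apply: rderivD; exact: cprimP.
Qed.

Lemma cintZ f a b (c : R[i]^o) : ccont f -> cint (fun x => c * f x) a b = c * cint f a b.
Proof.
move=> cf; rewrite (@cint_FTC _ (fun x => c * cprim f x)).
  by rewrite /cint; ring.
by move=> x; apply: rderivZ; exact: cprimP.
Qed.

Lemma cintB f g a b : ccont f -> ccont g ->
  cint (fun x => f x - g x) a b = cint f a b - cint g a b.
Proof.
move=> cf cg; rewrite (@cint_FTC _ (fun x => cprim f x + (-1) * cprim g x)).
  by rewrite /cint; ring.
move=> x; rewrite -[- g x]mulN1r.
by apply: rderivD; [exact: cprimP|apply: rderivZ; exact: cprimP].
Qed.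

Lemma cint_affine f a b (c e : R) : ccont f ->
  cint (fun x => c%:Co * f (c * x + e)) a b = cint f (c * a + e) (c * b + e).
Proof.
move=> cf; rewrite (@cint_FTC _ (fun x => cprim f (c * x + e))) //.
by move=> x; apply: rderiv_affine; exact: cprimP.
Qed.

(** The factor 2 comes from treating real and imaginary parts separately by the mean value
    theorem. *)
Lemma cint_bound f a b (M : R) : ccont f -> a <= b ->
  (forall x, a <= x <= b -> nm (f x) <= M) -> nm (cint f a b) <= 2 * M * (b - a).
Proof.
move=> cf ab fM; apply: le_trans (nm_le _) _.
have -> : 2 * M * (b - a) = M * (b - a) + M * (b - a) by ring.
rewrite /cint cReB cImB; apply: lerD.
  apply: (@mean_value_bound _ (fun x => complex.Re (cprim f x)) (fun x => complex.Re (f x))) => // x.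
    by have [] := cprimP cf x.
  by move=> /fM; apply: le_trans; exact: Re_le_nm.
apply: (@mean_value_bound _ (fun x => complex.Im (cprim f x)) (fun x => complex.Im (f x))) => // x.
  by have [] := cprimP cf x.
by move=> /fM; apply: le_trans; exact: Im_le_nm.
Qed.

Lemma cint_Re_ge f a b (m : R) : ccont f -> a <= b ->
  (forall x, a <= x <= b -> m <= complex.Re (f x)) ->
  m * (b - a) <= complex.Re (cint f a b).
Proof.
move=> cf ab fm; rewrite /cint cReB.
have dp x : is_derive x 1 (fun x => complex.Re (cprim f x)) (complex.Re (f x)).
  by have [] := cprimP cf x.
have cp : continuous (fun x => complex.Re (cprim f x)).
  by move=> x; apply/differentiable_continuous/derivable1_diffP; have [] := dp x.
have [c] := @MVT_segment R _ _ a b ab (fun x _ => dp x) (continuous_subspaceT cp).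
rewrite in_itv /= => cab ->.
by rewrite ler_wpM2r ?subr_ge0// fm.
Qed.

Lemma rderiv_epsilon F x d :
  (forall e : R, 0 < e -> exists2 D : R, 0 < D &
    forall h : R, `|h| < D -> nm (F (x + h) - F x - h%:Co * d) <= e * `|h|) ->
  rderiv F x d.
Proof.
move=> H; split; apply: is_derive_epsilon => e e0; have [D D0 HD] := H e e0;
  exists D => // h /HD; apply: le_trans; rewrite [h *: 1]mulr1.
  apply: le_trans (Re_le_nm _); rewrite !cReB cReM /= mul0r subr0.
  by rewrite /GRing.scale /=.
apply: le_trans (Im_le_nm _); rewrite !cImB cImM /= mul0r addr0.
by rewrite /GRing.scale /=.
Qed.

Lemma cderiv_rderiv (f : R[i]^o -> R[i]^o) (z v d : R[i]^o) x :
  cderiv f (z + x%:Co * v) d -> rderiv (fun x => f (z + x%:Co * v)) x (v * d).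
Proof.
move=> H; apply: rderiv_epsilon => e e0.
have v0 : 0 < nm v + 1 by rewrite ltr_wpDl ?nm_ge0.
have [|D D0 HD] := H (e / (nm v + 1)); first by rewrite divr_gt0.
exists (D / (nm v + 1)); first by rewrite divr_gt0.
move=> h; rewrite ltr_pdivlMr// => hD.
have hv : nm (h%:Co * v) <= `|h| * (nm v + 1).
  by rewrite nmM nm_real ler_wpM2l// lerDl.
have := HD (h%:Co * v) (le_lt_trans hv hD).
have -> : z + x%:Co * v + h%:Co * v = z + (x + h)%:Co * v by rewrite rmorphD /=; ring.
rewrite mulrA => /le_trans; apply.
apply: le_trans (ler_wpM2l _ hv) _; first by rewrite divr_ge0 ?ltW.
by rewrite le_eqVlt; apply/orP; left; apply/eqP; field; rewrite gt_eqF.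
Qed.

Lemma ccont_epsilon F : (forall x (e : R), 0 < e -> exists2 D : R, 0 < D &
    forall h : R, `|h| < D -> nm (F (x + h) - F x) <= e) -> ccont F.
Proof.
move=> H; split => x; apply/cvgrPdist_le => e e0; have [D D0 HD] := H x e e0;
  apply/nbhs_ballP; exists D => // y; rewrite /ball /= => xy; rewrite distrC.
  have := HD (y - x); rewrite (distrC y x) [x + _]addrC subrK => /(_ xy).
  by apply: le_trans; rewrite -cReB Re_le_nm.
have := HD (y - x); rewrite (distrC y x) [x + _]addrC subrK => /(_ xy).
by apply: le_trans; rewrite -cImB Im_le_nm.
Qed.

Lemma epsilon_ccont F : ccont F -> forall x (e : R), 0 < e -> exists2 D : R, 0 < D &
    forall h : R, `|h| < D -> nm (F (x + h) - F x) <= e.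
Proof.
move=> [F1 F2] x e e0.
have e20 : 0 < e / 2 by rewrite divr_gt0.
have /cvgrPdist_le/(_ _ e20)/nbhs_ballP[D1 /= D10 H1] := F1 x.
have /cvgrPdist_le/(_ _ e20)/nbhs_ballP[D2 /= D20 H2] := F2 x.
exists (Num.min D1 D2); first by rewrite lt_min D10.
move=> h; rewrite lt_min => /andP[h1 h2]; apply: le_trans (nm_le _) _.
rewrite (splitr e) cReB cImB; apply: lerD; rewrite distrC.
  by apply: H1; rewrite /ball /= opprD addrA subrr sub0r normrN.
by apply: H2; rewrite /ball /= opprD addrA subrr sub0r normrN.
Qed.

Lemma rderiv_ccont F f : (forall x, rderiv F x (f x)) -> ccont F.
Proof.
by move=> H; split => x; apply/differentiable_continuous/derivable1_diffP;
  have [[? _] [? _]] := H x.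
Qed.

Lemma ccont_cst (c : R[i]^o) : ccont (fun=> c).
Proof. by split => x; exact: cvg_cst. Qed.

Lemma ccontD f g : ccont f -> ccont g -> ccont (fun x => f x + g x).
Proof.
move=> [f1 f2] [g1 g2]; split.
  rewrite (_ : (fun x => complex.Re (f x + g x)) =
    (fun x => complex.Re (f x) + complex.Re (g x))).
    by move=> x; apply: cvgD; [exact: f1|exact: g1].
  by apply/funext => y; rewrite cReD.
rewrite (_ : (fun x => complex.Im (f x + g x)) =
  (fun x => complex.Im (f x) + complex.Im (g x))).
  by move=> x; apply: cvgD; [exact: f2|exact: g2].
by apply/funext => y; rewrite cImD.
Qed.

Lemma ccontM f g : ccont f -> ccont g -> ccont (fun x => f x * g x).
Proof.
move=> [f1 f2] [g1 g2]; split.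
  rewrite (_ : (fun x => complex.Re (f x * g x)) =
    (fun x => complex.Re (f x) * complex.Re (g x) - complex.Im (f x) * complex.Im (g x))).
    by move=> x; apply: cvgB; apply: cvgM; [exact: f1|exact: g1|exact: f2|exact: g2].
  by apply/funext => y; rewrite cReM.
rewrite (_ : (fun x => complex.Im (f x * g x)) =
  (fun x => complex.Re (f x) * complex.Im (g x) + complex.Im (f x) * complex.Re (g x))).
  by move=> x; apply: cvgD; apply: cvgM; [exact: f1|exact: g2|exact: f2|exact: g1].
by apply/funext => y; rewrite cImM.
Qed.

Lemma ccontZ f (c : R[i]^o) : ccont f -> ccont (fun x => c * f x).
Proof. by move=> cf; apply: ccontM => //; exact: ccont_cst. Qed.

Lemma ccontB f g : ccont f -> ccont g -> ccont (fun x => f x - g x).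
Proof.
move=> cf cg; have := ccontD cf (ccontZ (-1) cg).
by congr ccont; apply/funext => x; rewrite mulN1r.
Qed.

Lemma ccont_affine f (c e : R) : ccont f -> ccont (fun x => f (c * x + e)).
Proof.
have ca : continuous (fun x : R => c * x + e).
  move=> x; apply: cvgD; last exact: cvg_cst.
  by apply: cvgM; [exact: cvg_cst|exact: cvg_id].
move=> [f1 f2]; split => x.
  apply: (@continuous_comp _ _ _ (fun x => c * x + e) (fun x => complex.Re (f x)));
    [exact: ca|exact: f1].
apply: (@continuous_comp _ _ _ (fun x => c * x + e) (fun x => complex.Im (f x)));
    [exact: ca|exact: f2].
Qed.

Lemma ccont_sum (I : Type) (r : seq I) (F : I -> R -> R[i]^o) :
  (forall i, ccont (F i)) -> ccont (fun x => \sum_(i <- r) F i x).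
Proof.
move=> cF; elim: r => [|i r IH].
  by under eq_fun do rewrite big_nil; exact: ccont_cst.
by under eq_fun do rewrite big_cons; exact: ccontD.
Qed.

Lemma cint_sum (I : Type) (r : seq I) (F : I -> R -> R[i]^o) a b :
  (forall i, ccont (F i)) ->
  cint (fun x => \sum_(i <- r) F i x) a b = \sum_(i <- r) cint (F i) a b.
Proof.
move=> cF; elim: r => [|i r IH].
  under eq_fun do rewrite big_nil.
  rewrite big_nil (@cint_FTC _ (fun=> 0)) ?subrr// => x.
  by split; exact: is_derive_cst.
under eq_fun do rewrite big_cons.
by rewrite big_cons cintD ?IH//; exact: ccont_sum.
Qed.

Lemma cderiv_ccont (f f' : R[i]^o -> R[i]^o) (z v : R[i]^o) :
  (forall x, cderiv f (z + x%:Co * v) (f' (z + x%:Co * v))) ->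
  ccont (fun x => f (z + x%:Co * v)).
Proof.
by move=> H; apply: rderiv_ccont => x; apply: cderiv_rderiv; exact: H.
Qed.

End ComplexIntegral.

(** * Cauchy's theorem on a rectangle *)

Section Goursat.
Context {R : realType}.
Implicit Types (g G : R[i]^o -> R[i]^o) (x y a b c d : R).

Definition ii : R[i]^o := 0 +i* 1.

Lemma nm_ii : nm ii = 1.
Proof. by rewrite nmE /= expr0n add0r expr1n sqrtr1. Qed.

Lemma rderiv_horizontal g x y (e : R[i]^o) : cderiv g (x +i* y) e ->
  rderiv (fun x => g (x +i* y)) x e.
Proof.
move=> H; have E t : (t +i* y : R[i]^o) = (0 +i* y) + t%:Co * 1.
  by rewrite mulr1; apply: complexP; rewrite ?cReD ?cImD /= ?add0r ?addr0.
rewrite E in H; have := cderiv_rderiv H; rewrite mul1r.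
by under eq_fun do rewrite -E.
Qed.

Lemma rderiv_vertical g x y (e : R[i]^o) : cderiv g (x +i* y) e ->
  rderiv (fun y => g (x +i* y)) y (ii * e).
Proof.
move=> H; have E t : (x +i* t : R[i]^o) = x%:Co + t%:Co * ii.
  by apply: complexP; rewrite ?cReD ?cImD ?cReM ?cImM /=; ring.
rewrite E in H; have := cderiv_rderiv H.
by under eq_fun do rewrite -E.
Qed.

Lemma nm_quarter (z1 z2 z3 z4 : R[i]^o) (K : R) : K <= nm (z1 + z2 + z3 + z4) ->
  [\/ K <= 4 * nm z1, K <= 4 * nm z2, K <= 4 * nm z3 | K <= 4 * nm z4].
Proof.
move=> H; have := ler_nmD (z1 + z2 + z3) z4; have := ler_nmD (z1 + z2) z3.
have := ler_nmD z1 z2 => h1 h2 h3.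
have [?|k1] := leP K (4 * nm z1); first by constructor 1.
have [?|k2] := leP K (4 * nm z2); first by constructor 2.
have [?|k3] := leP K (4 * nm z3); first by constructor 3.
by constructor 4; lra.
Qed.

(** Follows one coordinate of the lower left corner under repeated halving; the limit is the
    supremum of this nondecreasing sequence. *)
Lemma bisection_limit (u : nat -> R) (L : R) : 0 <= L ->
  (forall n, u n.+1 = u n \/ u n.+1 = u n + L / 2 ^+ n.+1) ->
  exists l, forall n, u n <= l <= u n + L / 2 ^+ n.
Proof.
move=> L0 Hu.
have p2 n : 0 < 2 ^+ n :> R by rewrite exprn_gt0.
have Lp n : 0 <= L / 2 ^+ n by rewrite divr_ge0// ltW.
have half n : L / 2 ^+ n.+1 + L / 2 ^+ n.+1 = L / 2 ^+ n.
  by rewrite exprS; field; rewrite gt_eqF.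
have inc n m : u n <= u (n + m)%N.
  elim: m => [|m IH]; first by rewrite addn0.
  by rewrite addnS (le_trans IH)//; case: (Hu (n + m)%N) => ->; rewrite // lerDl.
have dec n m : u (n + m)%N + L / 2 ^+ (n + m)%N <= u n + L / 2 ^+ n.
  elim: m => [|m IH]; first by rewrite addn0.
  rewrite addnS (le_trans _ IH)//; have := half (n + m)%N; have := Lp (n + m).+1.
  by case: (Hu (n + m)%N) => ->; lra.
have ub n m : u m <= u n + L / 2 ^+ n.
  have h1 := inc m n; have h2 := dec n m; rewrite addnC in h1.
  by have := Lp (n + m)%N; lra.
exists (sup (range u)) => n; apply/andP; split.
  apply: ub_le_sup; last by exists n.
  by exists (u 0%N + L / 2 ^+ 0) => _ [m _ <-].
by apply: ge_sup; [exists (u 0%N), 0%N|move=> _ [m _ <-]].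
Qed.

Section Rectangle.
Variables (g g' : R[i]^o -> R[i]^o) (c0 d0 : R).
Hypothesis cd0 : c0 <= d0.
Hypothesis dg : forall x y, c0 <= y <= d0 -> cderiv g (x +i* y) (g' (x +i* y)).

(** [ccont] asks for continuity on all of R, while g is holomorphic only in the strip. Clamping the
    height extends the vertical traces of g and leaves them unchanged inside the strip. *)
Let clamp y := Num.max c0 (Num.min d0 y).

Let clamp_itv y : c0 <= clamp y <= d0.
Proof. by rewrite le_max lexx/= ge_max cd0 ge_min lexx. Qed.

Let clamp_id y : c0 <= y <= d0 -> clamp y = y.
Proof. by move=> /andP[h1 h2]; rewrite /clamp (min_idPr h2) (max_idPr h1). Qed.

Let clamp_lip y h : `|clamp (y + h) - clamp y| <= `|h|.
Proof.
have mx u v : `|Num.max c0 u - Num.max c0 v| <= `|u - v|.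
  have := ler_norm (u - v); have := ler_norm (- (u - v)); rewrite normrN => h1 h2.
  have h3 := normr_ge0 (u - v); rewrite ler_norml /Num.max.
  by case: ltP => ?; case: ltP => ?; apply/andP; split; lra.
have mn u v : `|Num.min d0 u - Num.min d0 v| <= `|u - v|.
  have := ler_norm (u - v); have := ler_norm (- (u - v)); rewrite normrN => h1 h2.
  have h3 := normr_ge0 (u - v); rewrite ler_norml /Num.min.
  by case: ltP => ?; case: ltP => ?; apply/andP; split; lra.
apply: le_trans (mx _ _) _; apply: le_trans (mn _ _) _.
by rewrite [y + h]addrC addrK.
Qed.

Let hor y x := g (x +i* y).
Let ver x y := g (x +i* clamp y).

Let hor_ccont y : c0 <= y <= d0 -> ccont (hor y).
Proof.
by move=> yI; apply: (@rderiv_ccont R _ (fun x => g' (x +i* y))) => x;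
  apply: rderiv_horizontal; exact: dg.
Qed.

Let ver_ccont x : ccont (ver x).
Proof.
apply: ccont_epsilon => y e e0.
have [D D0 HD] := cderiv_cont (dg x (clamp_itv y)) e0.
exists D => // h hD.
have := HD (0 +i* (clamp (y + h) - clamp y)); rewrite /ver.
have -> : (x +i* clamp y : R[i]^o) + (0 +i* (clamp (y + h) - clamp y)) =
  x +i* clamp (y + h).
  by apply: complexP; rewrite ?cReD ?cImD /=; ring.
apply; rewrite nmE /= expr0n add0r sqrtr_sqr.
exact: le_lt_trans (clamp_lip _ _) hD.
Qed.

(** The contour integral of g counterclockwise around [a, b] x [c, d]. *)
Let Delta a b c d := cint (hor c) a b - cint (hor d) a b +
  ii * (cint (ver b) c d - cint (ver a) c d).

(** The affine approximation [A] of g at the point has the primitive [G], so it contributes nothing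
    around the rectangle. The remainder is at most e B on the boundary, where B is half the
    perimeter. *)
Let Delta_local a b c d x y (e D : R) :
  a <= x <= b -> c <= y <= d -> c0 <= c -> d <= d0 -> 0 <= e ->
  (forall h, nm h < D -> nm (g (x +i* y + h) - g (x +i* y) - h * g' (x +i* y)) <= e * nm h) ->
  b - a + (d - c) < D ->
  nm (Delta a b c d) <= 4 * e * (b - a + (d - c)) ^+ 2.
Proof.
move=> /andP[ax xb] /andP[cy yd] c0c dd0 e0 HD BD.
set B := b - a + (d - c) in BD *.
have ab : a <= b by lra.
have cd : c <= d by lra.
pose p : R[i]^o := x +i* y.
pose G (z : R[i]^o) := g p * z + g' p / 2 * ((z - p) * (z - p)).
pose A (z : R[i]^o) := g p + (z - p) * g' p.
have dG z : cderiv G z (A z).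
  apply: cderiv_eq.
    apply: cderivD; first exact: cderivMl (cderiv_id _).
    apply: cderivMl; apply: cderivM.
      exact: cderivB (cderiv_id _) (cderiv_cst _ _).
    exact: cderivB (cderiv_id _) (cderiv_cst _ _).
  by rewrite /A; field.
have dA' z : cderiv A z (g' p).
  apply: cderiv_ext (cderiv_affine (g' p) (g p - p * g' p) z) => w.
  by rewrite /A; ring.
have small s t : a <= s <= b -> c <= t <= d -> nm (g (s +i* t) - A (s +i* t)) <= e * B.
  move=> /andP[as_ sb] /andP[ct td].
  have nB : nm ((s +i* t : R[i]^o) - p) <= B.
    apply: le_trans (nm_le _) _; rewrite cReB cImB /= /B.
    by apply: lerD; rewrite ler_norml; apply/andP; split; lra.
  have := HD (s +i* t - p) (le_lt_trans nB BD).
  have -> : x +i* y + (s +i* t - p) = s +i* t :> R[i]^o by rewrite /p; ring.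
  rewrite /A opprD addrA => /le_trans; apply.
  by rewrite ler_wpM2l.
have horE t : c <= t <= d -> nm (cint (hor t) a b - (G (b +i* t) - G (a +i* t))) <=
    2 * (e * B) * (b - a).
  move=> tcd.
  have dA s : rderiv (fun s => G (s +i* t)) s (A (s +i* t)) by exact: rderiv_horizontal.
  have cA : ccont (fun s => A (s +i* t)).
    apply: (@rderiv_ccont R _ (fun=> g' p)) => s; exact: rderiv_horizontal.
  have ch : ccont (hor t) by apply: hor_ccont; move/andP: tcd => [? ?]; apply/andP; split; lra.
  rewrite -(cint_FTC a b dA) -cintB//; apply: cint_bound => //; first exact: ccontB.
  by move=> s sab; exact: small.
have verE s : a <= s <= b -> nm (ii * cint (ver s) c d - (G (s +i* d) - G (s +i* c))) <=
    2 * (e * B) * (d - c).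
  move=> sab.
  have dA t : rderiv (fun t => G (s +i* t)) t (ii * A (s +i* t)) by exact: rderiv_vertical.
  have cA : ccont (fun t => ii * A (s +i* t)).
    apply: ccontZ.
    apply: (@rderiv_ccont R _ (fun=> ii * g' p)) => t; exact: rderiv_vertical.
  have cv := ver_ccont s.
  rewrite -(cint_FTC c d dA) -cintZ// -cintB//; last exact: ccontZ.
  apply: cint_bound => //; first by apply: ccontB => //; exact: ccontZ.
  move=> t tcd; rewrite -mulrBr nmM nm_ii mul1r /ver clamp_id.
    exact: small.
  by move/andP: tcd => [? ?]; apply/andP; split; lra.
have hc := horE c ltac:(by rewrite lexx).
have hd := horE d ltac:(by rewrite lexx andbT).
have va := verE a ltac:(by rewrite lexx).
have vb := verE b ltac:(by rewrite lexx andbT).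
have -> : Delta a b c d =
  (cint (hor c) a b - (G (b +i* c) - G (a +i* c))) -
  (cint (hor d) a b - (G (b +i* d) - G (a +i* d))) +
  ((ii * cint (ver b) c d - (G (b +i* d) - G (b +i* c))) -
   (ii * cint (ver a) c d - (G (a +i* d) - G (a +i* c)))) by rewrite /Delta; ring.
apply: le_trans (ler_nmD _ _) _.
apply: le_trans (lerD (ler_nmB _ _) (ler_nmB _ _)) _.
apply: le_trans (lerD (lerD hc hd) (lerD vb va)) _.
by rewrite le_eqVlt; apply/orP; left; apply/eqP; rewrite /B; ring.
Qed.

(** Some quarter of each rectangle carries at least a fourth of the integral in modulus. After n
    bisections the loss 4^n is compensated by the square of the shrunken perimeter, and
    differentiability at the common point makes the rest arbitrarily small. *)
Lemma goursat_rectangle a b c d : a <= b -> c0 <= c -> c <= d -> d <= d0 ->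
  Delta a b c d = 0.
Proof.
move=> ab c0c cd dd0.
set L := b - a; set M := d - c.
have L0 : 0 <= L by rewrite subr_ge0.
have M0 : 0 <= M by rewrite subr_ge0.
pose cell n (p : R * R) := Delta p.1 (p.1 + L / 2 ^+ n) p.2 (p.2 + M / 2 ^+ n).
have half n (X : R) : X / 2 ^+ n = X / 2 ^+ n.+1 + X / 2 ^+ n.+1.
  by rewrite exprS; field; rewrite gt_eqF// exprn_gt0.
pose good n (p q : R * R) := [/\ q.1 = p.1 \/ q.1 = p.1 + L / 2 ^+ n.+1,
  q.2 = p.2 \/ q.2 = p.2 + M / 2 ^+ n.+1 & nm (cell n p) <= 4 * nm (cell n.+1 q)].
have goodP n p : exists q, good n p q.
  case: p => u v; set l := L / 2 ^+ n.+1; set m := M / 2 ^+ n.+1.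
  have split4 : cell n (u, v) = cell n.+1 (u, v) + cell n.+1 (u + l, v) +
      cell n.+1 (u, v + m) + cell n.+1 (u + l, v + m).
    rewrite /cell /= !(half n) -/l -/m !(addrA _ l l) !(addrA _ m m) /Delta.
    rewrite -(cint_chasles _ u (u + l) (u + l + l)) -(cint_chasles (hor (v + m + m)) u (u + l) (u + l + l)).
    rewrite -(cint_chasles (ver (u + l + l)) v (v + m) (v + m + m)).
    rewrite -(cint_chasles (ver u) v (v + m) (v + m + m)).
    by ring.
  have := nm_quarter (K := nm (cell n (u, v))); rewrite {1}split4 => /(_ _ _ _ _ (lexx _)).
  case => H; [exists (u, v)|exists (u + l, v)|exists (u, v + m)|exists (u + l, v + m)];
    split => //=; by [left|right].
pose step n p := xget p [set q | good n p q].
have stepP n p : good n p (step n p).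
  by rewrite /step; have [q Hq] := goodP n p; exact: (xgetPex p (ex_intro _ q Hq)).
pose fix corner n := if n is n'.+1 then step n' (corner n') else (a, c).
have cellP n : nm (cell 0%N (a, c)) <= 4 ^+ n * nm (cell n (corner n)).
  elim: n => [|n IH]; first by rewrite expr0 mul1r.
  apply: le_trans IH _; rewrite exprSr -mulrA ler_wpM2l ?exprn_ge0//.
  by have [] := stepP n (corner n).
have [x Hx] := bisection_limit (u := fun n => (corner n).1) L0
  (fun n => let: And3 h _ _ := stepP n (corner n) in h).
have [y Hy] := bisection_limit (u := fun n => (corner n).2) M0
  (fun n => let: And3 _ h _ := stepP n (corner n) in h).
have cell0 : cell 0%N (a, c) = Delta a b c d.
  by rewrite /cell /= !divr1 /L /M ![_ + (_ - _)]addrC !subrK.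
have [L1 M1] : (x <= b) /\ (c <= y <= d).
  have := Hx 0%N; have := Hy 0%N; rewrite /= !divr1 /L /M => /andP[? ?] /andP[? ?].
  by split; [lra|apply/andP; split; lra].
have inc n : c <= (corner n).2.
  elim: n => [|n IH] //; have [_ [] -> _ //] := stepP n (corner n).
  by rewrite (le_trans IH)// lerDl divr_ge0// exprn_ge0.
have dec n : (corner n).2 + M / 2 ^+ n <= d.
  elim: n => [|n IH] /=; first by rewrite divr1 /M; lra.
  have [_ [] -> _ //] := stepP n (corner n); last by rewrite -addrA -half.
  by apply: le_trans IH; rewrite (half n M) addrA lerDl divr_ge0// exprn_ge0.
have yI : c0 <= y <= d0 by move/andP: M1 => [? ?]; apply/andP; split; lra.
apply/eqP; rewrite -nm_eq0 -cell0; apply/eqP/le_anti; rewrite nm_ge0 andbT.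
apply/ler_addgt0Pr => e e0; rewrite add0r.
have S0 : 0 < L + M + 1 by lra.
(* Chosen so that 4 e1 (L + M)^2 <= e; the + 1 keeps the denominator nonzero for a degenerate
   rectangle. *)
pose e1 := e / (4 * (L + M + 1) ^+ 2).
have e10 : 0 < e1 by rewrite divr_gt0// mulr_gt0// exprn_gt0.
have [D D0 HD] := dg x yI e10.
have [n Hn] : exists n, (L + M) / 2 ^+ n < D.
  exists (Num.truncn ((L + M) / D)).+1; rewrite ltr_pdivrMr ?exprn_gt0//.
  rewrite mulrC -ltr_pdivrMr//; apply: lt_trans (truncnS_gt _) _.
  by rewrite -natrX ltr_nat ltn_expl.
apply: le_trans (cellP n) _.
have : nm (cell n (corner n)) <= 4 * e1 * (L / 2 ^+ n + M / 2 ^+ n) ^+ 2.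
  rewrite /cell; set u := (corner n).1; set v := (corner n).2.
  have -> : L / 2 ^+ n + M / 2 ^+ n = u + L / 2 ^+ n - u + (v + M / 2 ^+ n - v) by ring.
  apply: (Delta_local (Hx n) (Hy n) _ _ (ltW e10) HD).
  - exact: le_trans c0c (inc n).
  - exact: le_trans (dec n) dd0.
  - by apply: le_lt_trans Hn; rewrite le_eqVlt; apply/orP; left; apply/eqP; ring.
have n4 : 0 < 4 ^+ n :> R by rewrite exprn_gt0.
move=> /(ler_wpM2l (ltW n4)) /le_trans; apply.
have -> : 4 ^+ n * (4 * e1 * (L / 2 ^+ n + M / 2 ^+ n) ^+ 2) =
   4 * e1 * (L + M) ^+ 2.
  have -> : 4 ^+ n = 2 ^+ n * 2 ^+ n :> R by rewrite -exprMn; congr (_ ^+ _); ring.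
  by field; rewrite gt_eqF// exprn_gt0.
rewrite /e1; have -> : 4 * (e / (4 * (L + M + 1) ^+ 2)) * (L + M) ^+ 2 =
  e * ((L + M) / (L + M + 1)) ^+ 2 by field; rewrite gt_eqF.
have LM0 : 0 <= L + M by lra.
have q0 : 0 <= (L + M) / (L + M + 1) by exact: divr_ge0 LM0 (ltW S0).
rewrite ler_piMr ?(ltW e0)// expr_le1//.
by rewrite ler_pdivrMr// mul1r lerDl.
Qed.

(** Moves the line of integration when g is nearly the same on both vertical sides: equal by
    periodicity, or small on both because they are far away. *)
Lemma cauchy_strip a b (B : R) : a <= b ->
  (forall y, c0 <= y <= d0 -> nm (g (b +i* y) - g (a +i* y)) <= B) ->
  nm (cint (fun x => g (x +i* c0)) a b - cint (fun x => g (x +i* d0)) a b) <=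
  2 * B * (d0 - c0).
Proof.
move=> ab H; have := goursat_rectangle ab (lexx c0) cd0 (lexx d0).
rewrite /Delta => /eqP; rewrite addr_eq0 => /eqP ->.
rewrite nmN nmM nm_ii mul1r -cintB; [|exact: ver_ccont|exact: ver_ccont].
apply: cint_bound => //; first by apply: ccontB; exact: ver_ccont.
by move=> y yI; rewrite /ver clamp_id//; exact: H.
Qed.

End Rectangle.
End Goursat.

(** * The identity theorem on a half plane *)

Section IdentityTheorem.
Context {R : realType}.

Lemma ccont_bounded (phi : R -> R[i]^o) (a b : R) : a <= b -> ccont phi ->
  exists M : R, forall x, a <= x <= b -> nm (phi x) <= M.
Proof.
move=> ab [c1 c2].
have cn (u : R -> R) : continuous u -> {within `[a, b], continuous (fun x => `|u x|)}.
  move=> cu; apply: continuous_subspaceT => x.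
  by apply: (@continuous_comp _ _ _ u (fun y => `|y|)); [exact: cu|exact: norm_continuous].
have [x1 _ H1] := EVT_max ab (cn _ c1).
have [x2 _ H2] := EVT_max ab (cn _ c2).
exists (`|complex.Re (phi x1)| + `|complex.Im (phi x2)|) => x xab.
by apply: le_trans (nm_le _) _; apply: lerD; [apply: H1|apply: H2]; rewrite in_itv.
Qed.

Lemma cint_cst (c : R[i]^o) (a b : R) : cint (fun=> c) a b = (b - a)%:Co * c.
Proof.
rewrite (@cint_FTC _ _ (fun x => 0 + x%:Co * c)).
  by rewrite rmorphB /=; ring.
move=> x; have := cderiv_rderiv (z := 0) (v := c) (x := x) (cderiv_id _).
by rewrite mulr1.
Qed.

(* Cauchy's theorem for the 2 pi-periodic function t |-> f (p + rho e^(i t)) on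
   the strip 0 <= Im t <= Y, with Y -> oo. The factor 2 comes from bounding real and
   imaginary parts separately. *)
Lemma mean_value_inequality (f f' : R[i]^o -> R[i]^o) (p : R[i]^o) (rho M : R) :
  0 < rho -> (forall z, cderiv f z (f' z)) ->
  (forall t, 0 <= t <= 2 * pi -> nm (f (p + rho%:Co * (cos t +i* sin t))) <= M) ->
  nm (f p) <= 2 * M.
Proof.
move=> rho0 df fM.
have pi0 : 0 < 2 * pi :> R by rewrite mulr_gt0// pi_gt0.
pose g (z : R[i]^o) := f (p + rho%:Co * cexp (ii * z)).
have gE x y : g (x +i* y) = f (p + (rho * expR (- y))%:Co * (cos x +i* sin x)).
  rewrite /g; congr (f (p + _)); rewrite /cexp cReM cImM /=.
  by apply: complexP; rewrite !(cReM, cImM) /= !mul0r !mul1r !(sub0r, subr0, addr0, add0r); ring.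
pose g' z := f' (p + rho%:Co * cexp (ii * z)) * (rho%:Co * (cexp (ii * z) * ii)).
have dg z : cderiv g z (g' z).
  apply: (@cderiv_comp R f (fun z => p + rho%:Co * cexp (ii * z))); first exact: df.
  apply: cderiv_eq; first apply: cderivD; first exact: cderiv_cst.
    apply: cderivMl.
    apply: (@cderiv_comp R cexp (fun z => ii * z)); first exact: cexp_cderiv.
    by apply: cderivMl; exact: cderiv_id.
  by rewrite add0r mulr1.
have gc y : ccont (fun x => g (x +i* y)).
  apply: (@rderiv_ccont R _ (fun x => g' (x +i* y))) => x.
  exact: rderiv_horizontal.
(* The rectangle is one period wide, so its vertical sides cancel exactly. *)
have same Y : 0 <= Y -> cint (fun x => g (x +i* 0)) 0 (2 * pi) = cint (fun x => g (x +i* Y)) 0 (2 * pi).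
  move=> Y0; have /(_ Y0) := @cauchy_strip R g g' 0 Y.
  move=> /(_ (fun x y _ => dg _) 0 (2 * pi) 0 (ltW pi0)) H.
  apply/eqP; rewrite -subr_eq0 -nm_eq0; apply/eqP/le_anti; rewrite nm_ge0 andbT.
  move: H; rewrite mulr0 mul0r; apply => y yI.
  by rewrite !gE mulr_natl cos2pi sin2pi cos0 sin0 subrr nm0.
have near e : 0 < e -> 2 * pi * nm (f p) <= 2 * M * (2 * pi) + 2 * e * (2 * pi).
  move=> e0; have [D D0 HD] := cderiv_cont (df p) e0.
  (* Since exp Y >= 1 + Y > rho / D, the circle at height Y has radius less than D. *)
  pose Y := rho / D.
  have Y0 : 0 <= Y by rewrite divr_ge0// ltW.
  have YD : rho * expR (- Y) < D.
    rewrite expRN ltr_pdivrMr ?expR_gt0// mulrC -ltr_pdivrMr//.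
    by apply: lt_le_trans (expR_ge1Dx _); rewrite ltrDr.
  have near_p x : nm (g (x +i* Y) - f p) <= e.
    rewrite gE; apply: HD; rewrite nmM nm_real nmE /= cos2Dsin2 sqrtr1 mulr1.
    by rewrite ger0_norm// mulr_ge0 ?expR_ge0// ltW.
  have -> : 2 * pi * nm (f p) = nm (cint (fun x => g (x +i* 0)) 0 (2 * pi) -
      cint (fun x => g (x +i* Y) - f p) 0 (2 * pi)).
    rewrite (same Y Y0) cintB//; last exact: ccont_cst.
    rewrite opprB addrCA subrr addr0 cint_cst subr0 nmM nm_real gtr0_norm//.
  apply: le_trans (ler_nmB _ _) _; apply: lerD.
    rewrite -[X in 2 * M * X]subr0; apply: (cint_bound _ (ltW pi0)) => //.
    by move=> x xI; rewrite gE oppr0 expR0 mulr1; exact: fM.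
  rewrite -[X in 2 * e * X]subr0; apply: (cint_bound _ (ltW pi0)) => //.
  by apply: ccontB => //; exact: ccont_cst.
apply/ler_addgt0Pr => e e0; have := near (e / 2) ltac:(by rewrite divr_gt0).
rewrite -mulrDl mulrC ler_pM2r// => /le_trans; apply.
by have -> : 2 * (e / 2) = e by field.
Qed.

Lemma expR_neg_lt (k e : R) : 0 < k -> 0 < e ->
  exists N : nat, expR (- (N%:R * k)) < e.
Proof.
move=> k0 e0; exists (Num.truncn (e^-1 / k)).+1.
rewrite expRN -[X in _ < X]invrK ltf_pV2 ?posrE ?invr_gt0 ?expR_gt0//.
apply: lt_le_trans (expR_ge1Dx _); apply: ltr_pwDl => //.
rewrite -ler_pdivrMr//; apply: ltW; exact: truncnS_gt.
Qed.

(* With w = (u - p) / rho, the function f(u) exp(N (w + w^2 / 2)) takes the value f(p)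
   at p. On the circle |w| = 1, f is zero where Re w > 1/3, and elsewhere
   Re (w + w^2 / 2) <= - 1/18; let N -> oo in the mean value inequality. *)
Theorem entire_vanishing (f f' : R[i]^o -> R[i]^o) (c : R) :
  (forall z, cderiv f z (f' z)) -> (forall z, c < complex.Re z -> f z = 0) ->
  forall z, f z = 0.
Proof.
move=> df f0 p.
(* A point of the circle with cos t > 1/3 is then to the right of the line Re = c, where f is
   zero. *)
pose rho := 3 * (`|c - complex.Re p| + 1).
have rho0 : 0 < rho by rewrite mulr_gt0// ltr_wpDl.
have rhoC0 : rho%:Co != 0.
  by rewrite -nm_gt0 nm_real gtr0_norm.
pose circ t : R[i]^o := p + rho%:Co * (cos t +i* sin t).
have circ_cont : ccont (fun t => f (circ t)).
  pose g (z : R[i]^o) := f (p + rho%:Co * cexp (ii * z)).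
  have gE x : f (circ x) = g (x +i* 0).
    rewrite /g; congr (f (p + _ * _)); rewrite /cexp cReM cImM /=.
    by rewrite !mul0r !mul1r oppr0 addr0 expR0 add0r !mul1r.
  rewrite (_ : (fun t => f (circ t)) = (fun t => g (t +i* 0))); last exact/funext.
  have dg z : cderiv g z (f' (p + rho%:Co * cexp (ii * z)) * (rho%:Co * (cexp (ii * z) * ii))).
    apply: (@cderiv_comp R f (fun z => p + rho%:Co * cexp (ii * z))); first exact: df.
    apply: cderiv_eq; first apply: cderivD; first exact: cderiv_cst.
      apply: cderivMl.
      apply: (@cderiv_comp R cexp (fun z => ii * z)); first exact: cexp_cderiv.
      by apply: cderivMl; exact: cderiv_id.
    by rewrite add0r mulr1.
  exact: (rderiv_ccont (fun x => rderiv_horizontal (dg (x +i* 0)))).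
have pi0 : 0 < 2 * pi :> R by rewrite mulr_gt0// pi_gt0.
have [M HM] := ccont_bounded (ltW pi0) circ_cont.
pose W (z : R[i]^o) := rho%:Co^-1 * z + (- (p / rho%:Co)).
have dW z : cderiv W z (rho%:Co^-1) by exact: cderiv_affine.
pose k (z : R[i]^o) := W z + 2^-1 * (W z * W z).
have dk z : exists d, cderiv k z d.
  eexists; apply: cderivD; first exact: dW.
  by apply: cderivMl; apply: cderivM; exact: dW.
have M0 : 0 <= M by apply: le_trans (HM 0 _); rewrite ?nm_ge0// lexx ltW.
have key N : nm (f p) <= 2 * (M * expR (- (N%:R * 18^-1))).
  pose G z := f z * cexp (N%:R * k z).
  have dG z : exists d, cderiv G z d.
    have [d hd] := dk z; eexists; apply: cderivM; first exact: df.
    apply: (@cderiv_comp R cexp (fun z => N%:R * k z)); first exact: cexp_cderiv.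
    by apply: cderivMl; exact: hd.
  have [G' HG'] := choice dG.
  have kp : k p = 0.
    by rewrite /k /W mulrC subrr mul0r mulr0 addr0.
  have -> : nm (f p) = nm (G p) by rewrite /G kp mulr0 cexp0 mulr1.
  apply: (mean_value_inequality rho0 HG') => t tI.
  rewrite -/(circ t) /G nmM nm_cexp.
  have WE : W (circ t) = cos t +i* sin t.
    by rewrite /W /circ; field.
  have kE : complex.Re (N%:R * k (circ t)) = N%:R * (cos t + cos t ^+ 2 - 2^-1).
    rewrite cReM Re_nat Im_nat mul0r subr0 /k WE.
    have -> : 2^-1 = (2^-1 : R)%:Co :> R[i]^o by rewrite fmorphV rmorph_nat.
    rewrite /= mul0r subr0.
    have -> : sin t * sin t = 1 - cos t ^+ 2 by rewrite -expr2 sin2cos2.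
    by congr (_ * _); field.
  rewrite kE.
  have [x1|x1] := leP (cos t) (3^-1); last first.
    rewrite f0 ?nm0 ?mul0r ?mulr_ge0 ?expR_ge0//.
    rewrite /circ cReD cReM /= mul0r subr0.
    have : rho * 3^-1 < rho * cos t by rewrite ltr_pM2l.
    have -> : rho * 3^-1 = `|c - complex.Re p| + 1 by rewrite /rho; field.
    by have := ler_norm (c - complex.Re p); lra.
  apply: ler_pM; rewrite ?nm_ge0 ?expR_ge0 ?HM//.
  rewrite ler_expR -mulrN ler_wpM2l//.
  (* By convexity, x + x^2 - 1/2 is largest on [-1, 1/3] at the endpoint 1/3, where it is - 1/18. *)
  have := cos_geN1 t; nra.
apply/eqP; rewrite -nm_eq0; apply/eqP/le_anti; rewrite nm_ge0 andbT.
apply/ler_addgt0Pr => e e0; rewrite add0r.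
have [|N HN] := @expR_neg_lt 18^-1 (e / (2 * (M + 1))) ltac:(by rewrite invr_gt0).
  by rewrite divr_gt0// mulr_gt0// ltr_wpDl.
apply: le_trans (key N) _.
have M10 : 0 < 2 * (M + 1) by rewrite mulr_gt0// ltr_wpDl.
move: HN; rewrite ltr_pdivlMr// => /ltW; apply: le_trans.
have := expR_ge0 (- (N%:R * 18^-1) : R); nra.
Qed.

End IdentityTheorem.

(** * Unordered sums *)

Section FiniteSums.
Local Open Scope fset_scope.
Local Open Scope ring_scope.
Context {R : realType}.
Variable I : choiceType.
Implicit Types (A B : {fset I}).

Lemma sum_fsetD (V : zmodType) (f : I -> V) A B : A `<=` B ->
  (\sum_(i <- B) f i = \sum_(i <- A) f i + \sum_(i <- B `\` A) f i)%R.
Proof.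
move=> AB; rewrite -big_cat; apply: perm_big; apply: uniq_perm.
- exact: fset_uniq.
- rewrite cat_uniq !fset_uniq andbT /=; apply/hasPn => i.
  by rewrite in_fsetD => /andP[].
- move=> i; rewrite mem_cat in_fsetD; have := fsubsetP AB i.
  by case: (i \in A) => //= ->.
Qed.

Lemma sum_fset_le (g : I -> R) A B : (forall i, 0 <= g i) -> A `<=` B ->
  \sum_(i <- A) g i <= \sum_(i <- B) g i.
Proof. by move=> g0 AB; rewrite (sum_fsetD _ AB) lerDl sumr_ge0. Qed.

End FiniteSums.

Section UnorderedSums.
Local Open Scope fset_scope.
Local Open Scope ring_scope.
Context {R : realType}.

(** Convergence along finite sets with real epsilon; [hsum_summability] ties it to
    [summability.sum], a limit whose value by itself does not certify convergence. *)
Definition hsum (I : choiceType) (f : I -> R[i]^o) (L : R[i]^o) := forall e : R, 0 < e ->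
  exists A0 : {fset I}, forall A : {fset I}, A0 `<=` A ->
    nm (\sum_(i <- A) f i - L) <= e.

Definition abs_summable (I : choiceType) (f : I -> R[i]^o) :=
  exists M : R, forall A : {fset I}, \sum_(i <- A) nm (f i) <= M.

Section OneIndex.
Variable I : choiceType.
Implicit Types (f g : I -> R[i]^o) (L : R[i]^o).

Lemma hsum_unique f L L' : hsum f L -> hsum f L' -> L = L'.
Proof.
move=> H H'; apply/eqP; rewrite -subr_eq0 -nm_eq0; apply/eqP/le_anti.
rewrite nm_ge0 andbT; apply/ler_addgt0Pr => e e0; rewrite add0r.
have e2 : 0 < e / 2 by rewrite divr_gt0.
have [A HA] := H _ e2; have [A' HA'] := H' _ e2.
have := HA _ (fsubsetUl A A'); have := HA' _ (fsubsetUr A A').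
set s := \sum_(i <- _) _ => h1 h2.
have -> : L - L' = (s - L') - (s - L) by ring.
by apply: le_trans (ler_nmB _ _) _; rewrite (splitr e) lerD.
Qed.

Lemma hsumD f g L L' : hsum f L -> hsum g L' -> hsum (fun i => f i + g i) (L + L').
Proof.
move=> H H' e e0; have e2 : 0 < e / 2 by rewrite divr_gt0.
have [A HA] := H _ e2; have [A' HA'] := H' _ e2.
exists (A `|` A')%fset => B; rewrite fsubUset => /andP[AB AB'].
rewrite big_split /= opprD addrACA.
by apply: le_trans (ler_nmD _ _) _; rewrite (splitr e) lerD ?HA ?HA'.
Qed.

Lemma hsumZ f L (c : R[i]^o) : hsum f L -> hsum (fun i => c * f i) (c * L).
Proof.
move=> H e e0; have c0 : 0 < nm c + 1 by rewrite ltr_wpDl ?nm_ge0.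
have [A HA] := H _ (divr_gt0 e0 c0); exists A => B /HA h.
rewrite -mulr_sumr -mulrBr nmM.
apply: le_trans (ler_wpM2l (nm_ge0 _) h) _.
by rewrite mulrCA ler_piMr ?(ltW e0)// ler_pdivrMr// mul1r lerDl.
Qed.

Lemma hsum0 : hsum (fun _ : I => 0 : R[i]^o) 0.
Proof.
by move=> e e0; exists fset0 => A _; rewrite big1// subr0 nm0 ltW.
Qed.

Lemma eq_hsum f g L : f =1 g -> hsum f L -> hsum g L.
Proof. by move=> /funext ->. Qed.

Lemma hsum_sum (J : Type) (s : seq J) (f : J -> I -> R[i]^o) (L : J -> R[i]^o) :
  (forall j, hsum (f j) (L j)) ->
  hsum (fun i => \sum_(j <- s) f j i) (\sum_(j <- s) L j).
Proof.
move=> H; elim: s => [|j s IH].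
  by rewrite big_nil; apply: eq_hsum hsum0 => i; rewrite big_nil.
by rewrite big_cons; apply: eq_hsum (hsumD (H j) IH) => i; rewrite big_cons.
Qed.

Lemma hsum_nonneg (g : I -> R) (M : R) : (forall i, 0 <= g i) ->
  (forall A : {fset I}, \sum_(i <- A) g i <= M) ->
  exists S : R, hsum (fun i => (g i)%:Co) (S%:Co).
Proof.
move=> g0 gM; pose E : set R := range (fun A : {fset I} => \sum_(i <- A) g i).
have Esup : has_sup E.
  by split; [exists (\sum_(i <- (fset0 : {fset I})) g i), fset0|exists M => _ [A _ <-]].
exists (sup E) => e e0.
have [_ [A0 _ <-] HA0] := sup_adherent e0 Esup.
exists A0 => A A0A; rewrite sumC -rmorphB /= nm_real.
have h1 := sum_fset_le g0 A0A.
have h2 : \sum_(i <- A) g i <= sup E by apply: ub_le_sup; [case: Esup|exists A].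
by rewrite ler_norml; apply/andP; split; lra.
Qed.

Lemma abs_summable_hsum_nm f : abs_summable f -> exists S : R, hsum (fun i => (nm (f i))%:Co) (S%:Co).
Proof. by move=> [M HM]; apply: hsum_nonneg HM => i; exact: nm_ge0. Qed.

(** Adding |f i| makes the real and imaginary parts nonnegative, so that their sums converge to
    suprema; the sum of the |f i| is then subtracted. *)
Lemma abs_summable_hsum f : abs_summable f -> exists L, hsum f L.
Proof.
move=> sf; have [S HS] := abs_summable_hsum_nm sf; have [M HM] := sf.
have [S1 HS1] : exists S1 : R, hsum (fun i => (nm (f i) + complex.Re (f i))%:Co) (S1%:Co).
  apply: (@hsum_nonneg _ (M + M)) => [i|A].
    by have := Re_le_nm (f i); rewrite ler_norml => /andP[]; lra.
  rewrite big_split /=; apply: lerD => //; apply: le_trans (HM A).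
  by apply: ler_sum => i _; apply: le_trans (Re_le_nm _); exact: ler_norm.
have [S2 HS2] : exists S2 : R, hsum (fun i => (nm (f i) + complex.Im (f i))%:Co) (S2%:Co).
  apply: (@hsum_nonneg _ (M + M)) => [i|A].
    by have := Im_le_nm (f i); rewrite ler_norml => /andP[]; lra.
  rewrite big_split /=; apply: lerD => //; apply: le_trans (HM A).
  by apply: ler_sum => i _; apply: le_trans (Im_le_nm _); exact: ler_norm.
eexists; apply: eq_hsum (hsumD (hsumD HS1 (hsumZ (-1) HS))
  (hsumZ (0 +i* 1) (hsumD HS2 (hsumZ (-1) HS)))) => i.
apply: complexP; rewrite !(cReD, cImD, cReM, cImM) /=; ring.
Qed.

Lemma abs_summable_tail f : abs_summable f -> forall e : R, 0 < e ->
  exists A0 : {fset I}, forall A : {fset I}, [disjoint A & A0]%fset ->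
    \sum_(i <- A) nm (f i) <= e.
Proof.
move=> sf e e0; have [S HS] := abs_summable_hsum_nm sf.
have [A0 HA0] := HS (e / 2) ltac:(by rewrite divr_gt0).
exists A0 => A dA; have := HA0 A0 (fsubset_refl _); have := HA0 _ (fsubsetUl A0 A).
rewrite (sum_fsetD _ (fsubsetUl A0 A)) !sumC -rmorphD -!rmorphB /= !nm_real.
have -> : ((A0 `|` A) `\` A0 = A)%fset.
  apply/fsetP => i; rewrite in_fsetD in_fsetU; have := fdisjointP dA i.
  by case: (i \in A) => [->//|_]; case: (i \in A0).
by rewrite !ler_norml => /andP[h1 h2] /andP[h3 h4]; lra.
Qed.

(* Weierstrass M-test, uniformly in the family [f] dominated by [b]. *)
Lemma dominated_hsum (b : I -> R[i]^o) : abs_summable b -> forall e : R, 0 < e ->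
  exists A0 : {fset I}, forall f L, (forall i, nm (f i) <= nm (b i)) -> hsum f L ->
    forall A : {fset I}, A0 `<=` A -> nm (\sum_(i <- A) f i - L) <= e.
Proof.
move=> sb e e0; have [A0 HA0] := abs_summable_tail sb e0.
exists A0 => f L fb hf A A0A; apply/ler_addgt0Pr => d d0.
have [A1 HA1] := hf d d0.
have := HA1 _ (fsubsetUr A A1); rewrite (sum_fsetD _ (fsubsetUl A A1)).
set s := \sum_(i <- A) f i; set t := \sum_(i <- _) f i => st.
have -> : s - L = (s + t - L) - t by ring.
apply: le_trans (ler_nmB _ _) _; rewrite addrC; apply: lerD => //.
apply: le_trans (ler_nm_sum _ _ _) _.
apply: le_trans (ler_sum _ (fun i _ => fb i)) _; apply: HA0.
apply/fdisjointP => i; rewrite in_fsetD => /andP[iA _].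
by apply: contra iA; exact: fsubsetP.
Qed.

Lemma hsum_nm_le f L (M : R) : hsum f L ->
  (forall A : {fset I}, \sum_(i <- A) nm (f i) <= M) -> nm L <= M.
Proof.
move=> hf fM; apply/ler_addgt0Pr => e e0; have [A HA] := hf e e0.
have -> : L = \sum_(i <- A) f i - (\sum_(i <- A) f i - L) by ring.
apply: le_trans (ler_nmB _ _) _; apply: lerD; last exact: HA.
exact: le_trans (ler_nm_sum _ _ _) (fM A).
Qed.

Lemma abs_summable_le f g : (forall i, nm (f i) <= nm (g i)) ->
  abs_summable g -> abs_summable f.
Proof.
by move=> fg [M HM]; exists M => A; apply: le_trans (HM A); exact: ler_sum.
Qed.

Lemma abs_summableZ f (c : R[i]^o) : abs_summable f -> abs_summable (fun i => c * f i).
Proof.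
move=> [M HM]; exists (nm c * M) => A; under eq_bigr do rewrite nmM.
by rewrite -mulr_sumr ler_wpM2l ?nm_ge0.
Qed.

Lemma fsub_exhaust (A : nat -> {fset I}) (B : {fset I}) :
  (forall i, exists N, forall n, (N <= n)%N -> i \in A n) ->
  exists N, forall n, (N <= n)%N -> B `<=` A n.
Proof.
move=> cov.
have [N HN] : exists N, forall n i, (N <= n)%N -> i \in enum_fset B -> i \in A n.
  elim: (enum_fset B) => [|i s [N HN]]; first by exists 0%N.
  have [N' HN'] := cov i; exists (maxn N N') => n j.
  rewrite geq_max in_cons => /andP[h1 h2] /orP[/eqP ->|]; first exact: HN'.
  exact: HN.
by exists N => n Nn; apply/fsubsetP => i; exact: HN.
Qed.

Lemma abs_summable_exhaust f (A : nat -> {fset I}) (M : R) :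
  (forall i, exists N, forall n, (N <= n)%N -> i \in A n) ->
  (forall n, \sum_(i <- A n) nm (f i) <= M) -> abs_summable f.
Proof.
move=> cov HM; exists M => B; have [N HN] := fsub_exhaust B cov.
by apply: le_trans (HM N); apply: sum_fset_le (HN N _) => // i; exact: nm_ge0.
Qed.

Lemma hsum_exhaust f L (A : nat -> {fset I}) :
  (forall i, exists N, forall n, (N <= n)%N -> i \in A n) -> hsum f L ->
  forall e : R, 0 < e -> exists N, forall n, (N <= n)%N ->
    nm (\sum_(i <- A n) f i - L) <= e.
Proof.
move=> cov hf e e0; have [A0 HA0] := hf e e0.
by have [N HN] := fsub_exhaust A0 cov; exists N => n Nn; apply: HA0; exact: HN.
Qed.

Lemma hsum_summability f L : hsum f L -> summability.sum f = L.
Proof.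
have FF : ProperFilter (@totally I) := totally_filter.
move=> hf; apply: cvg_lim; first exact: norm_hausdorff.
apply/cvgrPdist_le => -[e e'] /=; rewrite ltcE /= => /andP[/eqP -> e0].
have [A0 HA0] := hf e e0; exists A0 => // A /= A0A.
by rewrite distrC normC_nm complexr0 lecR /partial_sum -(big_seq_fsetE _ _ xpredT); exact: HA0.
Qed.

Lemma uprod_eq f L : (forall e : R, 0 < e ->
  exists A0 : {fset I}, forall A : {fset I}, A0 `<=` A ->
    nm (\prod_(i <- A) f i - L) <= e) -> uprod f = L.
Proof.
have FF : ProperFilter (@totally I) := totally_filter.
move=> hf; apply: cvg_lim; first exact: norm_hausdorff.
apply/cvgrPdist_le => -[e e'] /=; rewrite ltcE /= => /andP[/eqP -> e0].
have [A0 HA0] := hf e e0; exists A0 => // A /= A0A.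
by rewrite distrC normC_nm complexr0 lecR -(big_seq_fsetE _ _ xpredT); exact: HA0.
Qed.

End OneIndex.

Lemma hsum_bij (I J : choiceType) (h : J -> I) (k : I -> J) (f : I -> R[i]^o) L :
  cancel h k -> cancel k h -> hsum f L -> hsum (f \o h) L.
Proof.
move=> hk kh hf e e0; have [A0 HA0] := hf e e0.
exists [fset k i | i in A0] => A A0A.
have -> : \sum_(j <- A) (f \o h) j = \sum_(i <- [fset h j | j in A]) f i.
  rewrite big_imfset //= => x y _ _; exact: (can_inj hk).
apply: HA0; apply/fsubsetP => i iA0; rewrite -(kh i); apply/in_imfset.
by apply: (fsubsetP A0A); exact/in_imfset.
Qed.

Section TwoIndices.
Variables I J : choiceType.
Implicit Types f : I * J -> R[i]^o.

Lemma sum_fsetM (V : zmodType) (f : I * J -> V) (A : {fset I}) (B : {fset J}) :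
  (\sum_(p <- A `*` B) f p = \sum_(i <- A) \sum_(j <- B) f (i, j))%R.
Proof.
rewrite -big_allpairs_dep; rewrite [RHS](_ : _ = \sum_(p <- [seq (i, j) | i <- A, j <- B]) f p); last first.
  by rewrite !big_allpairs.
apply: perm_big; apply: uniq_perm; first exact: fset_uniq.
  by apply: allpairs_uniq; rewrite ?fset_uniq// => -[? ?] [? ?].
move=> [i j]; rewrite in_fsetM /=; apply/andP/allpairsP.
  by move=> [iA jB]; exists (i, j).
by move=> [[i' j'] [? ? [-> ->]]].
Qed.

Lemma fsub_fsetM (C : {fset I * J}) : C `<=` [fset p.1 | p in C] `*` [fset p.2 | p in C].
Proof.
apply/fsubsetP => -[i j] C0; rewrite in_fsetM /=.
by apply/andP; split; apply/imfsetP; exists (i, j).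
Qed.

Lemma abs_summable_pair f (r : I -> R) (M : R) :
  (forall i (B : {fset J}), \sum_(j <- B) nm (f (i, j)) <= r i) ->
  (forall A : {fset I}, \sum_(i <- A) r i <= M) -> abs_summable f.
Proof.
move=> Hr HM; exists M => C.
apply: le_trans (sum_fset_le _ (fsub_fsetM C)) _ => [i|]; first exact: nm_ge0.
rewrite sum_fsetM; apply: le_trans (HM [fset p.1 | p in C]).
by apply: ler_sum => i _; exact: Hr.
Qed.

Lemma hsum_fubini f L (r : I -> R[i]^o) : abs_summable f -> hsum f L ->
  (forall i, hsum (fun j => f (i, j)) (r i)) -> hsum r L.
Proof.
move=> sf hf hr e e0; have e2 : 0 < e / 2 by rewrite divr_gt0.
have [C HC] := hf _ e2.
exists [fset p.1 | p in C] => A CA.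
(* As A is finite, one finite set of second indices approximates all its row sums together. *)
have [B0 HB0] := hsum_sum A hr e2.
have := HB0 _ (fsubsetUl B0 [fset p.2 | p in C]).
set B := (B0 `|` _)%fset => hB.
have : nm (\sum_(p <- A `*` B) f p - L) <= e / 2.
  apply: HC; apply: fsubset_trans (fsub_fsetM C) _.
  apply/fsubsetP => -[i j]; rewrite !in_fsetM /= => /andP[iC jC].
  by rewrite (fsubsetP CA)//= /B in_fsetU jC orbT.
rewrite sum_fsetM exchange_big /= => hA.
set s := \sum_(j <- B) _ in hA hB.
have -> : \sum_(i <- A) r i - L = (s - L) - (s - \sum_(i <- A) r i) by ring.
by apply: le_trans (ler_nmB _ _) _; rewrite (splitr e) lerD.
Qed.

End TwoIndices.

Lemma abs_summable_bij (I J : choiceType) (h : J -> I) (k : I -> J) (f : I -> R[i]^o) :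
  cancel h k -> cancel k h -> abs_summable f -> abs_summable (f \o h).
Proof.
move=> hk kh [M HM]; exists M => A; apply: le_trans (HM [fset h j | j in A]).
by rewrite big_imfset //= => x y _ _; exact: (can_inj hk).
Qed.

Lemma hsum_exchange (I J : choiceType) (f : I * J -> R[i]^o)
    (r : I -> R[i]^o) (c : J -> R[i]^o) L : abs_summable f ->
  (forall i, hsum (fun j => f (i, j)) (r i)) ->
  (forall j, hsum (fun i => f (i, j)) (c j)) -> hsum r L -> hsum c L.
Proof.
move=> sf hr hc hL; have [L' hf] := abs_summable_hsum sf.
have -> : L = L' by apply: hsum_unique hL (hsum_fubini sf hf hr).
pose sw (p : J * I) := (p.2, p.1); pose sw' (p : I * J) := (p.2, p.1).
have c1 : cancel sw sw' by case.
have c2 : cancel sw' sw by case.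
exact: (hsum_fubini (abs_summable_bij c1 c2 sf) (hsum_bij c1 c2 hf)).
Qed.

Section ConcreteIndices.

Definition nat_range (n : nat) : {fset nat} := seq_fset tt (iota 0 n).
(** The range -n, ..., n - 1 is half open so that the unit intervals starting at its points tile
    [-n, n]; this matches the unfolded integrals. *)
Definition int_range (n : nat) : {fset int} :=
  seq_fset tt [seq (j%:Z - n%:Z)%R | j <- iota 0 (n + n)].

Lemma sum_nat_range (V : nmodType) (f : nat -> V) n :
  \sum_(i <- nat_range n) f i = \sum_(0 <= i < n) f i.
Proof.
rewrite /nat_range (perm_big (iota 0 n)) /=; first by rewrite /index_iota subn0.
by apply: perm_trans (sort_keys_perm _) _; rewrite undup_id// iota_uniq.
Qed.

Lemma sum_int_range (V : nmodType) (f : int -> V) n :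
  \sum_(i <- int_range n) f i = \sum_(0 <= j < n + n) f (j%:Z - n%:Z).
Proof.
rewrite /int_range (perm_big [seq (j%:Z - n%:Z)%R | j <- iota 0 (n + n)]) /=.
  by rewrite big_map /index_iota subn0.
apply: perm_trans (sort_keys_perm _) _; rewrite undup_id// map_inj_uniq ?iota_uniq//.
by move=> x y /addIr[].
Qed.

Lemma nat_range_cover i : exists N, forall n, (N <= n)%N -> i \in nat_range n.
Proof. by exists i.+1 => n; rewrite seq_fsetE mem_iota. Qed.

Lemma int_range_cover (i : int) : exists N, forall n, (N <= n)%N -> i \in int_range n.
Proof.
exists (absz i).+1 => n ni; rewrite seq_fsetE; apply/mapP.
exists (absz (i + n%:Z)%R); last by lia.
by rewrite mem_iota; lia.
Qed.

Lemma hsum_nat (f : nat -> R[i]^o) L : hsum f L -> forall e : R, 0 < e ->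
  exists N, forall n, (N <= n)%N -> nm (\sum_(0 <= i < n) f i - L) <= e.
Proof.
move=> hf e e0; have [N HN] := hsum_exhaust nat_range_cover hf e0.
by exists N => n /HN; rewrite sum_nat_range.
Qed.

Lemma abs_summable_nat (f : nat -> R[i]^o) (M : R) :
  (forall n, \sum_(0 <= i < n) nm (f i) <= M) -> abs_summable f.
Proof.
move=> HM; apply: (abs_summable_exhaust nat_range_cover (M := M)) => n.
by rewrite sum_nat_range.
Qed.

Lemma abs_summable_int (f : int -> R[i]^o) (M : R) :
  (forall n, \sum_(0 <= j < n + n) nm (f (j%:Z - n%:Z)) <= M) -> abs_summable f.
Proof.
move=> HM; apply: (abs_summable_exhaust int_range_cover (M := M)) => n.
by rewrite sum_int_range.
Qed.

Variable r : nat.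

Definition box_emb n (m : {ffun 'I_r -> 'I_n}) : {ffun 'I_r -> nat} :=
  [ffun k => nat_of_ord (m k)].
(** Boxes are cofinal among the finite sets of multi-indices, and over a box a sum of products
    factors. *)
Definition box (n : nat) : {fset {ffun 'I_r -> nat}} :=
  seq_fset tt [seq box_emb m | m <- enum {ffun 'I_r -> 'I_n}].

Lemma sum_box (V : nmodType) (f : {ffun 'I_r -> nat} -> V) n :
  \sum_(m <- box n) f m = \sum_(m : {ffun 'I_r -> 'I_n}) f (box_emb m).
Proof.
rewrite /box (perm_big [seq box_emb m | m <- enum {ffun 'I_r -> 'I_n}]) /=.
  by rewrite big_map big_enum.
apply: perm_trans (sort_keys_perm _) _; rewrite undup_id// map_inj_uniq ?enum_uniq//.
move=> x y /ffunP H; apply/ffunP => k; apply: val_inj.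
by have := H k; rewrite !ffunE.
Qed.

Lemma box_cover m : exists N, forall n, (N <= n)%N -> m \in box n.
Proof.
exists (\max_k m k).+1 => n mn; rewrite seq_fsetE; apply/mapP.
have lt k : (m k < n)%N by apply: leq_trans mn; rewrite ltnS leq_bigmax.
exists [ffun k => Ordinal (lt k)]; first by rewrite mem_enum.
by apply/ffunP => k; rewrite !ffunE.
Qed.

Lemma sum_box_prod (V : comPzRingType) (f : 'I_r -> nat -> V) n :
  \sum_(m <- box n) \prod_k f k (m k) = \prod_k \sum_(0 <= j < n) f k j.
Proof.
rewrite sum_box; under [RHS]eq_bigr do rewrite big_mkord.
rewrite bigA_distr_bigA /=; apply: eq_bigr => m _; apply: eq_bigr => k _.
by rewrite ffunE.
Qed.

(** Any finite set lies in some box, where the sum factors into one-dimensional sums. *)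
Lemma abs_summable_prod (f : 'I_r -> nat -> R[i]^o) (M : 'I_r -> R) :
  (forall k n, \sum_(0 <= i < n) nm (f k i) <= M k) ->
  forall A : {fset {ffun 'I_r -> nat}},
    \sum_(m <- A) nm (\prod_k f k (m k)) <= \prod_k M k.
Proof.
move=> HM A.
have [n HN] := fsub_exhaust A box_cover; have Hn := HN n (leqnn n).
apply: le_trans (sum_fset_le _ Hn) _ => [i|]; first exact: nm_ge0.
rewrite (eq_bigr (fun m : {ffun _ -> _} => \prod_k nm (f k (m k)))); last by move=> m _; exact: nm_prod.
rewrite (sum_box_prod (fun k j => nm (f k j))); apply: ler_prod => k _.
by rewrite HM andbT sumr_ge0// => *; exact: nm_ge0.
Qed.

End ConcreteIndices.
End UnorderedSums.

(** * Uniqueness of Fourier coefficients *)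

Section FourierUniqueness.
Context {R : realType}.
Implicit Types (D : R -> R[i]^o) (k : int).

Definition echar k (z : R[i]^o) : R[i]^o := cexp (two_pi_i * k%:~R * z).

Lemma echarD k l z : echar (k + l) z = echar k z * echar l z.
Proof. by rewrite /echar -cexpD intrD; congr cexp; ring. Qed.

Lemma echar_add k z w : echar k (z + w) = echar k z * echar k w.
Proof. by rewrite /echar -cexpD; congr cexp; ring. Qed.

Lemma echar_cderiv k z : cderiv (echar k) z (two_pi_i * k%:~R * echar k z).
Proof.
apply: cderiv_eq.
  apply: (@cderiv_comp R cexp (fun z => two_pi_i * k%:~R * z)); first exact: cexp_cderiv.
  by apply: cderivMl; exact: cderiv_id.
by rewrite /echar; ring.
Qed.

Lemma echar_ccont k (z : R[i]^o) : ccont (fun x : R => echar k (z + x%:Co)).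
Proof.
have := @cderiv_ccont R (echar k) (fun z => two_pi_i * k%:~R * echar k z) z 1
  (fun x => echar_cderiv k _).
by under eq_fun do rewrite mulr1.
Qed.

Lemma echar_real k (x : R) : echar k (x%:Co) =
  cos (2 * pi * k%:~R * x) +i* sin (2 * pi * k%:~R * x).
Proof.
rewrite /echar.
have -> : two_pi_i * k%:~R * x%:Co = 0 +i* (2 * pi * k%:~R * x) :> R[i]^o.
  have -> : k%:~R = (k%:~R : R)%:Co :> R[i]^o by rewrite rmorph_int.
  by apply: complexP; rewrite !(cReM, cImM) /=; ring.
by rewrite /cexp /= expR0 !mul1r.
Qed.

Lemma echar0 z : echar 0 z = 1.
Proof. by rewrite /echar mulr0 mul0r cexp0. Qed.

Lemma echar_nat (n : nat) z : echar n%:Z z = echar 1 z ^+ n.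
Proof.
elim: n => [|n IH]; first by rewrite echar0.
by rewrite intS echarD IH exprS.
Qed.

Lemma echar_period k : echar k 1 = 1.
Proof.
have e1 : echar 1 1 = 1.
  rewrite -[X in echar _ X]/((1 : R)%:Co) echar_real !mulr1.
  by rewrite mulr_natl cos2pi sin2pi.
case: k => n; first by rewrite echar_nat e1 expr1n.
have := echarD (Negz n) n.+1 1; rewrite NegzE addNr echar0 echar_nat e1 expr1n.
by rewrite mulr1.
Qed.

Lemma echar_add1 k z : echar k (z + 1) = echar k z.
Proof. by rewrite echar_add echar_period mulr1. Qed.

(* All the integrals of D T^n vanish for T(x) = 1 + cos 2 pi x - cos 2 pi a, while
   T > 1 on |x| < a and |T| <= 1 elsewhere on the period. *)
Lemma fourier_vanish_at0 D : ccont D ->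
  (forall k, cint (fun x => D x * echar k x%:Co) (- 2^-1) (2^-1) = 0) -> D 0 = 0.
Proof.
move=> cD H; apply/eqP/negPn/negP => D0.
(* Normalised to 1 at 0, so that its real part is at least 1/2 for |x| <= a. *)
pose D1 x := (D 0)^-1 * D x.
have cD1 : ccont D1 by exact: ccontZ.
have ce k : ccont (fun x : R => echar k x%:Co).
  by have := echar_ccont k 0; under eq_fun do rewrite add0r.
have [d d0 Hd] := epsilon_ccont cD1 0 (e := 2^-1) ltac:(by rewrite invr_gt0).
pose a := Num.min (d / 2) 4^-1.
have a0 : 0 < a by rewrite lt_min; apply/andP; split; lra.
have a4 : a <= 4^-1 by rewrite ge_min lexx orbT.
have ad : a < d.
  by have h : a <= d / 2; [rewrite ge_min lexx|lra].
have pi0 := @pi_gt0 R.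
pose T (x : R) : R := 1 + cos (2 * pi * x) - cos (2 * pi * a).
have TC x : (T x)%:Co = (1 - cos (2 * pi * a))%:Co + 2^-1 * (echar 1 x%:Co + echar (-1) x%:Co).
  have -> : 2^-1 = (2^-1 : R)%:Co :> R[i]^o by rewrite fmorphV rmorph_nat.
  rewrite !echar_real; apply: complexP; rewrite !(cReD, cImD, cReM, cImM) /=.
    by rewrite mulrN1 mulr1 mulNr cosN /T; field.
  by rewrite mulrN1 mulr1 mulNr sinN; ring.
(* [T] is a trigonometric polynomial of degree 1: one more factor mixes the frequencies k, k + 1 and
   k - 1, so the induction has to carry all k. *)
have zero n k : ccont (fun x => D1 x * (T x)%:Co ^+ n * echar k x%:Co) /\
    cint (fun x => D1 x * (T x)%:Co ^+ n * echar k x%:Co) (- 2^-1) (2^-1) = 0.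
  elim: n k => [|n IH] k.
    split; first by apply: ccontM => //; apply: ccontM => //; exact: ccont_cst.
    rewrite (eq_cint (g := fun x => (D 0)^-1 * (D x * echar k x%:Co))).
      by rewrite cintZ ?H ?mulr0//; exact: ccontM.
    by move=> x; rewrite expr0 mulr1 /D1; ring.
  pose al := (1 - cos (2 * pi * a))%:Co; pose F k x := D1 x * (T x)%:Co ^+ n * echar k x%:Co.
  have E : (fun x => D1 x * (T x)%:Co ^+ n.+1 * echar k x%:Co) =
     (fun x => al * F k x + (2^-1 * F (1 + k) x + 2^-1 * F (-1 + k) x)).
    by apply/funext => x; rewrite exprS {1}TC /F !echarD -/al; ring.
  have [c1 i1] := IH k; have [c2 i2] := IH (1 + k); have [c3 i3] := IH (-1 + k).
  rewrite E; split.
    by apply: ccontD; [exact: ccontZ|apply: ccontD; exact: ccontZ].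
  rewrite cintD ?cintD ?cintZ// ?i1 ?i2 ?i3; [by ring|exact: ccontZ|exact: ccontZ|exact: ccontZ|].
  by apply: ccontD; exact: ccontZ.
have [M HM] := ccont_bounded (a := - 2^-1) (b := 2^-1) ltac:(lra) cD1.
pose q := T (a / 2).
have coslt (x y : R) : 0 <= x -> x < y -> y <= 2^-1 -> cos (2 * pi * y) < cos (2 * pi * x).
  move=> x0 xy y2.
  have h1 : 0 <= pi * (1 - 2 * y) by apply: mulr_ge0; [exact: pi_ge0|lra].
  have h2 : 0 <= pi * x by apply: mulr_ge0 => //; exact: pi_ge0.
  have h3 : 0 < pi * (y - x) by apply: mulr_gt0; [exact: pi_gt0|lra].
  by rewrite ltr_cos ?in_itv /=; [lra|apply/andP; split; lra|apply/andP; split; lra].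
have cosle (x y : R) : 0 <= x -> x <= y -> y <= 2^-1 -> cos (2 * pi * y) <= cos (2 * pi * x).
  move=> x0 xy y2; have [->//|nxy] := eqVneq x y.
  by apply/ltW/coslt => //; rewrite lt_neqAle nxy.
have q1 : 1 < q.
  by have := coslt (a / 2) a ltac:(lra) ltac:(lra) ltac:(lra); rewrite /q /T; lra.
have cosn (x : R) : cos (2 * pi * x) = cos (2 * pi * `|x|).
  by rewrite -[in LHS]cos_norm normrM gtr0_norm ?mulr_gt0.
have ReF n x : complex.Re (D1 x * (T x)%:Co ^+ n * echar 0 x%:Co) = complex.Re (D1 x) * T x ^+ n.
  by rewrite /echar mulr0 mul0r cexp0 mulr1 -rmorphXn cReM /= mulr0 subr0.
have D1n x : `|x| <= a -> 2^-1 <= complex.Re (D1 x).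
  move=> xa; have := Hd x (le_lt_trans xa ad); rewrite add0r.
  have -> : D1 0 = 1 by rewrite /D1 mulVf.
  move=> /(le_trans (Re_le_nm _)); rewrite cReB /= ler_norml => /andP[]; lra.
have bound n : a * (2^-1 * q ^+ n) <= M.
  have [cF iF] := zero n 0.
  have out x : - 2^-1 <= x <= 2^-1 -> a <= `|x| ->
      - M <= complex.Re (D1 x * (T x)%:Co ^+ n * echar 0 x%:Co).
    move=> xI ax; rewrite ReF.
    have : `|complex.Re (D1 x) * T x ^+ n| <= M.
      rewrite normrM normrX -[M]mulr1; apply: ler_pM => //.
        exact: le_trans (Re_le_nm _) (HM _ xI).
      apply: exprn_ile1 => //; rewrite ler_norml /T cosn.
      have := cos_geN1 (2 * pi * `|x|); have := cos_le1 (2 * pi * a).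
      have := cosle a `|x| (ltW a0) ax.
      have -> : `|x| <= 2^-1 by rewrite ler_norml.
      by move=> /(_ isT) ? ? ?; apply/andP; split; lra.
    by rewrite ler_norml => /andP[].
  have mid x : `|x| <= a -> 0 <= complex.Re (D1 x * (T x)%:Co ^+ n * echar 0 x%:Co).
    move=> xa; rewrite ReF mulr_ge0//; first by have := D1n x xa; lra.
    apply: exprn_ge0; rewrite /T cosn; have := cosle `|x| a (normr_ge0 x) xa ltac:(lra); lra.
  have inn x : `|x| <= a / 2 -> 2^-1 * q ^+ n <= complex.Re (D1 x * (T x)%:Co ^+ n * echar 0 x%:Co).
    move=> xa; rewrite ReF; apply: ler_pM => //.
    - by apply: exprn_ge0; lra.
    - by apply: D1n; lra.
    apply: lerXn2r; rewrite ?nnegrE; [lra| |].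
      rewrite /T cosn; have := cosle `|x| a (normr_ge0 x) ltac:(lra) ltac:(lra); lra.
    rewrite /q /T [in leRHS]cosn lerB// lerD2l.
    by apply: cosle => //; lra.
  pose F x := D1 x * (T x)%:Co ^+ n * echar 0 x%:Co.
  (* The inner interval has length a and real part at least q^n / 2, the two next to it contribute
     nonnegative amounts, and the outer ones lose at most M in total. *)
  have {iF} : cint F (- 2^-1) (- a) + cint F (- a) (- (a / 2)) +
      cint F (- (a / 2)) (a / 2) + cint F (a / 2) a + cint F a 2^-1 = 0.
    by rewrite !cint_chasles.
  move=> /(congr1 (fun w : R[i]^o => complex.Re w)); rewrite !cReD -[complex.Re 0]/0 => E.
  have j1 : - M * (- a - - 2^-1) <= complex.Re (cint F (- 2^-1) (- a)).
    apply: cint_Re_ge => // [|x /andP[h1 h2]]; first lra.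
    by apply: out; [apply/andP; split; lra|rewrite ler0_norm; lra].
  have j2 : 0 * (- (a / 2) - - a) <= complex.Re (cint F (- a) (- (a / 2))).
    apply: cint_Re_ge => // [|x /andP[h1 h2]]; first lra.
    by apply: mid; rewrite ler0_norm; lra.
  have j3 : 2^-1 * q ^+ n * (a / 2 - - (a / 2)) <= complex.Re (cint F (- (a / 2)) (a / 2)).
    apply: cint_Re_ge => // [|x /andP[h1 h2]]; first lra.
    by apply: inn; rewrite ler_norml; apply/andP; split; lra.
  have j4 : 0 * (a - a / 2) <= complex.Re (cint F (a / 2) a).
    apply: cint_Re_ge => // [|x /andP[h1 h2]]; first lra.
    by apply: mid; rewrite ger0_norm; lra.
  have j5 : - M * (2^-1 - a) <= complex.Re (cint F a 2^-1).
    apply: cint_Re_ge => // [|x /andP[h1 h2]]; first lra.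
    by apply: out; [apply/andP; split; lra|rewrite ger0_norm; lra].
  have M0 : 0 <= M by apply: le_trans (nm_ge0 _) (HM 0 _); apply/andP; split; lra.
  have Ma : 0 <= M * a by apply: mulr_ge0 => //; exact: ltW.
  have -> : a * (2^-1 * q ^+ n) = 2^-1 * q ^+ n * (a / 2 - - (a / 2)) by field.
  have aux (Q r1 r2 r3 r4 r5 : R) : - M * (- a - - 2^-1) <= r1 -> 0 * (- (a / 2) - - a) <= r2 ->
      2^-1 * Q * (a / 2 - - (a / 2)) <= r3 -> 0 * (a - a / 2) <= r4 -> - M * (2^-1 - a) <= r5 ->
      r1 + r2 + r3 + r4 + r5 = 0 -> 2^-1 * Q * (a / 2 - - (a / 2)) <= M.
    by move: Ma; clear; lra.
  exact: aux j1 j2 j3 j4 j5 E.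
(* Bernoulli's inequality makes q^n too large for the bound M at this n. *)
pose n := (Num.truncn (2 * M / (a * (q - 1)))).+1; have bn := bound n.
have qn (k : nat) : 1 + k%:R * (q - 1) <= q ^+ k.
  elim: k => [|k IH]; first by rewrite mul0r addr0.
  rewrite exprS; have q0 : 0 <= q by lra.
  apply: le_trans (ler_wpM2l q0 IH); rewrite -subr_ge0.
  have -> : q * (1 + k%:R * (q - 1)) - (1 + k.+1%:R * (q - 1)) = k%:R * (q - 1) ^+ 2.
    by rewrite -natr1; ring.
  by rewrite mulr_ge0// sqr_ge0.
have : 2 * M / (a * (q - 1)) < n%:R by exact: truncnS_gt.
rewrite ltr_pdivrMr ?mulr_gt0 ?subr_gt0// => h.
have : a * (2^-1 * (1 + n%:R * (q - 1))) <= a * (2^-1 * q ^+ n).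
  by apply: ler_wpM2l; [exact: ltW|apply: ler_wpM2l; rewrite ?invr_ge0 ?qn].
move: bn h a0; clear; move: (q ^+ n) (n%:R : R) => Q N bn h a0; nra.
Qed.

Lemma cint_periodic D (a : R) : ccont D -> (forall x, D (x + 1) = D x) ->
  cint D a (a + 1) = cint D 0 1.
Proof.
move=> cD per; rewrite -(cint_chasles D a 1) -(cint_chasles D 0 a 1) addrC.
have -> : cint D 1 (a + 1) = cint D 0 a; last by [].
have := @cint_affine R D 0 a 1 1 cD; rewrite mulr0 add0r mul1r => <-.
by apply: eq_cint => x; rewrite mul1r mul1r per.
Qed.

(** Translation by x only multiplies each coefficient by a character, so the value at 0 decides;
    periodicity brings the shifted period back to [0, 1]. *)
Theorem fourier_unique D : ccont D -> (forall x, D (x + 1) = D x) ->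
  (forall k, cint (fun x => D x * echar k x%:Co) 0 1 = 0) -> forall x, D x = 0.
Proof.
move=> cD per H x.
have cDx : ccont (fun t => D (1 * t + x)) by exact: ccont_affine.
have ce k : ccont (fun x : R => echar k x%:Co).
  by have := echar_ccont k 0; under eq_fun do rewrite add0r.
have /= := fourier_vanish_at0 cDx; rewrite mulr0 add0r; apply => k.
rewrite (eq_cint (g := fun t => echar k (- x%:Co) *
   ((1 : R)%:Co * (D (1 * t + x) * echar k (1 * t + x)%:Co)))); last first.
  move=> t; rewrite !mul1r rmorphD /= mulrCA -echar_add; congr (_ * echar k _); ring.
have cDe : ccont (fun t => D t * echar k t%:Co) by exact: ccontM.
rewrite cintZ; last by apply: ccontZ; exact: (ccont_affine (f := fun t => D t * echar k t%:Co)).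
rewrite (@cint_affine _ (fun t => D t * echar k t%:Co))//.
have -> : 1 * 2^-1 + x = 1 * - 2^-1 + x + 1 by field.
rewrite cint_periodic ?H ?mulr0// => t.
by rewrite per rmorphD echar_add1.
Qed.

End FourierUniqueness.

(** * Convergence estimates *)

Section PowerBounds.
Context {R : realType}.
Implicit Types (a b p c x : R).

Lemma powRN_le a b p : 0 < a -> a <= b -> 0 <= p -> b `^ (- p) <= a `^ (- p).
Proof.
move=> a0 ab p0; have b0 : 0 < b by exact: lt_le_trans a0 ab.
rewrite !powRN lef_pV2 ?posrE ?powR_gt0//.
by apply: ge0_ler_powR => //; rewrite nnegrE ltW.
Qed.

(** One step of the integral test for x^(- p), obtained from ln (1 + u) <= u and 1 + u <= exp u. *)
Lemma powR_step a p : 0 < a -> 1 < p ->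
  (p - 1) * (a + 1) `^ (- p) <= a `^ (- (p - 1)) - (a + 1) `^ (- (p - 1)).
Proof.
move=> a0 p1; have b0 : 0 < a + 1 by rewrite addr_gt0.
set q := p - 1; have q0 : 0 < q by rewrite subr_gt0.
have E1 : (a + 1) `^ (- p) = (a + 1) `^ (- q) * (a + 1)^-1.
  have -> : - p = - q + (- 1) by rewrite /q; ring.
  rewrite powRD; last by rewrite (gt_eqF b0) implybT.
  by rewrite powR_inv1 ?(ltW b0).
have E2 : a `^ (- q) = (a + 1) `^ (- q) * ((a + 1) / a) `^ q.
  rewrite powRM ?invr_ge0 ?(ltW a0) ?(ltW b0)// mulrA -powRD; last first.
    by rewrite (gt_eqF b0) implybT.
  by rewrite addNr powRr0 mul1r -powR_inv1 ?(ltW a0)// -powRrM mulN1r.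
rewrite E1 E2 -[X in _ - X]mulr1 -mulrBr mulrCA ler_wpM2l ?powR_ge0//.
have u0 : 0 < (a + 1) / a by rewrite divr_gt0.
have h1 : q * (a + 1)^-1 <= q * ln ((a + 1) / a).
  rewrite ler_wpM2l ?(ltW q0)//.
  have -> : ln ((a + 1) / a) = - ln (a / (a + 1)).
    by rewrite -lnV ?posrE ?divr_gt0// invf_div.
  have -> : a / (a + 1) = 1 + (- (a + 1)^-1) by field; rewrite gt_eqF.
  rewrite lerNr; apply: le_ln1Dx; rewrite ltrNl opprK invf_lt1//.
  by rewrite ltrDr.
apply: le_trans h1 _; rewrite /powR (gt_eqF u0).
by have := expR_ge1Dx (q * ln ((a + 1) / a)); lra.
Qed.

Lemma pseries_bound p n : 1 < p ->
  \sum_(0 <= i < n) (1 + i%:R : R) `^ (- p) <= 1 + (p - 1)^-1.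
Proof.
move=> p1; have q0 : 0 < p - 1 by rewrite subr_gt0.
(* The telescoping term makes the claim strong enough for induction. *)
suff : \sum_(0 <= i < n.+1) (1 + i%:R : R) `^ (- p) <=
    1 + (p - 1)^-1 * (1 - (n%:R + 1) `^ (- (p - 1))).
  rewrite big_nat_recr //= => H.
  have h1 : 0 <= (1 + n%:R : R) `^ (- p) by exact: powR_ge0.
  have h2 : 0 <= (p - 1)^-1 * (n%:R + 1) `^ (- (p - 1)).
    by rewrite mulr_ge0 ?powR_ge0// invr_ge0 ltW.
  move: H; rewrite mulrBr mulr1; lra.
elim: n => [|n IH].
  by rewrite big_nat1 addr0 !add0r !powR1 subrr mulr0 addr0.
rewrite big_nat_recr //=.
have h := @powR_step (n%:R + 1) p ltac:(by rewrite ltr_wpDl) p1.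
have E : 1 + n.+1%:R = n%:R + 1 + 1 :> R by rewrite -natr1; ring.
have E' : n.+1%:R + 1 = n%:R + 1 + 1 :> R by rewrite -natr1.
rewrite E E'; set u := (_ + _ + _) `^ (- p) in h *.
set v := (n%:R + 1 + 1) `^ _ in h *; set w := (n%:R + 1) `^ _ in h IH.
have h' : u <= (p - 1)^-1 * (w - v).
  by rewrite -ler_pdivrMl ?invr_gt0// invrK.
move: IH; rewrite !mulrBr in h' *; lra.
Qed.

Lemma pseries_int_bound p n : 1 < p ->
  \sum_(0 <= j < n + n) (1 + `|j%:Z - n%:Z|%:~R : R) `^ (- p) <= 2 * (1 + (p - 1)^-1).
Proof.
move=> p1; apply: (@le_trans _ _ (2 * \sum_(0 <= i < n) (1 + i%:R : R) `^ (- p))); last first.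
  by rewrite ler_pM2l// pseries_bound.
elim: n => [|n IH]; first by rewrite big_geq// big_geq// mulr0.
rewrite addSn addnS big_nat_recl// big_nat_recr//= [in leRHS]big_nat_recr//=.
rewrite mulrDr.
have -> : \sum_(0 <= i < n + n) (1 + `|i.+1%:Z - n.+1%:Z|%:~R : R) `^ (- p) =
          \sum_(0 <= i < n + n) (1 + `|i%:Z - n%:Z|%:~R : R) `^ (- p).
  by apply: eq_bigr => i _; congr ((1 + `|_|%:~R) `^ _); lia.
have -> : `|0%:Z - n.+1%:Z| = n.+1%:Z by lia.
have -> : `|(n + n).+1%:Z - n.+1%:Z| = n%:Z by lia.
have h : (1 + n.+1%:~R : R) `^ (- p) <= (1 + n%:R) `^ (- p).
  apply: powRN_le; rewrite ?ltr_wpDr//; last lra.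
  by rewrite lerD2l -[_%:~R]/(n.+1%:R) ler_nat.
rewrite -[n%:~R]/(n%:R : R); lra.
Qed.

(* [u] and [n] are the upper half plane part and the integer shift of a lattice point of "size" [S]. *)
Lemma lattice_lower_bound (u : R[i]^o) (n : int) (S X y : R) : 0 < y ->
  y * S <= complex.Im u -> `|complex.Re u| <= X * S -> 0 <= S -> 0 <= X ->
  S + `|n%:~R| <= (1 + (X + 1) / y) * nm (u + n%:~R).
Proof.
move=> y0 Su Ru S0 X0.
have En : n%:~R = (n%:~R : R)%:Co :> R[i]^o by rewrite rmorph_int.
have h1 : y * S <= nm (u + n%:~R).
  apply: le_trans Su _; apply: le_trans (Im_le_nm _).
  by rewrite En cImD /= addr0 ler_norm.
have h2 : `|n%:~R| <= nm (u + n%:~R) + X * S.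
  apply: le_trans (lerD (Re_le_nm _) Ru); rewrite En cReD /=.
  by have := ler_normB (complex.Re u + n%:~R) (complex.Re u); rewrite addrAC subrr add0r.
have h3 : S <= nm (u + n%:~R) / y by rewrite ler_pdivlMr// mulrC.
have h4 : (X + 1) * S <= (X + 1) * (nm (u + n%:~R) / y).
  by apply: ler_wpM2l h3; lra.
rewrite mulrDl mul1r mulrAC -mulrA; lra.
Qed.

(** From ln (e x) <= e x with e = c / (|p| + 1), which is small enough for |p| e <= c. *)
Lemma exp_power_bound p c : 0 < c -> exists2 C : R, 0 < C &
  forall x, 1 <= x -> x `^ p <= C * expR (c * x).
Proof.
move=> c0; pose e := c / (`|p| + 1).
have p0 : 0 < `|p| + 1 by rewrite ltr_wpDl.
have e0 : 0 < e by rewrite divr_gt0.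
exists (expR (`|p| * - ln e)); first exact: expR_gt0.
move=> x x1; have x0 : 0 < x by exact: lt_le_trans x1.
rewrite /powR (gt_eqF x0) -expRD ler_expR.
have lx : 0 <= ln x by exact: ln_ge0.
have h1 : p * ln x <= `|p| * ln x by rewrite ler_wpM2r// ler_norm.
apply: le_trans h1 _.
have h2 : ln x <= - ln e + e * x.
  have := ln_sublinear (mulr_gt0 e0 x0); rewrite lnM ?posrE//; lra.
apply: le_trans (ler_wpM2l (normr_ge0 p) h2) _.
rewrite mulrDr lerD2l mulrA ler_wpM2r ?(ltW x0)//.
by rewrite /e mulrA ler_pdivrMr// mulrDr mulr1 mulrC lerDl ltW.
Qed.

Lemma geometric_bound c n : 0 <= c -> c < 1 ->
  \sum_(0 <= i < n) c ^+ i <= (1 - c)^-1.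
Proof.
move=> c0 c1; have c2 : 0 < 1 - c by rewrite subr_gt0.
rewrite -[leRHS]mul1r ler_pdivlMr//.
suff -> : (\sum_(0 <= i < n) c ^+ i) * (1 - c) = 1 - c ^+ n.
  by rewrite gerBl exprn_ge0.
elim: n => [|n IH]; first by rewrite big_geq// mul0r expr0 subrr.
by rewrite big_nat_recr//= mulrDl IH exprS; ring.
Qed.

(** Half of the exponential decay absorbs the power; the other half leaves a geometric series. *)
Lemma exp_series_bound p c : 0 < c -> exists M : R, forall n,
  \sum_(0 <= i < n) (i.+1%:R `^ p * expR (- (c * i.+1%:R))) <= M.
Proof.
move=> c0; have c20 : 0 < c / 2 by rewrite divr_gt0.
have [C C0 HC] := exp_power_bound p c20.
pose r := expR (- (c / 2)).
have r1 : r < 1 by rewrite expR_lt1 oppr_lt0.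
exists (C * (1 - r)^-1) => n.
apply: le_trans (_ : C * \sum_(0 <= i < n) r ^+ i <= _); last first.
  by rewrite ler_wpM2l ?(ltW C0)// geometric_bound ?expR_ge0.
rewrite mulr_sumr; apply: ler_sum => i _.
have h : i.+1%:R `^ p <= C * expR (c / 2 * i.+1%:R) by apply: HC; rewrite ler1n.
apply: le_trans (ler_wpM2r (expR_ge0 _) h) _.
rewrite -(mulrA C) -expRD ler_wpM2l ?(ltW C0)// /r -expRM_natl ler_expR.
have E : i.+1%:R = i%:R + 1 :> R by rewrite -natr1.
rewrite E -subr_ge0.
have -> : i%:R * - (c / 2) - (c / 2 * (i%:R + 1) - c * (i%:R + 1)) = c / 2 by field.
exact: ltW.
Qed.

End PowerBounds.

(** * Dirichlet series and the bilateral series *)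

Section DirichletSeries.
Context {R : realType}.

Lemma expR_linear_bound (d u : R) : 0 < d -> 0 <= u -> u <= d^-1 * expR (d * u).
Proof.
move=> d0 u0; rewrite ler_pdivlMl//.
by have := expR_ge1Dx (d * u); lra.
Qed.

(** Termwise differentiation: the quadratic remainder of exp is summed directly. The surplus exp (d
    |lam|) in the summability hypothesis pays for |lam|^2 and for the increment exp (|h| |lam|) with
    |h| < d / 2. It serves both for series in s with logarithmic frequencies and for the q-expansion
    as a function of z. *)
Lemma dirichlet_cderiv (I : choiceType) (b lam : I -> R[i]^o) (s0 : R[i]^o) (d : R)
    (Phi : R[i]^o -> R[i]^o) : 0 < d ->
  abs_summable (fun i => (nm (b i * cexp (s0 * lam i)) * expR (d * nm (lam i)))%:Co) ->
  (forall h, nm h < d -> hsum (fun i => b i * cexp ((s0 + h) * lam i)) (Phi (s0 + h))) ->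
  exists2 e, hsum (fun i => b i * cexp (s0 * lam i) * lam i) e & cderiv Phi s0 e.
Proof.
move=> d0 Hs HPhi.
set t := fun i => b i * cexp (s0 * lam i).
have t0 i : 0 <= nm (t i) * expR (d * nm (lam i)) by rewrite mulr_ge0 ?nm_ge0 ?expR_ge0.
have [e He] : exists e, hsum (fun i => t i * lam i) e.
  apply: abs_summable_hsum; apply: abs_summable_le (abs_summableZ (d^-1)%:Co Hs) => i.
  rewrite (nmM (t i)) (nmM (d^-1)%:Co) !nm_real normfV (gtr0_norm d0) (ger0_norm (t0 i)).
  rewrite mulrCA ler_wpM2l ?nm_ge0//.
  exact: expR_linear_bound d0 (nm_ge0 _).
have [M HM] := Hs.
have HM' (A : {fset I}) : \sum_(i <- A) nm (t i) * expR (d * nm (lam i)) <= M.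
  apply: le_trans (HM A); apply: ler_sum => i _.
  by rewrite nm_real (ger0_norm (t0 i)) lexx.
have M0 : 0 <= M by have := HM' fset0; rewrite big_seq_fset0.
(* The 4 is that of [cexp_sub1x_bound], and (4 / d)^2 comes from l^2 <= (4 / d)^2 exp (d l / 2); M +
   1 makes K positive. *)
pose K := 4 * (4 / d) ^+ 2 * (M + 1).
have M1 : 0 < M + 1 by lra.
have K0 : 0 < K by rewrite /K mulr_gt0// mulr_gt0// exprn_gt0// divr_gt0.
exists e => // eps eps0.
exists (Num.min (d / 2) (eps / K)); first by rewrite lt_min !divr_gt0.
move=> h; rewrite lt_min => /andP[hd hK].
have hd' : nm h < d by lra.
have H1 := HPhi h hd'; have := HPhi 0; rewrite nm0 addr0 => /(_ d0) H2.
have H3 := hsumD H1 (hsumZ (-1) (hsumD H2 (hsumZ h He))).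
have -> : Phi (s0 + h) - Phi s0 - h * e = Phi (s0 + h) + -1 * (Phi s0 + h * e) by ring.
apply: le_trans (_ : nm h * K * nm h <= _); last first.
  by rewrite ler_wpM2r ?nm_ge0// ltW// -ltr_pdivlMr.
apply: (hsum_nm_le H3) => A.
apply: (@le_trans _ _ (\sum_(i <- A) nm h ^+ 2 * (4 * (4 / d) ^+ 2) * (nm (t i) * expR (d * nm (lam i))))).
  apply: ler_sum => i _.
  have -> : b i * cexp ((s0 + h) * lam i) + -1 * (b i * cexp (s0 * lam i) + h * (t i * lam i)) =
      t i * (cexp (h * lam i) - 1 - h * lam i).
    by rewrite /t mulrDl cexpD; ring.
  rewrite nmM [leRHS]mulrCA; apply: ler_wpM2l; first exact: nm_ge0.
  apply: le_trans (cexp_sub1x_bound _) _; rewrite nmM.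
  set l := nm (lam i); have l0 : 0 <= l by exact: nm_ge0.
  have l2 : l ^+ 2 <= (4 / d) ^+ 2 * expR (d / 2 * l).
    have d4 : 0 < d / 4 by rewrite divr_gt0.
    have := expR_linear_bound d4 l0; rewrite invf_div => h1.
    have -> : expR (d / 2 * l) = expR (d / 4 * l) ^+ 2.
      by rewrite -expRM_natl; congr expR; field.
    rewrite -exprMn; apply: lerXn2r => //; rewrite ?nnegrE//.
    by rewrite mulr_ge0 ?expR_ge0// divr_ge0// ltW.
  have e2 : expR (nm h * l) <= expR (d / 2 * l).
    by rewrite ler_expR ler_wpM2r// ltW.
  have -> : expR (d * l) = expR (d / 2 * l) * expR (d / 2 * l).
    by rewrite -expRD; congr expR; field.
  have h3 : l ^+ 2 * expR (nm h * l) <=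
      (4 / d) ^+ 2 * expR (d / 2 * l) * expR (d / 2 * l).
    by apply: ler_pM; rewrite ?expR_ge0 ?exprn_ge0.
  have h4 : 0 <= 4 * nm h ^+ 2 by rewrite mulr_ge0// exprn_ge0// nm_ge0.
  have h5 := ler_wpM2l h4 h3.
  apply: le_trans (le_trans _ h5) _.
    by rewrite le_eqVlt; apply/orP; left; apply/eqP; rewrite /l; ring.
  by rewrite le_eqVlt; apply/orP; left; apply/eqP; ring.
rewrite -mulr_sumr.
have -> : nm h * K * nm h = nm h ^+ 2 * (4 * (4 / d) ^+ 2) * (M + 1) by rewrite /K; ring.
apply: ler_wpM2l; last by apply: le_trans (HM' A) _; rewrite lerDl.
by rewrite mulr_ge0 ?exprn_ge0 ?nm_ge0// mulr_ge0// exprn_ge0// divr_ge0// ltW.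
Qed.

(** This is (i + 1)^s: the index starts at 0, the series at 1. *)
Definition spow (i : nat) (s : R[i]^o) : R[i]^o := cexp (s * (ln i.+1%:R)%:Co).

Lemma nm_spow i s : nm (spow i s) = i.+1%:R `^ complex.Re s.
Proof.
by rewrite /spow nm_cexp cReM /= mulr0 subr0 /powR pnatr_eq0.
Qed.

Lemma spowD i s t : spow i (s + t) = spow i s * spow i t.
Proof. by rewrite /spow mulrDl cexpD. Qed.

Lemma spow_nat i (m : nat) : spow i m%:R = i.+1%:R ^+ m.
Proof.
rewrite /spow cexpMn cexp_real lnK ?posrE ?ltr0n// rmorph_nat //.
Qed.

Lemma spow0 i : spow i 0 = 1.
Proof. by rewrite /spow mul0r cexp0. Qed.

Section ExponentialDecay.
Variables (c : nat -> R[i]^o) (B kappa : R).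
Hypothesis kappa0 : 0 < kappa.
Hypothesis cB : forall i, nm (c i) <= B * expR (- (kappa * i.+1%:R)).

Lemma decay_sum_bound (p : R) : exists M : R, forall n,
  \sum_(0 <= i < n) (i.+1%:R `^ p * nm (c i)) <= M.
Proof.
have B0 : 0 <= B.
  have := le_trans (nm_ge0 _) (cB 0); rewrite pmulr_lge0 ?expR_gt0//.
have [M HM] := @exp_series_bound R p kappa kappa0.
exists (B * M) => n; apply: le_trans (ler_wpM2l B0 (HM n)).
rewrite mulr_sumr; apply: ler_sum => i _.
by rewrite mulrCA ler_wpM2l ?powR_ge0.
Qed.

Lemma decay_summable s : abs_summable (fun i => c i * spow i s).
Proof.
have [M HM] := decay_sum_bound (complex.Re s).
apply: (abs_summable_nat (M := M)) => n; apply: le_trans (HM n).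
by apply: ler_sum => i _; rewrite nmM nm_spow mulrC.
Qed.

(** With d = 1 the surplus factor is exp (ln (i + 1)) = i + 1, one more power for the exponential
    decay to absorb. *)
Lemma decay_cderiv (Phi : R[i]^o -> R[i]^o) :
  (forall s, hsum (fun i => c i * spow i s) (Phi s)) -> forall s, exists e, cderiv Phi s e.
Proof.
move=> H s; have [||e _ He] := @dirichlet_cderiv _ c (fun i => (ln i.+1%:R)%:Co) s 1 Phi ltr01; last by exists e.
  have [M HM] := decay_sum_bound (complex.Re s + 1).
  apply: (abs_summable_nat (M := M)) => n; apply: le_trans (HM n).
  apply: ler_sum => i _; rewrite nm_real ger0_norm ?mulr_ge0 ?nm_ge0 ?expR_ge0//.
  rewrite -/(spow i s) nmM nm_spow mul1r nm_real ger0_norm ?ln_ge0 ?ler1n//.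
  rewrite lnK ?posrE ?ltr0n// powRD ?pnatr_eq0 ?implybT//.
  by rewrite powRr1// [_ * nm _]mulrC mulrA [nm _ * _]mulrC mulrAC lexx.
by move=> h _; exact: H.
Qed.

End ExponentialDecay.
End DirichletSeries.

Section BilateralSeries.
Context {R : realType}.
Implicit Types (s z : R[i]^o) (n : int).

Definition biterm s z n : R[i]^o := cpowN (z + n%:~R) s.
Definition biseries s z : R[i]^o := summability.sum (biterm s z).

Lemma Im_shift z n : complex.Im (z + n%:~R) = complex.Im z.
Proof.
have -> : n%:~R = (n%:~R : R)%:Co :> R[i]^o by rewrite rmorph_int.
by rewrite cImD /= addr0.
Qed.

Lemma Re_shift z n : complex.Re (z + n%:~R) = complex.Re z + n%:~R.
Proof.
have -> : n%:~R = (n%:~R : R)%:Co :> R[i]^o by rewrite rmorph_int.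
by rewrite cReD.
Qed.

Definition bidom (C p : R) n : R[i]^o := (C * (1 + `|n|%:~R) `^ (- p))%:Co.

Lemma bidom_summable C p : 1 < p -> abs_summable (bidom C p).
Proof.
move=> p1; apply: (abs_summable_int (M := `|C| * (2 * (1 + (p - 1)^-1)))) => N.
apply: le_trans (ler_wpM2l (normr_ge0 C) (pseries_int_bound N p1)).
rewrite mulr_sumr; apply: ler_sum => j _.
by rewrite nm_real normrM (ger0_norm (powR_ge0 _ _)).
Qed.

Lemma nm_shift_lower z n (X y : R) : 0 < y -> y <= complex.Im z ->
  `|complex.Re z| <= X -> 1 + `|n|%:~R <= (1 + (X + 1) / y) * nm (z + n%:~R).
Proof.
move=> y0 yz zX; have X0 : 0 <= X by apply: le_trans zX.
have := @lattice_lower_bound R z n 1 X y y0; rewrite !mulr1 => H.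
by rewrite intr_norm; exact: H.
Qed.

(** The bound is uniform for Im z >= y and |Re z| <= X; this is what gives uniform convergence on
    horizontal segments. *)
Lemma biterm_bound s z n (X y : R) : 0 < y -> y <= complex.Im z ->
  `|complex.Re z| <= X -> 0 <= complex.Re s ->
  nm (biterm s z n) <= nm (bidom (expR (pi * `|complex.Im s|) *
     (1 + (X + 1) / y) `^ complex.Re s) (complex.Re s) n).
Proof.
move=> y0 yz zX s0; have X0 : 0 <= X by apply: le_trans zX.
have I0 : 0 < complex.Im (z + n%:~R) by rewrite Im_shift; exact: lt_le_trans yz.
have K0 : 0 < 1 + (X + 1) / y by rewrite ltr_pwDl// divr_ge0 ?(ltW y0)//; lra.
have n0 : 0 < 1 + `|n|%:~R :> R by rewrite ltr_pwDl// ler0z.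
apply: le_trans (nm_cpowN_le _ (ltW I0) (Im_gt0_neq0 I0)) _.
rewrite nm_real [X in _ <= X]ger0_norm; last by rewrite !mulr_ge0 ?expR_ge0 ?powR_ge0.
rewrite -mulrA ler_wpM2l ?expR_ge0//.
have h : (1 + `|n|%:~R) / (1 + (X + 1) / y) <= nm (z + n%:~R).
  by rewrite ler_pdivrMr// mulrC; exact: nm_shift_lower.
apply: le_trans (powRN_le _ h s0) _; first by rewrite divr_gt0.
rewrite powRM ?(ltW n0) ?invr_ge0 ?(ltW K0)// mulrC.
by rewrite -[X in X `^ _ * _ <= _]powR_inv1 ?(ltW K0)// -powRrM mulrNN mul1r.
Qed.

Lemma biterm_summable s z : 0 < complex.Im z -> 1 < complex.Re s ->
  abs_summable (biterm s z).
Proof.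
move=> z0 s1; apply: (abs_summable_le _ (bidom_summable (expR (pi * `|complex.Im s|) *
  (1 + (`|complex.Re z| + 1) / complex.Im z) `^ complex.Re s) s1)) => n.
by apply: biterm_bound => //; lra.
Qed.

Lemma hsum_biseries s z : 0 < complex.Im z -> 1 < complex.Re s ->
  hsum (biterm s z) (biseries s z).
Proof.
move=> z0 s1; have [L HL] := abs_summable_hsum (biterm_summable z0 s1).
by rewrite /biseries (hsum_summability HL).
Qed.

Lemma biseries_cderiv s z : 0 < complex.Im z -> 1 < complex.Re s ->
  exists e, cderiv (biseries ^~ z) s e.
Proof.
(* Half of the room above 1 is spent on the surplus exp (d |clog w|), of order |w|^d; the exponent
   sg - d stays above 1. *)
move=> z0 s1; pose sg := complex.Re s; pose d := (sg - 1) / 2.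
have d0 : 0 < d by rewrite divr_gt0// subr_gt0.
pose K := 1 + (`|complex.Re z| + 1) / complex.Im z.
have K1 : 1 <= K by rewrite /K lerDl divr_ge0 ?(ltW z0)// addr_ge0.
have K0 : 0 < K by exact: lt_le_trans K1.
have [||e _ He] := @dirichlet_cderiv _ _ (fun=> 1) (fun n => - clog (z + n%:~R)) s d
  (biseries ^~ z) d0; last by exists e.
  pose C := expR (pi * `|complex.Im s|) * K `^ (sg - d) * (expR (d * pi) * K `^ (2 * d)).
  have sd1 : 1 < sg - d by rewrite /d; lra.
  apply: (abs_summable_le _ (bidom_summable C sd1)) => n.
  set w := z + n%:~R.
  have I0 : 0 < complex.Im w by rewrite Im_shift.
  have w0 := Im_gt0_neq0 I0; have nw0 : 0 < nm w by rewrite nm_gt0.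
  have wK : 1 + `|n|%:~R <= K * nm w by apply: nm_shift_lower; rewrite ?lexx.
  have n0 : 0 < 1 + `|n|%:~R :> R by rewrite ltr_pwDl// ler0z.
  rewrite mul1r nmN mulrN -/(cpowN w s).
  rewrite nm_real [X in X <= _]ger0_norm ?mulr_ge0 ?expR_ge0 ?nm_ge0//.
  rewrite nm_real [X in _ <= X]ger0_norm; last first.
    by rewrite !mulr_ge0 ?powR_ge0 ?expR_ge0.
  (* |w| may be less than 1, but ln |w| >= - ln K, hence the absolute value of ln |w| is at most ln
     |w| + 2 ln K. *)
  have clog_le : nm (clog w) <= ln (nm w) + 2 * ln K + pi.
    apply: le_trans (nm_le _) _; apply: lerD; last first.
      by have /andP[c0 c1] := carg_upper (ltW I0) w0; rewrite /= ger0_norm.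
    have lK : 0 <= ln K by exact: ln_ge0.
    have lw : - ln K <= ln (nm w).
      rewrite -lnV ?posrE// ler_ln ?posrE ?invr_gt0// -[leLHS]mul1r ler_pdivrMr//.
      rewrite mulrC; apply: le_trans wK; rewrite lerDl ler0z//.
    by rewrite /= -/(nm _) ler_norml; apply/andP; split; lra.
  have e1 : expR (d * nm (clog w)) <= nm w `^ d * (expR (d * pi) * K `^ (2 * d)).
    rewrite /powR (gt_eqF nw0) (gt_eqF K0) -!expRD ler_expR.
    by have := ler_wpM2l (ltW d0) clog_le; rewrite !mulrDr; lra.
  have e2 := nm_cpowN_le s (ltW I0) w0.
  apply: le_trans (ler_pM (nm_ge0 _) (expR_ge0 _) e2 e1) _.
  have -> : expR (pi * `|complex.Im s|) * nm w `^ (- complex.Re s) *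
      (nm w `^ d * (expR (d * pi) * K `^ (2 * d))) =
    expR (pi * `|complex.Im s|) * (expR (d * pi) * K `^ (2 * d)) * nm w `^ (- (sg - d)).
    have -> : - (sg - d) = - sg + d by ring.
    rewrite [in RHS]powRD ?(gt_eqF nw0) ?implybT//; ring.
  rewrite /C; set A := expR (pi * _); set B := expR (d * pi) * _.
  have -> : A * K `^ (sg - d) * B * (1 + `|n|%:~R) `^ (- (sg - d)) =
    A * B * (K `^ (sg - d) * (1 + `|n|%:~R) `^ (- (sg - d))) by ring.
  apply: ler_wpM2l; first by rewrite !mulr_ge0 ?expR_ge0 ?powR_ge0.
  have h : (1 + `|n|%:~R) / K <= nm w by rewrite ler_pdivrMr// mulrC.
  apply: le_trans (powRN_le _ h _) _; [by rewrite divr_gt0|lra|].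
  rewrite powRM ?(ltW n0) ?invr_ge0 ?(ltW K0)//.
  by rewrite -[X in _ * X `^ _ <= _]powR_inv1 ?(ltW K0)// -powRrM mulrNN mul1r mulrC.
move=> h hd; have sh : 1 < complex.Re (s + h).
  rewrite cReD; have := Re_le_nm h; rewrite ler_norml => /andP[h1 _].
  by move: hd; rewrite /d -/sg; lra.
apply: eq_hsum (hsum_biseries z0 sh) => n.
by rewrite mul1r mulrN.
Qed.

End BilateralSeries.

(** * Fourier coefficients of the bilateral series *)

Section LipschitzCoefficients.
Context {R : realType}.
Variable s : R[i]^o.
Hypothesis s1 : 1 < complex.Re s.
Let s0 : 0 <= complex.Re s. Proof. exact: ltW (lt_trans ltr01 s1). Qed.
Implicit Types (x y : R) (k : int).

Lemma nm_echar k (z : R[i]^o) : nm (echar k z) = expR (- (2 * pi * k%:~R * complex.Im z)).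
Proof.
rewrite /echar nm_cexp.
have -> : k%:~R = (k%:~R : R)%:Co :> R[i]^o by rewrite rmorph_int.
by congr expR; rewrite !(cReM, cImM) /=; ring.
Qed.

Lemma biseries_add1 (z : R[i]^o) : 0 < complex.Im z -> biseries s (z + 1) = biseries s z.
Proof.
move=> z0.
have H := hsum_biseries z0 s1.
have c1 : cancel (fun n : int => n + 1) (fun n => n - 1) by move=> n; rewrite addrK.
have c2 : cancel (fun n : int => n - 1) (fun n => n + 1) by move=> n; rewrite subrK.
rewrite /biseries; apply: hsum_summability.
apply: eq_hsum (hsum_bij c1 c2 H) => n /=.
by rewrite /biterm intrD addrA addrAC.
Qed.

Lemma biseries_uniform (X y e : R) : 0 < y -> 0 < e -> exists N, forall n, (N <= n)%N ->
  forall z, y <= complex.Im z -> `|complex.Re z| <= X ->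
  nm (\sum_(0 <= j < n + n) biterm s z (j%:Z - n%:Z) - biseries s z) <= e.
Proof.
move=> y0 e0.
pose C := expR (pi * `|complex.Im s|) * (1 + (X + 1) / y) `^ complex.Re s.
have [A0 HA0] := dominated_hsum (bidom_summable C s1) e0.
have [N HN] := fsub_exhaust A0 (@int_range_cover); exists N => n Nn z yz zX.
rewrite -sum_int_range; apply: HA0 => [i||]; last exact: HN.
  by apply: (@biterm_bound R s z _ X y).
by apply: hsum_biseries => //; exact: lt_le_trans yz.
Qed.

Lemma biseries_bound (X y : R) : 0 < y -> exists M : R,
  forall z, y <= complex.Im z -> `|complex.Re z| <= X -> nm (biseries s z) <= M.
Proof.
move=> y0; pose C := expR (pi * `|complex.Im s|) * (1 + (X + 1) / y) `^ complex.Re s.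
have [M HM] := bidom_summable C s1; exists M => z yz zX.
have z0 : 0 < complex.Im z by exact: lt_le_trans yz.
apply: hsum_nm_le (hsum_biseries z0 s1) _ => A; apply: le_trans (HM A).
by apply: ler_sum => n _; apply: (@biterm_bound R s z _ X y).
Qed.

(** Continuity is local, so uniform approximation on bounded intervals is enough. *)
Lemma ccont_uniform_limit (F : R -> R[i]^o) :
  (forall (X e : R), 0 < e -> exists2 G, ccont G & forall x, `|x| <= X -> nm (G x - F x) <= e) ->
  ccont F.
Proof.
move=> H; apply: ccont_epsilon => x e e0.
have e3 : 0 < e / 3 by rewrite divr_gt0.
have [G cG HG] := H (`|x| + 1) _ e3.
have [D D0 HD] := epsilon_ccont cG x e3.
exists (Num.min 1 D); first by rewrite lt_min ltr01.
move=> h; rewrite lt_min => /andP[h1 hD].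
have g1 := HG (x + h) ltac:(by apply: le_trans (ler_normD _ _) _; rewrite lerD2l ltW).
have g2 := HG x ltac:(by rewrite lerDl).
have g3 := HD h hD.
have -> : F (x + h) - F x = (G (x + h) - G x) - (G (x + h) - F (x + h)) + (G x - F x) by ring.
apply: le_trans (ler_nmD _ _) _; have := ler_nmB (G (x + h) - G x) (G (x + h) - F (x + h)).
by move: g1 g2 g3; lra.
Qed.

Lemma cpowN_ccont y : 0 < y -> ccont (fun x => cpowN (x +i* y) s).
Proof.
move=> y0; apply: (@rderiv_ccont R _ (fun x => - s * cpowN (x +i* y) (s + 1))) => x.
exact: (rderiv_horizontal (cpowN_cderiv s (y0 : 0 < complex.Im (x +i* y)))).
Qed.

Lemma shiftE x y (n : int) : ((x +i* y : R[i]^o) + n%:~R) = (x + n%:~R) +i* y.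
Proof.
have -> : n%:~R = (n%:~R : R)%:Co :> R[i]^o by rewrite rmorph_int.
by apply: complexP; rewrite ?cReD ?cImD /= ?addr0.
Qed.

Lemma biterm_ccont y (n : int) : 0 < y -> ccont (fun x => biterm s (x +i* y) n).
Proof.
move=> y0; have := ccont_affine 1 n%:~R (cpowN_ccont y0).
by congr ccont; apply/funext => x; rewrite /biterm shiftE mul1r.
Qed.

Lemma biseries_ccont y : 0 < y -> ccont (fun x => biseries s (x +i* y)).
Proof.
move=> y0; apply: ccont_uniform_limit => X e e0.
have [N HN] := biseries_uniform X y0 e0.
exists (fun x => \sum_(0 <= j < N + N) biterm s (x +i* y) (j%:Z - N%:Z)).
  by apply: ccont_sum => j; exact: biterm_ccont.
by move=> x xX; apply: HN.
Qed.

Lemma echar_hor_ccont k y : ccont (fun x => echar k (x +i* y)).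
Proof.
apply: (@rderiv_ccont R _ (fun x => two_pi_i * k%:~R * echar k (x +i* y))) => x.
exact: (rderiv_horizontal (echar_cderiv k (x +i* y))).
Qed.

Lemma cint_unfold (h : R -> R[i]^o) (a : R) n : ccont h ->
  cint h a (a + n%:R) = \sum_(0 <= j < n) cint (fun x => h (1 * x + (a + j%:R))) 0 1.
Proof.
move=> ch; elim: n => [|n IH]; first by rewrite addr0 cintxx big_geq.
rewrite big_nat_recr //= -IH -(cint_chasles h a (a + n%:R)); congr (_ + _).
have := cint_affine 0 1 1 (a + n%:R) ch.
rewrite mulr0 mulr1 add0r => E.
rewrite (_ : a + n.+1%:R = 1 + (a + n%:R)); last by rewrite -natr1; ring.
by rewrite -E; apply: eq_cint => x; exact: mul1r.
Qed.

Definition lip_kernel k (w : R[i]^o) : R[i]^o := cpowN w s * echar (- k) w.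

(* Unfolding the sum over Z turns the Fourier coefficient [lip_coef] into the limit of
   [lip_int], the integral of [lip_kernel] over [-N, N] + i y. *)
Definition lip_coef k y := cint (fun x => biseries s (x +i* y) * echar (- k) (x +i* y)) 0 1.

Definition lip_int k y (N : nat) :=
  cint (fun x => lip_kernel k (x +i* y)) (- N%:R) N%:R.

Lemma lip_kernel_ccont k y : 0 < y -> ccont (fun x => lip_kernel k (x +i* y)).
Proof. by move=> y0; apply: ccontM; [exact: cpowN_ccont|exact: echar_hor_ccont]. Qed.

(** Cut [-N, N] into unit intervals: the character has period 1 and is common to all the pieces, so
    only the powers are summed. *)
Lemma lip_int_unfold k y N : 0 < y -> lip_int k y N =
  cint (fun x => (\sum_(0 <= j < N + N) biterm s (x +i* y) (j%:Z - N%:Z)) *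
    echar (- k) (x +i* y)) 0 1.
Proof.
move=> y0; have ck := lip_kernel_ccont k y0.
rewrite /lip_int [X in cint _ _ X](_ : N%:R = - N%:R + (N + N)%:R); last by rewrite natrD; ring.
rewrite cint_unfold// -cint_sum; last by move=> j; exact: (ccont_affine 1 (- N%:R + j%:R) ck).
apply: eq_cint => x; rewrite big_distrl /=; apply: eq_bigr => j _.
rewrite /lip_kernel /biterm shiftE intrB mul1r.
have -> : (x + (- N%:R + j%:R)) +i* y = (x +i* y : R[i]^o) + (j%:Z - N%:Z)%:~R.
  by rewrite shiftE intrB; congr (_ +i* _); rewrite !pmulrn; ring.
rewrite echar_add; congr (_ * _).
  by rewrite shiftE intrB.
have -> : echar (- k) ((j%:Z - N%:Z)%:~R : R[i]^o) = 1; last by rewrite mulr1.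
rewrite /echar -mulrA -intrM.
have -> : two_pi_i * (- k * (j%:Z - N%:Z))%:~R = two_pi_i * (- k * (j%:Z - N%:Z))%:~R * 1 :> R[i]^o.
  by rewrite mulr1.
exact: echar_period.
Qed.

(** Uniform convergence on the segment [0, 1] + i y lets the sum pass through the integral. *)
Lemma lip_int_cvg k y : 0 < y -> forall e : R, 0 < e -> exists N, forall n, (N <= n)%N ->
  nm (lip_int k y n - lip_coef k y) <= e.
Proof.
move=> y0 e e0; pose E := expR (- (2 * pi * (- k)%:~R * y)).
have E0 : 0 < 2 * E by rewrite mulr_gt0// expR_gt0.
have [N HN] := biseries_uniform 1 y0 (divr_gt0 e0 E0).
exists N => n Nn; rewrite lip_int_unfold// /lip_coef -cintB; last 2 first.
- apply: ccontM; last exact: echar_hor_ccont.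
  by apply: ccont_sum => j; exact: biterm_ccont.
- by apply: ccontM; [exact: biseries_ccont|exact: echar_hor_ccont].
apply: le_trans (cint_bound (M := e / (2 * E) * E) _ ler01 _) _.
- apply: ccontB; apply: ccontM; try exact: echar_hor_ccont; last exact: biseries_ccont.
  by apply: ccont_sum => j; exact: biterm_ccont.
- move=> x /andP[x0 x1]; rewrite -mulrBl nmM nm_echar /=; apply: ler_wpM2r; first exact: expR_ge0.
  by apply: HN => //=; rewrite ger0_norm.
by rewrite subr0 mulr1 le_eqVlt; apply/orP; left; apply/eqP; field; rewrite gt_eqF// expR_gt0.
Qed.

(** Transfers a relation between truncated integrals, up to a vanishing error, to the coefficients.
    The factor m in the truncation is there for substitutions that stretch the interval. *)
Lemma lip_coef_eq k y k' y' (c : R[i]^o) (m : nat) : 0 < y -> 0 < y' -> (0 < m)%N ->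
  (forall e : R, 0 < e -> exists N, forall n, (N <= n)%N ->
     nm (lip_int k y (m * n) - c * lip_int k' y' n) <= e) ->
  lip_coef k y = c * lip_coef k' y'.
Proof.
move=> y0 y'0 m0 H; apply/eqP; rewrite -subr_eq0 -nm_eq0; apply/eqP/le_anti.
rewrite nm_ge0 andbT; apply/ler_addgt0Pr => e e0; rewrite add0r.
have e3 : 0 < e / 3 by rewrite divr_gt0.
have c1 : 0 < nm c + 1 by rewrite ltr_wpDl ?nm_ge0.
have [N1 H1] := H _ e3; have [N2 H2] := lip_int_cvg k y0 e3.
have [N3 H3] := lip_int_cvg k' y'0 (divr_gt0 e3 c1).
pose n := maxn N1 (maxn N2 N3).
have {}H1 := H1 n (leq_maxl _ _).
have {}H2 : nm (lip_int k y (m * n) - lip_coef k y) <= e / 3.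
  apply: H2; apply: leq_trans (leq_pmull _ m0).
  by rewrite /n !leq_max leqnn orbT.
have {}H3 : nm (lip_int k' y' n - lip_coef k' y') <= e / 3 / (nm c + 1).
  by apply: H3; rewrite /n !leq_max leqnn !orbT.
have -> : lip_coef k y - c * lip_coef k' y' = (lip_int k y (m * n) - c * lip_int k' y' n) -
  (lip_int k y (m * n) - lip_coef k y) + c * (lip_int k' y' n - lip_coef k' y') by ring.
apply: le_trans (ler_nmD _ _) _; apply: le_trans (lerD (ler_nmB _ _) (lexx _)) _.
have H4 : nm (c * (lip_int k' y' n - lip_coef k' y')) <= e / 3.
  rewrite nmM; apply: le_trans (ler_wpM2l (nm_ge0 c) H3) _.
  by rewrite mulrCA ler_piMr ?(ltW e3)// ler_pdivrMr// mul1r lerDl.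
apply: le_trans (lerD (lerD H1 H2) H4) _.
by rewrite le_eqVlt; apply/orP; left; apply/eqP; field.
Qed.

End LipschitzCoefficients.

(** * Lipschitz's formula *)

Section LipschitzFormula.
Context {R : realType}.
Variable s : R[i]^o.
Hypothesis s1 : 1 < complex.Re s.
Implicit Types (x y : R) (k : int).
Let s0 : 0 <= complex.Re s. Proof. exact: ltW (lt_trans ltr01 s1). Qed.

(** For the vertical sides of Cauchy's rectangle, whose length is fixed, and for the boundary terms
    of the integration by parts; decay of order 1 / n is enough for both. *)
Lemma nm_lip_kernel_bound k (n : nat) x y Y : (0 < n)%N -> `|x| = n%:R -> 0 < y -> y <= Y ->
  nm (lip_kernel s k (x +i* y)) <=
  expR (pi * `|complex.Im s|) * expR (2 * pi * `|k%:~R| * Y) / n%:R.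
Proof.
move=> n0 xn y0 yY.
have I0 : 0 < complex.Im (x +i* y : R[i]^o) by [].
rewrite /lip_kernel nmM nm_echar.
have nx : n%:R <= nm (x +i* y : R[i]^o) by have := Re_le_nm (x +i* y); rewrite /= xn.
have n1 : 1 <= n%:R :> R by rewrite ler1n.
have nR : 0 < n%:R :> R by rewrite ltr0n.
have h1 : nm (cpowN (x +i* y) s) <= expR (pi * `|complex.Im s|) / n%:R.
  apply: le_trans (nm_cpowN_le _ (ltW I0) (Im_gt0_neq0 I0)) _.
  rewrite ler_wpM2l ?expR_ge0//; apply: le_trans (powRN_le nR nx s0) _.
  rewrite -powR_inv1 ?(ltW nR)//; apply: ler_powR => //.
  by rewrite lerN2 ltW.
have h2 : expR (- (2 * pi * (- k)%:~R * y)) <= expR (2 * pi * `|k%:~R| * Y).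
  rewrite ler_expR mulrNz mulrN mulNr opprK -!mulrA.
  rewrite ler_wpM2l// ler_wpM2l ?pi_ge0//.
  apply: le_trans (ler_norm _) _; rewrite normrM (gtr0_norm y0).
  by rewrite ler_wpM2l.
by rewrite [leRHS]mulrAC; apply: (ler_pM _ _ h1 h2); rewrite ?nm_ge0 ?expR_ge0.
Qed.

(** Cauchy's theorem on [-n, n] x [y1, y2], with n -> oo. *)
Lemma lip_coef_height k y1 y2 : 0 < y1 -> y1 <= y2 ->
  lip_coef s k y1 = lip_coef s k y2.
Proof.
move=> y10 y12; have y20 : 0 < y2 by exact: lt_le_trans y12.
rewrite -[RHS]mul1r; apply: (lip_coef_eq s1 (m := 1)) => // e e0.
pose C := expR (pi * `|complex.Im s|) * expR (2 * pi * `|k%:~R| * y2).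
have C0 : 0 < C by rewrite mulr_gt0 ?expR_gt0.
pose D := 4 * C * (y2 - y1 + 1).
have y210 : 0 < y2 - y1 + 1 by lra.
have D0 : 0 < D by rewrite /D mulr_gt0// mulr_gt0.
exists (Num.truncn (D / e)).+1 => n Nn; rewrite mul1n mul1r.
have nR : D / e < n%:R.
  by apply: lt_le_trans (truncnS_gt _) _; rewrite ler_nat.
have n0 : (0 < n)%N by exact: leq_trans Nn.
have n0R : 0 < n%:R :> R by rewrite ltr0n.
pose g' (w : R[i]^o) := cpowN w s * (two_pi_i * (- k)%:~R * echar (- k) w) +
   echar (- k) w * (- s * cpowN w (s + 1)).
have dg x y : y1 <= y <= y2 -> cderiv (lip_kernel s k) (x +i* y) (g' (x +i* y)).
  move=> /andP[h1 _]; apply: cderivM; last exact: echar_cderiv.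
  by apply: cpowN_cderiv; exact: lt_le_trans h1.
apply: le_trans (cauchy_strip (B := 2 * (C / n%:R)) y12 dg _ _) _.
- by rewrite ge0_cp ?ltW// lerNl oppr0 ltW.
- move=> y /andP[h1 h2]; apply: le_trans (ler_nmB _ _) _.
  rewrite mulr_natl mulr2n; apply: lerD;
    apply: nm_lip_kernel_bound => //; rewrite ?normrN ?ger0_norm ?(ltW n0R)//;
    exact: lt_le_trans h1.
have h : D <= e * n%:R by rewrite mulrC ltW// -ltr_pdivrMr.
have -> : 2 * (2 * (C / n%:R)) * (y2 - y1) = 4 * C * (y2 - y1) / n%:R by field; rewrite gt_eqF.
rewrite ler_pdivrMr//; apply: le_trans h; rewrite /D.
by apply: ler_wpM2l; [rewrite mulr_ge0// ltW|rewrite lerDl].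
Qed.

Lemma lip_coef_indep k y1 y2 : 0 < y1 -> 0 < y2 -> lip_coef s k y1 = lip_coef s k y2.
Proof.
move=> y10 y20; have [h|h] := leP y1 y2; first exact: lip_coef_height.
by apply/esym/lip_coef_height => //; exact: ltW.
Qed.

(* The substitution w = m.+1 w'. *)
Lemma lip_coef_scale k y (m : nat) : 0 < y ->
  lip_coef s k (m.+1%:R * y) = spow m (1 - s) * lip_coef s (k * m.+1) y.
Proof.
move=> y0; have m0 : 0 < m.+1%:R :> R by rewrite ltr0n.
have my0 : 0 < m.+1%:R * y by rewrite mulr_gt0.
apply: (lip_coef_eq s1 (m := m.+1)) => // e e0; exists 0%N => n _.
suff -> : lip_int s k (m.+1%:R * y) (m.+1 * n) = spow m (1 - s) * lip_int s (k * m.+1) y n.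
  by rewrite subrr nm0 ltW.
rewrite /lip_int -cintZ; last exact: lip_kernel_ccont.
have := cint_affine (- n%:R) n%:R m.+1%:R 0 (@lip_kernel_ccont R s k (m.+1%:R * y) my0).
rewrite !addr0 mulrN -natrM => <-; apply: eq_cint => x; rewrite addr0.
have -> : (m.+1%:R * x) +i* (m.+1%:R * y) = (m.+1%:R)%:Co * (x +i* y) :> R[i]^o.
  by apply: complexP; rewrite ?cReM ?cImM /= ?mul0r ?subr0 ?addr0.
rewrite /lip_kernel cpowN_real_mul//; last exact: Im_gt0_neq0.
have -> : echar (- k) (m.+1%:R%:Co * (x +i* y)) = echar (- (k * m.+1)) (x +i* y).
  by rewrite /echar; congr cexp; rewrite -mulNr intrM rmorph_nat; ring.
have -> : spow m (1 - s) = (m.+1%:R)%:Co * cexp (- (s * (ln m.+1%:R)%:Co)).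
  by rewrite /spow mulrDl cexpD mul1r cexp_real lnK ?posrE// mulNr.
by ring.
Qed.

(** The line is pushed upwards: the bilateral series stays bounded for Im w >= 1 and 0 <= Re w <= 1,
    while the character has modulus exp (2 pi k Im w) with k < 0. *)
Lemma lip_coef_neg k y : k < 0 -> 0 < y -> lip_coef s k y = 0.
Proof.
move=> k0 y0; apply/eqP; rewrite -nm_eq0; apply/eqP/le_anti; rewrite nm_ge0 andbT.
have [M HM] := biseries_bound s1 1 (@ltr01 R).
have M0 : 0 <= M by apply: le_trans (nm_ge0 _) (HM (0 +i* 1) _ _); rewrite //= normr0.
apply/ler_addgt0Pr => e e0; rewrite add0r.
have pi2 : 0 < 2 * pi :> R by rewrite mulr_gt0// pi_gt0.
have M1 : 0 < 2 * (M + 1) by lra.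
have [N HN] := expR_neg_lt pi2 (divr_gt0 e0 M1).
pose Y : R := N%:R + 1.
have Y1 : 1 <= Y by rewrite lerDr.
have Y0 : 0 < Y by lra.
rewrite (@lip_coef_indep k y Y)//.
have E : expR (- (2 * pi * (- k)%:~R * Y)) <= expR (- (N%:R * (2 * pi))).
  rewrite ler_expR lerN2 -mulrA mulrC ler_wpM2l ?(ltW pi2)//.
  have k1 : 1 <= (- k)%:~R :> R by rewrite ler1z; lia.
  apply: le_trans (_ : Y <= _); first by rewrite lerDl.
  by rewrite ler_peMl// ltW.
apply: le_trans (cint_bound (M := M * (e / (2 * (M + 1)))) _ ler01 _) _.
- by apply: ccontM; [exact: biseries_ccont|exact: echar_hor_ccont].
- move=> x /andP[x0 x1]; rewrite nmM nm_echar; apply: ler_pM; rewrite ?nm_ge0 ?expR_ge0//.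
    by apply: HM => //=; rewrite ger0_norm.
  by apply: le_trans E _; exact: ltW.
rewrite subr0 mulr1.
have -> : 2 * (M * (e / (2 * (M + 1)))) = e * (M / (M + 1)).
  by field; rewrite gt_eqF//; lra.
rewrite ler_piMr ?(ltW e0)// ler_pdivrMr; last lra.
by rewrite mul1r lerDl.
Qed.

Lemma nm_spow_lt1 (m : nat) (t : R[i]^o) : (0 < m)%N -> complex.Re t < 0 -> nm (spow m t) < 1.
Proof.
move=> m0 t0; have m1 : 1 < m.+1%:R :> R by rewrite ltr1n.
rewrite nm_spow /powR gt_eqF ?(lt_trans _ m1)// -[X in _ < X]expR0 ltr_expR.
by rewrite nmulr_rlt0//; exact: ln_gt0.
Qed.

(* By scaling, the coefficient equals itself times 2^(1 - s), of modulus < 1. *)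
Lemma lip_coef_0 y : 0 < y -> lip_coef s 0 y = 0.
Proof.
move=> y0; have := @lip_coef_scale 0 y 1 y0; rewrite mul0r.
rewrite (@lip_coef_indep 0 (2 * y) y)//; last by rewrite mulr_gt0.
have h : nm (spow 1 (1 - s)) < 1.
  by apply: nm_spow_lt1 => //; rewrite cReB /= subr_lt0.
move=> /(congr1 nm); rewrite nmM => E; apply/eqP; rewrite -nm_eq0; apply/eqP/le_anti.
rewrite nm_ge0 andbT; have := nm_ge0 (lip_coef s 0 y); move: E h.
by move: (nm _) (nm _) => a b; nra.
Qed.

Definition lip_const : R[i]^o := lip_coef s 1 1.

Lemma lip_coef_pos (m : nat) y : 0 < y -> lip_coef s m.+1 y = spow m (s - 1) * lip_const.
Proof.
move=> y0; have := @lip_coef_scale 1 y m y0; rewrite mul1r /lip_const.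
rewrite (@lip_coef_indep 1 1 (m.+1%:R * y))//; last by rewrite mulr_gt0.
move=> ->; rewrite mulrA -spowD.
have -> : s - 1 + (1 - s) = 0 by ring.
by rewrite spow0 mul1r.
Qed.

End LipschitzFormula.

Section QSeries.
Context {R : realType}.
Implicit Types (s z t : R[i]^o).

Definition qterm t z (i : nat) : R[i]^o := echar i.+1 z * spow i t.
Definition qseries t z : R[i]^o := summability.sum (qterm t z).

Lemma echar_decay z (i : nat) :
  nm (echar i.+1 z) <= 1 * expR (- (2 * pi * complex.Im z * i.+1%:R)).
Proof.
by rewrite nm_echar mul1r ler_expR lerN2 -!mulrA [complex.Im z * _]mulrC.
Qed.

Lemma two_pi_gt0 z : 0 < complex.Im z -> 0 < 2 * pi * complex.Im z.
Proof. by move=> z0; rewrite mulr_gt0// mulr_gt0// pi_gt0. Qed.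

Lemma qterm_summable t z : 0 < complex.Im z -> abs_summable (qterm t z).
Proof.
by move=> z0; apply: (decay_summable (two_pi_gt0 z0) (echar_decay z)).
Qed.

Lemma hsum_qseries t z : 0 < complex.Im z -> hsum (qterm t z) (qseries t z).
Proof.
move=> z0; have [L HL] := abs_summable_hsum (qterm_summable t z0).
by rewrite /qseries (hsum_summability HL).
Qed.

Lemma qseries_cderiv t z : 0 < complex.Im z -> exists e, cderiv (qseries ^~ z) t e.
Proof.
move=> z0; apply: (decay_cderiv (two_pi_gt0 z0) (echar_decay z)) => u.
exact: hsum_qseries.
Qed.

(** The modulus of a term does not depend on Re z, so one dominating series serves the whole
    line. *)
Lemma qseries_uniform t (y e : R) : 0 < y -> 0 < e -> exists N, forall n, (N <= n)%N ->
  forall x, nm (\sum_(0 <= i < n) qterm t (x +i* y) i - qseries t (x +i* y)) <= e.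
Proof.
move=> y0 e0.
have [A0 HA0] := dominated_hsum (qterm_summable t (y0 : 0 < complex.Im (0 +i* y))) e0.
have [N HN] := fsub_exhaust A0 (@nat_range_cover); exists N => n Nn x.
rewrite -sum_nat_range; apply: HA0 => [i||]; last exact: HN.
  rewrite /qterm; move: (spow i t) => u; rewrite (nmM (echar _ (x +i* y))) (nmM (echar _ (0 +i* y))).
  by rewrite !nm_echar lexx.
exact: hsum_qseries.
Qed.

Lemma qterm_ccont t (y : R) i : ccont (fun x => qterm t (x +i* y) i).
Proof. by apply: ccontM; [exact: echar_hor_ccont|exact: ccont_cst]. Qed.

Lemma qseries_ccont t (y : R) : 0 < y -> ccont (fun x => qseries t (x +i* y)).
Proof.
move=> y0; apply: ccont_uniform_limit => X e e0.
have [N HN] := qseries_uniform t y0 e0.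
exists (fun x => \sum_(0 <= i < N) qterm t (x +i* y) i); last by move=> x _; exact: HN.
by apply: ccont_sum => i; exact: qterm_ccont.
Qed.

Lemma cint_echar (k : int) (y : R) : cint (fun x => echar k (x +i* y)) 0 1 = (k == 0)%:R.
Proof.
have [->|k0] := eqVneq k 0.
  rewrite (eq_cint (g := fun=> 1)); last by move=> x; rewrite echar0.
  by rewrite cint_cst subr0 mulr1.
pose c : R[i]^o := two_pi_i * k%:~R.
have c0 : c != 0.
  rewrite mulf_neq0 ?intr_eq0// -nm_gt0 nmE /= expr0n add0r sqrtr_sqr normr_gt0.
  by rewrite mulf_neq0// gt_eqF// pi_gt0.
rewrite (@cint_FTC _ _ (fun x => c^-1 * echar k (x +i* y))).
  have -> : (1 +i* y) = (0 +i* y : R[i]^o) + 1 by apply: complexP; rewrite ?cReD ?cImD /= ?add0r ?addr0.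
  by rewrite echar_add1 subrr.
move=> x; have := rderivZ c^-1 (rderiv_horizontal (echar_cderiv k (x +i* y))).
by rewrite mulrA -/c mulVf// mul1r.
Qed.

Lemma qseries_coef t (k : int) (y : R) : 0 < y ->
  cint (fun x => qseries t (x +i* y) * echar (- k) (x +i* y)) 0 1 =
  if k is Posz i.+1 then spow i t else 0.
Proof.
move=> y0; set L := (if k is Posz i.+1 then _ else _).
have partial n : cint (fun x => (\sum_(0 <= i < n) qterm t (x +i* y) i) * echar (- k) (x +i* y)) 0 1 =
    \sum_(0 <= i < n) spow i t * (i.+1%:Z - k == 0)%:R.
  rewrite (eq_cint (g := fun x => \sum_(0 <= i < n) spow i t * echar (i.+1%:Z - k) (x +i* y))).
    rewrite cint_sum; last by move=> i; apply: ccontZ; exact: echar_hor_ccont.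
    by apply: eq_bigr => i _; rewrite cintZ ?cint_echar//; exact: echar_hor_ccont.
  move=> x; rewrite big_distrl /=; apply: eq_bigr => i _.
  by rewrite /qterm echarD; ring.
have lim n : (absz k <= n)%N -> \sum_(0 <= i < n) spow i t * (i.+1%:Z - k == 0)%:R = L.
  move=> kn; have zero j : j.+1%:Z != k -> spow j t * (j.+1%:Z - k == 0)%:R = 0.
    by rewrite subr_eq0 => /negbTE ->; rewrite mulr0.
  have one j : j.+1%:Z = k -> spow j t * (j.+1%:Z - k == 0)%:R = spow j t.
    by move=> ->; rewrite subrr eqxx mulr1.
  rewrite /L; move: zero one kn; clear; case: k => [[|i]|i] zero one kn.
  - by rewrite big1// => j _; apply: zero.
  - rewrite (big_cat_nat (n := i)) ?(ltnW kn)//= [X in _ + X]big_ltn// one//.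
    rewrite big_nat_cond big1 ?add0r; last first.
      by move=> j /andP[/andP[_ ji] _]; apply: zero; lia.
    rewrite big_nat_cond big1 ?addr0// => j /andP[/andP[ij _] _].
    by apply: zero; lia.
  - by rewrite big1// => j _; apply: zero.
apply/eqP; rewrite -subr_eq0 -nm_eq0; apply/eqP/le_anti; rewrite nm_ge0 andbT.
apply/ler_addgt0Pr => e e0; rewrite add0r.
pose E := expR (- (2 * pi * (- k)%:~R * y)).
have E0 : 0 < 2 * E by rewrite mulr_gt0// expR_gt0.
have [N HN] := qseries_uniform t y0 (divr_gt0 e0 E0).
have N1 := HN _ (leq_maxl N (absz k)).
rewrite -(lim _ (leq_maxr N (absz k))) -partial nmB -cintB; last 2 first.
- apply: ccontM; last exact: echar_hor_ccont.
  by apply: ccont_sum => j; exact: qterm_ccont.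
- by apply: ccontM; [exact: qseries_ccont|exact: echar_hor_ccont].
apply: le_trans (cint_bound (M := e / (2 * E) * E) _ ler01 _) _.
- apply: ccontB; apply: ccontM; try exact: echar_hor_ccont; last exact: qseries_ccont.
  by apply: ccont_sum => j; exact: qterm_ccont.
- move=> x /andP[x0 x1]; rewrite -mulrBl nmM nm_echar /=; apply: ler_wpM2r; first exact: expR_ge0.
  exact: N1.
by rewrite subr0 mulr1 le_eqVlt; apply/orP; left; apply/eqP; field; rewrite gt_eqF// expR_gt0.
Qed.

Lemma qseries_add1 t z : qseries t (z + 1) = qseries t z.
Proof.
by rewrite /qseries; congr summability.sum; apply/funext => i; rewrite /qterm echar_add1.
Qed.

(** On the horizontal line through z both sides are continuous, 1-periodic and have the same Fourier
    coefficients. *)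
Theorem lipschitz_formula s z : 1 < complex.Re s -> 0 < complex.Im z ->
  biseries s z = lip_const s * qseries (s - 1) z.
Proof.
move=> s1; case: z => x y /= y0.
pose D (x : R) := biseries s (x +i* y) - lip_const s * qseries (s - 1) (x +i* y).
suff : D x = 0 by rewrite /D => /eqP; rewrite subr_eq0 => /eqP.
have shift x' : (x' + 1) +i* y = (x' +i* y : R[i]^o) + 1.
  by apply: complexP; rewrite ?cReD ?cImD /= ?addr0.
have cb : ccont (fun x => biseries s (x +i* y)) by exact: biseries_ccont.
have cq : ccont (fun x => qseries (s - 1) (x +i* y)) by exact: qseries_ccont.
apply: fourier_unique.
- by apply: ccontB => //; exact: ccontZ.
- by move=> x'; rewrite /D shift biseries_add1// qseries_add1.
move=> k.
have ce := @echar_hor_ccont R k y.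
(* The character at the real point x is a constant times the character at x + i y; the double
   negation brings out [lip_coef s (- k) y]. *)
rewrite (eq_cint (g := fun x => echar k (- (0 +i* y)) *
   (biseries s (x +i* y) * echar (- - k) (x +i* y) -
    lip_const s * (qseries (s - 1) (x +i* y) * echar (- - k) (x +i* y))))); last first.
  move=> x'; have -> : x'%:Co = - (0 +i* y) + (x' +i* y) :> R[i]^o.
    by apply: complexP; rewrite ?cReD ?cImD ?cReN ?cImN /=; ring.
  by rewrite opprK echar_add /D; ring.
rewrite -(opprK k) in ce.
rewrite cintZ; last by apply: ccontB; [exact: ccontM|apply: ccontZ; exact: ccontM].
rewrite cintB; [|exact: ccontM|by apply: ccontZ; exact: ccontM].
rewrite cintZ; last exact: ccontM.
rewrite -/(lip_coef s (- k) y) qseries_coef//.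
case: (- k) => [[|m]|m].
- by rewrite lip_coef_0// mulr0 subrr mulr0.
- by rewrite lip_coef_pos// mulrC [lip_const s * _]mulrC subrr mul0r.
- by rewrite lip_coef_neg// mulr0 subrr mulr0.
Qed.

End QSeries.

(** * The Lipschitz constant *)

Section LipschitzConstant.
Context {R : realType}.
Implicit Types (s z t : R[i]^o).

Lemma nm_le_eps (w : R[i]^o) : (forall e : R, 0 < e -> nm w <= e) -> w = 0.
Proof.
move=> H; apply/eqP; rewrite -nm_eq0; apply/eqP/le_anti; rewrite nm_ge0 andbT.
by apply/ler_addgt0Pr => e e0; rewrite add0r H.
Qed.

Lemma two_pi_i_neq0 : two_pi_i != 0 :> R[i]^o.
Proof.
rewrite -nm_gt0 nmE /= expr0n add0r sqrtr_sqr normr_gt0.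
by rewrite mulf_neq0// gt_eqF// pi_gt0.
Qed.

(** The derivative of w^(- s) exp (- 2 pi i w) is integrated over [-N, N] + i, and its boundary
    values tend to 0. *)
Lemma lip_const_rec s : 1 < complex.Re s ->
  two_pi_i * lip_const s = - s * lip_const (s + 1).
Proof.
move=> s1; have s2 : 1 < complex.Re (s + 1) by rewrite cReD /=; lra.
apply/eqP; rewrite -subr_eq0; apply/eqP/nm_le_eps => e e0.
pose K := lip_kernel s 1; pose K1 := lip_kernel (s + 1) 1.
have id1 N : two_pi_i * lip_int s 1 1 N - (- s * lip_int (s + 1) 1 1 N) =
    - (K (N%:R +i* 1) - K (- N%:R +i* 1)).
  have d x : rderiv (fun x => K (x +i* 1)) x (- (two_pi_i * K (x +i* 1)) + - s * K1 (x +i* 1)).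
    apply: rderiv_horizontal; apply: cderiv_eq.
      by apply: cderivM; [exact: cpowN_cderiv|exact: echar_cderiv].
    by rewrite /K /K1 /lip_kernel mulrN1z; ring.
  have c0 := @lip_kernel_ccont R s 1 1 ltr01.
  have c1 := @lip_kernel_ccont R (s + 1) 1 1 ltr01.
  rewrite -(cint_FTC _ _ d).
  rewrite (eq_cint (g := fun x => - two_pi_i * K (x +i* 1) + - s * K1 (x +i* 1))).
    rewrite cintD; [|exact: ccontZ|exact: ccontZ].
    by rewrite !cintZ// /lip_int -/K -/K1; ring.
  by move=> x; congr (_ + _); rewrite mulNr.
pose C := expR (pi * `|complex.Im s|) * expR (2 * pi * `|1%:~R| * 1) : R.
have e4 : 0 < e / 4 by rewrite divr_gt0.
have p0 : 0 < nm (two_pi_i : R[i]^o) + 1 by rewrite ltr_wpDl ?nm_ge0.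
have q0 : 0 < nm s + 1 by rewrite ltr_wpDl ?nm_ge0.
have [N1 H1] := lip_int_cvg s1 1 ltr01 (divr_gt0 e4 p0).
have [N2 H2] := lip_int_cvg s2 1 ltr01 (divr_gt0 e4 q0).
pose N3 := (Num.truncn (C / (e / 4))).+1.
pose n := maxn N3 (maxn N1 N2).
have n0 : (0 < n)%N by rewrite /n leq_max.
have nR : 0 < n%:R :> R by rewrite ltr0n.
have Cn : C / n%:R <= e / 4.
  rewrite ler_pdivrMr// mulrC -ler_pdivrMr//.
  apply: le_trans (ltW (truncnS_gt _)) _; rewrite ler_nat; exact: leq_maxl.
have k1 : nm (K (n%:R +i* 1)) <= e / 4.
  apply: le_trans Cn; apply: nm_lip_kernel_bound => //.
  by rewrite ger0_norm// ltW.
have k2 : nm (K (- n%:R +i* 1)) <= e / 4.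
  apply: le_trans Cn; apply: nm_lip_kernel_bound => //.
  by rewrite normrN ger0_norm// ltW.
have {}H1 := H1 n ltac:(by rewrite /n !leq_max leqnn !orbT).
have {}H2 := H2 n ltac:(by rewrite /n !leq_max leqnn !orbT).
have h1 : nm (two_pi_i * (lip_int s 1 1 n - lip_const s)) <= e / 4.
  rewrite nmM; apply: le_trans (ler_wpM2l (nm_ge0 _) H1) _.
  by rewrite mulrCA ler_piMr ?(ltW e4)// ler_pdivrMr// mul1r lerDl.
have h2 : nm (s * (lip_int (s + 1) 1 1 n - lip_const (s + 1))) <= e / 4.
  rewrite nmM; apply: le_trans (ler_wpM2l (nm_ge0 _) H2) _.
  by rewrite mulrCA ler_piMr ?(ltW e4)// ler_pdivrMr// mul1r lerDl.
have -> : two_pi_i * lip_const s - - s * lip_const (s + 1) =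
  (- (K (n%:R +i* 1) - K (- n%:R +i* 1))) -
  (two_pi_i * (lip_int s 1 1 n - lip_const s) +
   s * (lip_int (s + 1) 1 1 n - lip_const (s + 1))).
  by rewrite -id1; ring.
apply: le_trans (ler_nmB _ _) _; rewrite nmN.
apply: le_trans (lerD (ler_nmB _ _) (ler_nmD _ _)) _.
apply: le_trans (lerD (lerD k1 k2) (lerD h1 h2)) _.
by rewrite le_eqVlt; apply/orP; left; apply/eqP; field.
Qed.

Lemma hsum_point (I : choiceType) (i0 : I) (v : R[i]^o) :
  hsum (fun i => if i == i0 then v else 0) v.
Proof.
move=> e e0; exists [fset i0]%fset => A A0.
have iA : i0 \in A by apply: (fsubsetP A0); rewrite inE.
rewrite (bigD1_seq i0) //= eqxx big1 ?addr0 ?subrr ?nm0 ?ltW//.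
by move=> i /negbTE ->.
Qed.

Lemma hsum_natS (f : nat -> R[i]^o) L : hsum (fun i => f i.+1) L -> abs_summable f ->
  hsum f (f 0%N + L).
Proof.
move=> H sf; have [L' H'] := abs_summable_hsum sf.
have -> // : f 0%N + L = L'.
apply/eqP; rewrite -subr_eq0; apply/eqP/nm_le_eps => e e0.
have e2 : 0 < e / 2 by rewrite divr_gt0.
have [N HN] := hsum_nat H e2; have [N' HN'] := hsum_nat H' e2.
have h1 := HN (maxn N N') (leq_maxl _ _).
have h2 := HN' (maxn N N').+1 (leqW (leq_maxr _ _)).
rewrite big_nat_recl //= in h2.
set S := \sum_(0 <= i < _) f i.+1 in h1 h2.
have -> : f 0%N + L - L' = (f 0%N + S - L') - (S - L) by ring.
by apply: le_trans (ler_nmB _ _) _; rewrite (splitr e) lerD.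
Qed.

Lemma spow1 i : spow i (1 : R[i]^o) = i.+1%:R.
Proof. by rewrite -[1]/(1%:R) spow_nat expr1. Qed.

Lemma hsum_geometric (q : R[i]^o) : nm q < 1 -> hsum (fun i => q ^+ i) (1 - q)^-1.
Proof.
move=> q1; have sf : abs_summable (fun i => q ^+ i).
  apply: (abs_summable_nat (M := (1 - nm q)^-1)) => n.
  under eq_bigr do rewrite nmX; exact: geometric_bound (nm_ge0 _) q1.
have [L HL] := abs_summable_hsum sf.
have q0 : 1 - q != 0.
  by rewrite subr_eq0; apply: contraTneq q1 => <-; rewrite nm1 ltxx.
have H : hsum (fun i => q ^+ i.+1) (q * L).
  by apply: eq_hsum (hsumZ q HL) => i; rewrite exprS.
have := hsum_unique HL (hsum_natS H sf); rewrite expr0 => E.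
suff <- : L = (1 - q)^-1 by [].
by apply: (mulfI q0); rewrite mulfV// mulrBl mul1r {1}E addrK.
Qed.

(** Subtracting q times the series from the series leaves a geometric one. *)
Lemma qseries1 z : 0 < complex.Im z ->
  qseries 1 z = echar 1 z / (1 - echar 1 z) ^+ 2.
Proof.
move=> z0; set q := echar 1 z.
have q1 : nm q < 1.
  by rewrite /q nm_echar expR_lt1 oppr_lt0 mulr1 two_pi_gt0.
have q0 : 1 - q != 0.
  by rewrite subr_eq0; apply: contraTneq q1 => <-; rewrite nm1 ltxx.
have qE i : qterm 1 z i = i.+1%:R * q ^+ i.+1.
  by rewrite /qterm spow1 echar_nat mulrC.
have sf := qterm_summable 1 z0.
have H := hsum_qseries 1 z0.
have Hq : hsum (fun i => i%:R * q ^+ i.+1) (q * qseries 1 z).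
  have Hq' : hsum (fun i => (i.+1)%:R * q ^+ i.+2) (q * qseries 1 z).
    by apply: eq_hsum (hsumZ q H) => i; rewrite qE [q ^+ i.+2]exprS mulrCA.
  have -> : q * qseries 1 z = 0%:R * q ^+ 1 + q * qseries 1 z by rewrite mul0r add0r.
  apply: (hsum_natS (f := fun i => i%:R * q ^+ i.+1)) => //.
  apply: abs_summable_le sf => i; rewrite qE (nmM i%:R) (nmM i.+1%:R) !nm_nat.
  by rewrite ler_wpM2r ?nm_ge0// ler_nat.
have Hg : hsum (fun i => q ^+ i.+1) (q * (1 - q)^-1).
  by apply: eq_hsum (hsumZ q (hsum_geometric q1)) => i; rewrite exprS.
have E : qseries 1 z + -1 * (q * qseries 1 z) = q * (1 - q)^-1.
  apply: (hsum_unique (hsumD H (hsumZ (-1) Hq))); apply: eq_hsum Hg => i.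
  by rewrite qE -natr1; ring.
apply: (mulfI q0); have -> : (1 - q) * qseries 1 z = q * (1 - q)^-1 by rewrite -E; ring.
by field.
Qed.

(** The term n = 0 equals - y^(-2); the other terms have modulus at most n^(-2) <= 4 / (1 + |n|)^2,
    uniformly in y. *)
Lemma biseries2_near0 : exists M : R, forall y : R, 0 < y ->
  nm (biseries 2%:R (0 +i* y) + ((y ^+ 2)^-1)%:Co) <= M.
Proof.
have two1 : 1 < 2 :> R by rewrite ltr1n.
have [M HM] := bidom_summable 4 two1; exists M => y y0.
have z0 : 0 < complex.Im (0 +i* y : R[i]^o) by [].
have s2 : 1 < complex.Re (2%:R : R[i]^o) by rewrite Re_nat.
have H := hsum_biseries z0 s2.
pose v : R[i]^o := - ((y ^+ 2)^-1)%:Co.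
have v0 : biterm 2%:R (0 +i* y) 0 = v.
  rewrite /biterm addr0 cpowN_nat ?(ltW z0)//; last exact: Im_gt0_neq0.
  have -> : (0 +i* y : R[i]^o) ^+ 2 = - (y ^+ 2)%:Co.
    by rewrite expr2; apply: complexP; rewrite ?cReM ?cImM ?cReN ?cImN /=; ring.
  by rewrite invrN /v fmorphV.
have H' := hsumD H (hsumZ (-1) (hsum_point (0 : int) v)).
have -> : biseries 2%:R (0 +i* y) + ((y ^+ 2)^-1)%:Co = biseries 2%:R (0 +i* y) + -1 * v.
  by rewrite /v mulrNN mul1r.
apply: hsum_nm_le H' _ => A; apply: le_trans (HM A); apply: ler_sum => n _.
have [->|n0] := eqVneq n 0; first by rewrite v0 mulN1r subrr nm0 nm_ge0.
rewrite mulr0 addr0 /biterm cpowN_nat; last 2 first.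
- by rewrite Im_shift /= ltW.
- by apply: Im_gt0_neq0; rewrite Im_shift.
have n1 : 1 <= `|n|%:~R :> R by rewrite ler1z; lia.
rewrite nmV nmX nm_real ger0_norm; last by rewrite mulr_ge0 ?powR_ge0.
rewrite powR_invn ?addr_ge0 ?ler0z//.
have h : `|n|%:~R <= nm ((0 +i* y : R[i]^o) + n%:~R).
  by have := Re_le_nm ((0 +i* y : R[i]^o) + n%:~R); rewrite Re_shift /= add0r intr_norm.
have h0 : 0 < nm ((0 +i* y : R[i]^o) + n%:~R) by apply: lt_le_trans h; lra.
have n2 : 0 < 1 + `|n|%:~R :> R by lra.
rewrite ler_pdivlMr ?exprn_gt0//.
rewrite mulrC ler_pdivrMr ?exprn_gt0//.
have -> : 4 * nm ((0 +i* y : R[i]^o) + n%:~R) ^+ 2 = (2 * nm ((0 +i* y : R[i]^o) + n%:~R)) ^+ 2.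
  by ring.
by apply: lerXn2r; rewrite ?nnegrE ?mulr_ge0 ?(ltW h0)//; lra.
Qed.

(* Compare the two sides of Lipschitz's formula at u = i t / (2 pi) as t -> 0. *)
Lemma lip_const2 : lip_const 2%:R = two_pi_i ^+ 2 :> R[i]^o.
Proof.
have [M HM] := biseries2_near0; set A := lip_const 2%:R.
have s2 : 1 < complex.Re (2%:R : R[i]^o) by rewrite Re_nat ltr1n.
have pi0 := @pi_gt0 R; have pi2 : 0 < 2 * pi :> R by rewrite mulr_gt0.
have M0 : 0 <= M by apply: le_trans (nm_ge0 _) (HM 1 ltr01).
pose E := expR 1 : R; have E0 : 0 < E by exact: expR_gt0.
pose K := nm A + M + 2 * (2 * pi) ^+ 2 * E.
have K0 : 0 < K.
  by rewrite ltr_wpDl ?addr_ge0 ?nm_ge0// mulr_gt0// mulr_gt0// exprn_gt0.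
have main (t : R) : 0 < t -> t <= 1 -> nm (A - two_pi_i ^+ 2) <= t * K.
  move=> t0 t1; pose y := t / (2 * pi).
  have y0 : 0 < y by rewrite divr_gt0.
  pose q := expR (- t); pose d := 1 - q.
  have q1 : q < 1 by rewrite expR_lt1 oppr_lt0.
  have d0 : 0 < d by rewrite subr_gt0.
  have dt : d <= t by rewrite /d /q; have := expR_ge1Dx (- t); lra.
  have dt2 : `|d - t| <= t ^+ 2 * E.
    have := expR_sub1x_bound (- t); rewrite normrN (gtr0_norm t0) => h.
    have -> : d - t = - (expR (- t) - 1 - - t) by rewrite /d /q; ring.
    rewrite normrN; apply: le_trans h _; rewrite ler_wpM2l ?exprn_ge0 ?(ltW t0)//.
    by rewrite ler_expR.
  have qE : echar 1 (0 +i* y) = q%:Co.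
    rewrite /echar.
    have -> : two_pi_i * 1%:~R * (0 +i* y) = (- t)%:Co :> R[i]^o.
      rewrite mulr1; apply: complexP; rewrite ?cReM ?cImM /=; last by ring.
      by rewrite /y mul0r sub0r mulrC divfK// gt_eqF.
    exact: cexp_real.
  have z0 : 0 < complex.Im (0 +i* y : R[i]^o) by [].
  have L := lipschitz_formula s2 z0.
  have e1 : 2%:R - 1 = 1 :> R[i]^o by ring.
  rewrite e1 qseries1// qE -/A in L.
  set rho := biseries 2%:R (0 +i* y) + ((y ^+ 2)^-1)%:Co.
  have rhoM : nm rho <= M by exact: HM.
  have dC0 : d%:Co != 0 by rewrite -nm_gt0 nm_real gtr0_norm.
  have y2 : (y ^+ 2)%:Co != 0 by rewrite -nm_gt0 nm_real gtr0_norm ?exprn_gt0.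
  have AE : A * q%:Co = d%:Co ^+ 2 * (rho - ((y ^+ 2)^-1)%:Co).
    rewrite /rho addrK L; have -> : d%:Co = 1 - q%:Co by rewrite /d rmorphB.
    field; rewrite -[1]/(1%:Co) -rmorphB; exact: dC0.
  have tpi : two_pi_i ^+ 2 = - ((2 * pi) ^+ 2)%:Co :> R[i]^o.
    by rewrite expr2; apply: complexP; rewrite ?cReM ?cImM ?cReN ?cImN /=; ring.
  have r3 : ((2 * pi) ^+ 2 - (d / y) ^+ 2)%:Co =
      ((2 * pi) ^+ 2)%:Co - d%:Co ^+ 2 * ((y ^+ 2)^-1)%:Co.
    rewrite rmorphB; congr (_ - _); rewrite expr_div_n.
    by rewrite -[X in _ = X * _]rmorphXn -rmorphM.
  (* Each of the three summands is O(t): 0 < d <= t, and d / y differs from 2 pi by O(t). *)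
  have -> : A - two_pi_i ^+ 2 = A * d%:Co + (d%:Co ^+ 2 * rho + ((2 * pi) ^+ 2 - (d / y) ^+ 2)%:Co).
    have AS : A = A * q%:Co + A * d%:Co by rewrite /d rmorphB; ring.
    by rewrite [in LHS]AS AE tpi r3; ring.
  have b1 : nm (A * d%:Co) <= t * nm A.
    by rewrite nmM nm_real gtr0_norm// mulrC ler_wpM2r ?nm_ge0.
  have b2 : nm (d%:Co ^+ 2 * rho) <= t * M.
    rewrite nmM nmX nm_real gtr0_norm//; apply: ler_pM; rewrite ?nm_ge0 ?exprn_ge0 ?(ltW d0)//.
    rewrite expr2; apply: le_trans (_ : t * 1 <= _); last by rewrite mulr1.
    by apply: ler_pM; rewrite ?(ltW d0)//; exact: le_trans dt t1.
  have dy : d / y = 2 * pi * (d / t) by rewrite /y invf_div mulrCA.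
  have b3 : nm (((2 * pi) ^+ 2 - (d / y) ^+ 2)%:Co : R[i]^o) <= t * (2 * (2 * pi) ^+ 2 * E).
    rewrite nm_real dy.
    have -> : (2 * pi) ^+ 2 - (2 * pi * (d / t)) ^+ 2 =
      (2 * pi) ^+ 2 * (1 + d / t) * ((t - d) / t) by field; rewrite gt_eqF.
    have r1 : d / t <= 1 by rewrite ler_pdivrMr// mul1r.
    have r0 : 0 <= d / t by rewrite divr_ge0// ltW.
    have p2 : 0 < (2 * pi) ^+ 2 :> R by rewrite exprn_gt0.
    rewrite normrM ger0_norm; last by rewrite mulr_ge0 ?(ltW p2)//; lra.
    have -> : t * (2 * (2 * pi) ^+ 2 * E) = (2 * pi) ^+ 2 * 2 * (t * E) by ring.
    apply: ler_pM => //; first by rewrite mulr_ge0 ?(ltW p2)//; lra.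
      by rewrite ler_wpM2l ?(ltW p2)//; lra.
    rewrite normrM normfV (gtr0_norm t0) ler_pdivrMr// distrC.
    by have -> : t * E * t = t ^+ 2 * E by ring.
  have -> : t * K = t * nm A + (t * M + t * (2 * (2 * pi) ^+ 2 * E)) by rewrite /K; ring.
  apply: le_trans (ler_nmD _ _) _; apply: lerD => //.
  by apply: le_trans (ler_nmD _ _) _; exact: lerD.
apply/eqP; rewrite -subr_eq0; apply/eqP/nm_le_eps => e e0.
pose t : R := Num.min 1 (e / K).
have t0 : 0 < t by rewrite lt_min ltr01 divr_gt0.
apply: le_trans (main t t0 _) _; first by rewrite ge_min lexx.
by rewrite -ler_pdivlMr// ge_min lexx orbT.
Qed.

End LipschitzConstant.

(** * Continuation of the Lipschitz constant *)

Section EntireExtension.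
Context {R : realType}.
Implicit Types (s z t : R[i]^o).

Lemma cderivV (f : R[i]^o -> R[i]^o) s d : f s != 0 -> cderiv f s d ->
  exists e, cderiv (fun w => (f w)^-1) s e.
Proof.
move=> f0 /cderivP[df _].
have /derivableP H := derivableV f0 df.
by exists ('D_1 (fun w => (f w)^-1) s); apply/cderivP.
Qed.

(** High in the half plane the first term exp (2 pi i z) outweighs the rest of the series. *)
Lemma qseries_neq0 t : exists2 y : R, 0 < y & qseries t (0 +i* y) != 0.
Proof.
have pi2 : 0 < 2 * pi :> R by rewrite mulr_gt0// pi_gt0.
pose p := complex.Re t.
have [M0 HM0] := @exp_series_bound R p (2 * pi) pi2.
pose M := Num.max M0 1.
have M1 : 1 <= M by rewrite le_max lexx orbT.
have M2 : 0 < M by lra.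
have HM n : \sum_(0 <= i < n) (i.+1%:R `^ p * expR (- (2 * pi * i.+1%:R))) <= M.
  by rewrite le_max HM0.
have k0 : 0 < (M * expR (2 * pi))^-1 by rewrite invr_gt0 mulr_gt0 ?expR_gt0.
have [N HN] := expR_neg_lt pi2 k0.
(* So y - 1 = N, and exp (- 2 pi N) M exp (2 pi) < 1, where M bounds the series of moduli at height
   1. *)
pose y : R := N%:R + 1.
have y1 : 1 <= y by rewrite lerDr.
have y0 : 0 < y by lra.
exists y => //.
have z0 : 0 < complex.Im (0 +i* y : R[i]^o) by [].
pose q := echar 1 (0 +i* y : R[i]^o).
have nq : nm q = expR (- (2 * pi * y)) by rewrite nm_echar mulr1.
have H := hsumD (hsum_qseries t z0) (hsumZ (-1) (hsum_point 0%N q)).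
have bnd : nm (qseries t (0 +i* y) + -1 * q) < nm q.
  pose c := expR (- (2 * pi * y)) * expR (- (2 * pi * (y - 1))) * expR (2 * pi).
  have cM : c * M < nm q.
    have h : expR (- (2 * pi * (y - 1))) * (M * expR (2 * pi)) < 1.
      have Me : 0 < M * expR (2 * pi) by rewrite mulr_gt0 ?expR_gt0.
      by rewrite -ltr_pdivlMr// div1r /y addrK mulrC.
    have -> : c * M = nm q * (expR (- (2 * pi * (y - 1))) * (M * expR (2 * pi))).
      by rewrite nq /c; ring.
    by rewrite gtr_pMr// nq expR_gt0.
  apply: le_lt_trans cM; apply: hsum_nm_le H _ => A.
  have [n Hn'] := fsub_exhaust A (@nat_range_cover); have Hn := Hn' n (leqnn n).
  apply: le_trans (sum_fset_le _ Hn) _ => [i|]; first exact: nm_ge0.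
  rewrite sum_nat_range; apply: le_trans (ler_wpM2l _ (HM n)); last first.
    by rewrite !mulr_ge0 ?expR_ge0.
  rewrite mulr_sumr; apply: ler_sum => i _.
  case: i => [|i].
    rewrite eqxx /qterm /spow ln1 mulr0 cexp0 mulr1 -/q mulN1r subrr nm0.
    by rewrite !mulr_ge0 ?expR_ge0 ?powR_ge0.
  rewrite mulr0 addr0 /qterm nmM nm_spow nm_echar /= -/p.
  rewrite [leRHS]mulrCA mulrC ler_wpM2l ?powR_ge0// /c -!expRD ler_expR.
  have i0 : 0 <= i%:R :> R by [].
  have -> : (i.+2%:Z)%:~R = i%:R + 2 :> R by rewrite -[LHS]/(i.+2%:R) -!natr1; ring.
  have -> : i.+2%:R = i%:R + 2 :> R by rewrite -!natr1; ring.
  rewrite -subr_ge0.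
  have -> : - (2 * pi * y) + - (2 * pi * (y - 1)) + 2 * pi + - (2 * pi * (i%:R + 2)) -
    - (2 * pi * (i%:R + 2) * y) = 2 * pi * (i%:R * (y - 1)) by ring.
  by rewrite mulr_ge0 ?(ltW pi2)// mulr_ge0//; lra.
apply: contraTneq bnd => ->.
by rewrite add0r mulN1r nmN ltxx.
Qed.

(** At one fixed point i y, Lipschitz's formula gives the constant as a quotient of two functions
    holomorphic in s, whose denominator stays nonzero near s by continuity. *)
Lemma lip_const_cderiv s : 1 < complex.Re s -> exists d, cderiv (@lip_const R) s d.
Proof.
move=> s1; have [y y0 Q0] := qseries_neq0 (s - 1).
have z0 : 0 < complex.Im (0 +i* y : R[i]^o) by [].
have [dF HF] := biseries_cderiv z0 s1.
pose Q w := qseries (w - 1) (0 +i* y).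
have [dQ0 HQ0] := qseries_cderiv (s - 1) z0.
have HQ : cderiv Q s (dQ0 * 1).
  apply: (@cderiv_comp R (qseries ^~ (0 +i* y)) (fun w => w - 1)) => //.
  have := cderivB (cderiv_id s) (cderiv_cst 1 s); by rewrite subr0.
have [dV HV] := @cderivV Q s _ Q0 HQ.
have e0 : 0 < nm (Q s) / 2 by rewrite divr_gt0// nm_gt0.
have [D D0 HD] := cderiv_cont HQ e0.
have D1 : 0 < Num.min D (complex.Re s - 1) by rewrite lt_min D0 subr_gt0.
eexists; apply: (cderiv_near D1 _ (cderivM HF HV)) => h.
rewrite lt_min => /andP[hD h1].
have sh : 1 < complex.Re (s + h).
  by rewrite cReD; have := Re_le_nm h; rewrite ler_norml => /andP[? _]; lra.
rewrite (lipschitz_formula sh z0) -/(Q (s + h)) mulfK//.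
have := HD h hD; apply: contraTneq => ->.
rewrite sub0r nmN -ltNge ltr_pdivrMr// mulr_natr mulr2n ltrDl nm_gt0//.
Qed.

(* [m] steps of [lip_const_rec] reach the half plane 1 < Re s + m. *)
Definition lip_ext (m : nat) s : R[i]^o :=
  (\prod_(j < m) (- (s + j%:R) / two_pi_i)) * lip_const (s + m%:R).

Lemma lip_extS m s : 1 < complex.Re s + m%:R -> lip_ext m.+1 s = lip_ext m s.
Proof.
move=> sm; have := lip_const_rec (s := s + m%:R); rewrite cReD Re_nat => /(_ sm) E.
rewrite /lip_ext big_ord_recr /= -mulrA; congr (_ * _).
apply: (mulfI two_pi_i_neq0); rewrite E -natr1 addrA.
by field; exact: two_pi_i_neq0.
Qed.

Lemma lip_ext_eq m n s : 1 < complex.Re s + m%:R -> (m <= n)%N -> lip_ext n s = lip_ext m s.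
Proof.
move=> sm /subnK <-; elim: (n - m)%N => [|k IH] //.
rewrite addSn lip_extS//; apply: lt_le_trans sm _.
by rewrite lerD2l ler_nat leq_addl.
Qed.

(** This number of steps ensures Re s + m > 1. By [lip_ext_eq] a different sufficient number gives
    the same value, so one m serves a whole neighbourhood. *)
Definition lip_entire s : R[i]^o := lip_ext (Num.truncn `|complex.Re s|).+2 s.

Lemma lip_entireE m s : 1 < complex.Re s + m%:R -> lip_entire s = lip_ext m s.
Proof.
move=> sm; have sN : 1 < complex.Re s + (Num.truncn `|complex.Re s|).+2%:R.
  have := truncnS_gt `|complex.Re s|; have := ler_norm (- complex.Re s).
  rewrite normrN => h1 h2; rewrite -natr1; lra.
by rewrite /lip_entire; have [h|/ltnW h] := leqP m (Num.truncn `|complex.Re s|).+2;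
  [|apply/esym]; exact: lip_ext_eq.
Qed.

Lemma lip_entire_const s : 1 < complex.Re s -> lip_entire s = lip_const s.
Proof.
by move=> s1; rewrite (@lip_entireE 0) ?addr0// /lip_ext big_ord0 mul1r addr0.
Qed.

Lemma lip_ext_prod_cderiv m s : exists d, cderiv (fun s => \prod_(j < m) (- (s + j%:R) / two_pi_i)) s d.
Proof.
elim: m => [|m [d Hd]].
  by exists 0; apply: cderiv_ext (cderiv_cst 1 s) => w; rewrite big_ord0.
eexists; apply: cderiv_ext (cderivM Hd (cderiv_affine (- two_pi_i^-1) (- m%:R / two_pi_i) s)) => w.
by rewrite big_ord_recr /=; congr (_ * _); ring.
Qed.

Lemma lip_const_shift_cderiv m s : 1 < complex.Re s + m%:R ->
  exists d, cderiv (fun s => lip_const (s + m%:R)) s d.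
Proof.
move=> sm; have [d Hd] := @lip_const_cderiv (s + m%:R) ltac:(by rewrite cReD Re_nat).
exists (d * 1); apply: (@cderiv_comp R (@lip_const R) (fun s => s + m%:R)) => //.
by have := cderivD (cderiv_id s) (cderiv_cst m%:R s); rewrite addr0.
Qed.

Lemma lip_entire_near m s : 1 < complex.Re s + m%:R -> exists2 D : R, 0 < D &
  forall h, nm h < D -> lip_ext m (s + h) = lip_entire (s + h).
Proof.
move=> sm; exists (complex.Re s + m%:R - 1); first by rewrite subr_gt0.
move=> h hD; apply/esym/lip_entireE; rewrite cReD.
by have := Re_le_nm h; rewrite ler_norml => /andP[? _]; lra.
Qed.

Lemma lip_entire_cderiv s : exists d, cderiv lip_entire s d.
Proof.
pose m := (Num.truncn `|complex.Re s|).+2.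
have sm : 1 < complex.Re s + m%:R.
  have := truncnS_gt `|complex.Re s|; have := ler_norm (- complex.Re s).
  rewrite normrN /m => h1 h2; rewrite -natr1; lra.
have [D D0 HD] := lip_entire_near sm.
have [d1 H1] := lip_ext_prod_cderiv m s; have [d2 H2] := lip_const_shift_cderiv sm.
by eexists; exact: (cderiv_near D0 HD (cderivM H1 H2)).
Qed.

Lemma prod_descending (n : nat) : \prod_(j < n) (- (- n%:R + j%:R) / two_pi_i) =
  n`!%:R / two_pi_i ^+ n :> R[i]^o.
Proof.
elim: n => [|n IH]; first by rewrite big_ord0 fact0 expr0 divr1.
rewrite big_ord_recl /= addr0 opprK.
rewrite (eq_bigr (fun j : 'I_n => - (- n%:R + j%:R) / two_pi_i)); last first.
  by move=> j _; rewrite /bump leq0n add1n -(natr1 n) -(natr1 j); congr (_ / _); ring.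
by rewrite IH factS natrM exprS invfM; ring.
Qed.

(** Already n + 2 steps are enough at - n, and the factor j = n vanishes there. *)
Lemma lip_entire_zero (n : nat) : lip_entire (- n%:R) = 0.
Proof.
rewrite (@lip_entireE n.+2); last by rewrite cReN Re_nat -!natr1; lra.
rewrite /lip_ext big_ord_recr big_ord_recr /= addNr oppr0 mul0r mulr0 !mul0r//.
Qed.

(* [lip_entire s = (s + n) g s] near [- n], so the derivative there is [g (- n)]. *)
Lemma lip_entire_derivative (n : nat) :
  cderiv lip_entire (- n%:R) (n`!%:R / two_pi_i ^+ n).
Proof.
have sm : 1 < complex.Re (- n%:R : R[i]^o) + n.+2%:R.
  by rewrite cReN Re_nat -!natr1; lra.
have [D D0 HD] := lip_entire_near sm.
have [d1 H1] := lip_ext_prod_cderiv n (- n%:R).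
have [d2 H2] := lip_const_shift_cderiv sm.
have A0 := @cderiv_affine R (- two_pi_i^-1) (- n%:R / two_pi_i) (- n%:R).
have A1 := @cderiv_affine R (- two_pi_i^-1) (- n.+1%:R / two_pi_i) (- n%:R).
have H := cderivM (cderivM (cderivM H1 A0) A1) H2.
apply: cderiv_eq.
  apply: (cderiv_near D0 HD); apply: cderiv_ext H => w /=.
  rewrite /lip_ext !big_ord_recr /=; congr (_ * _ * _ * _); ring.
rewrite prod_descending.
have -> : - n%:R + n.+2%:R = 2%:R :> R[i]^o by rewrite -!natr1; ring.
(* The derivative - 1 / (2 pi i) of the factor j = n and the value - 1 / (2 pi i) of the factor j =
   n + 1 cancel c(2) = (2 pi i)^2. *)
rewrite lip_const2 -natr1.
by field; rewrite expf_neq0 two_pi_i_neq0.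
Qed.

End EntireExtension.

(** * Summation over the lattice *)

Section MultipleSeries.
Context {R : realType} {r : nat}.
Implicit Types (s t : R[i]^o) (m : {ffun 'I_r -> nat}).

Definition scvg (u : nat -> R[i]^o) l := forall e : R, 0 < e ->
  exists N, forall n, (N <= n)%N -> nm (u n - l) <= e.

Lemma scvgM (u v : nat -> R[i]^o) a b : scvg u a -> scvg v b ->
  scvg (fun n => u n * v n) (a * b).
Proof.
move=> Hu Hv e e0.
have a1 : 0 < nm a + 1 by rewrite ltr_wpDl ?nm_ge0.
have b1 : 0 < nm b + 1 by rewrite ltr_wpDl ?nm_ge0.
have e2 : 0 < e / 2 by rewrite divr_gt0.
have [N1 H1] := Hu _ (divr_gt0 e2 b1).
have [N2 H2] := Hv (Num.min 1 (e / 2 / (nm a + 1))) ltac:(by rewrite lt_min ltr01 divr_gt0).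
exists (maxn N1 N2) => n; rewrite geq_max => /andP[/H1 h1 /H2 h2].
have h21 : nm (v n - b) <= 1 by apply: le_trans h2 _; rewrite ge_min lexx.
have h22 : nm (v n - b) <= e / 2 / (nm a + 1) by apply: le_trans h2 _; rewrite ge_min lexx orbT.
have vb : nm (v n) <= nm b + 1.
  have -> : v n = b + (v n - b) by ring.
  by apply: le_trans (ler_nmD _ _) _; rewrite lerD2l.
have -> : u n * v n - a * b = (u n - a) * v n + a * (v n - b) by ring.
apply: le_trans (ler_nmD _ _) _; rewrite !nmM (splitr e); apply: lerD.
  apply: le_trans (ler_pM (nm_ge0 _) (nm_ge0 _) h1 vb) _.
  by rewrite divfK// gt_eqF.
apply: le_trans (ler_wpM2l (nm_ge0 _) h22) _.
by rewrite mulrCA ler_piMr ?(ltW e2)// ler_pdivrMr// mul1r lerDl.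
Qed.

Lemma scvg_prod (I : Type) (l : seq I) (u : I -> nat -> R[i]^o) (a : I -> R[i]^o) :
  (forall i, scvg (u i) (a i)) ->
  scvg (fun n => \prod_(i <- l) u i n) (\prod_(i <- l) a i).
Proof.
move=> H; elim: l => [|i l IH].
  by move=> e e0; exists 0%N => n _; rewrite !big_nil subrr nm0 ltW.
move=> e e0; have [N HN] := scvgM (H i) IH e0.
by exists N => n /HN; rewrite !big_cons.
Qed.

(** Over boxes the partial sums are products of finite geometric sums, whose limit is known;
    absolute summability identifies it with the unordered sum. *)
Lemma hsum_geometric_prod (x : 'I_r -> R[i]^o) : (forall k, nm (x k) < 1) ->
  hsum (fun m => \prod_k x k ^+ m k) (\prod_k (1 - x k)^-1).
Proof.
move=> x1.
have bnd := @abs_summable_prod R r (fun k j => x k ^+ j) (fun k => (1 - nm (x k))^-1) _.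
have [|L HL] := @abs_summable_hsum R _ (fun m => \prod_k x k ^+ m k).
  exists (\prod_k (1 - nm (x k))^-1) => A; apply: bnd => k n.
  by under eq_bigr do rewrite nmX; exact: geometric_bound (nm_ge0 _) (x1 k).
have c1 : scvg (fun n => \prod_k \sum_(0 <= j < n) x k ^+ j) (\prod_k (1 - x k)^-1).
  by apply: scvg_prod => k e e0; have := hsum_nat (hsum_geometric (x1 k)) e0.
have -> // : \prod_k (1 - x k)^-1 = L.
apply/eqP; rewrite -subr_eq0; apply/eqP/nm_le_eps => e e0.
have e2 : 0 < e / 2 by rewrite divr_gt0.
have [N1 H1] := c1 _ e2; have [N2 H2] := hsum_exhaust (@box_cover r) HL e2.
have {}H1 := H1 (maxn N1 N2) (leq_maxl _ _).
have := H2 (maxn N1 N2) (leq_maxr _ _).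
rewrite (sum_box_prod (fun k j => x k ^+ j)) => {}H2.
set P := \prod_k \sum_(0 <= j < _) _ in H1 H2.
have -> : \prod_k (1 - x k)^-1 - L = (P - L) - (P - \prod_k (1 - x k)^-1) by ring.
by apply: le_trans (ler_nmB _ _) _; rewrite (splitr e) lerD.
Qed.

Variables (z : R[i]^o) (omega : 'I_r -> R[i]^o).
Hypothesis hz : 0 < complex.Im z.
Hypothesis homega : forall k, 0 < complex.Im (omega k).

Definition lattice_point m : R[i]^o := z + \sum_(k < r) (m k)%:R * omega k.

Lemma Im_lattice m : complex.Im (lattice_point m) =
  complex.Im z + \sum_(k < r) (m k)%:R * complex.Im (omega k).
Proof.
rewrite /lattice_point cImD Im_sum; congr (_ + _); apply: eq_bigr => k _.
by rewrite cImM Re_nat Im_nat mul0r addr0.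
Qed.

Lemma Re_lattice m : complex.Re (lattice_point m) =
  complex.Re z + \sum_(k < r) (m k)%:R * complex.Re (omega k).
Proof.
rewrite /lattice_point cReD Re_sum; congr (_ + _); apply: eq_bigr => k _.
by rewrite cReM Re_nat Im_nat mul0r subr0.
Qed.

Lemma Im_lattice_gt0 m : 0 < complex.Im (lattice_point m).
Proof.
rewrite Im_lattice ltr_wpDr//; apply: sumr_ge0 => k _.
by rewrite mulr_ge0// ltW.
Qed.

Lemma echar_lattice (j : int) m :
  echar j (lattice_point m) = echar j z * \prod_(k < r) echar j (omega k) ^+ m k.
Proof.
rewrite /lattice_point echar_add; congr (_ * _).
rewrite /echar mulr_sumr cexp_sum; apply: eq_bigr => k _.
by rewrite -cexpMn; congr cexp; ring.
Qed.

Lemma nm_echar_lt1 (i : nat) k : nm (echar i.+1 (omega k)) <= expR (- (2 * pi * complex.Im (omega k))).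
Proof.
rewrite nm_echar ler_expR lerN2 ler_wpM2r ?(ltW (homega k))//.
rewrite ler_peMr ?mulr_ge0 ?pi_ge0//.
by rewrite -[X in _ <= X]/(i.+1%:R) ler1n.
Qed.

Lemma expR_omega_lt1 k : expR (- (2 * pi * complex.Im (omega k))) < 1.
Proof. by rewrite expR_lt1 oppr_lt0 two_pi_gt0. Qed.

Definition mcoef (i : nat) : R[i]^o := echar i.+1 z / \prod_(k < r) (1 - echar i.+1 (omega k)).

Definition multiseries t : R[i]^o := summability.sum (fun i => mcoef i * spow i t).

(** Bounds the reciprocal denominators of all [mcoef i] at once, the modulus of exp (2 pi i n
    omega_k) being largest at n = 1. *)
Let Mom := \prod_(k < r) (1 - expR (- (2 * pi * complex.Im (omega k))))^-1.

Let Mom_ge0 : 0 <= Mom.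
Proof. by apply: prodr_ge0 => k _; rewrite invr_ge0 subr_ge0 ltW// expR_omega_lt1. Qed.

Lemma nm_one_sub_ge (w : R[i]^o) (e : R) : nm w <= e -> 1 - e <= nm (1 - w).
Proof.
by move=> we; have := ler_nm_sub 1 w; rewrite nm1; apply: le_trans; rewrite lerD2l lerN2.
Qed.

Lemma mcoef_decay i : nm (mcoef i) <= Mom * expR (- (2 * pi * complex.Im z * i.+1%:R)).
Proof.
rewrite /mcoef nmM mulrC nmV nm_prod; apply: ler_pM; rewrite ?nm_ge0 ?invr_ge0 ?prodr_ge0//.
- by move=> k _; exact: nm_ge0.
- rewrite /Mom -prodfV; apply: ler_prod => k _; rewrite invr_ge0 nm_ge0 /=.
  have h : 0 < 1 - expR (- (2 * pi * complex.Im (omega k))) by rewrite subr_gt0 expR_omega_lt1.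
  have h2 := nm_one_sub_ge (nm_echar_lt1 i k).
  by rewrite lef_pV2 ?posrE//; exact: lt_le_trans h2.
- by have := echar_decay z i; rewrite mul1r.
Qed.

Lemma hsum_multiseries t : hsum (fun i => mcoef i * spow i t) (multiseries t).
Proof.
have [L HL] := abs_summable_hsum (decay_summable (two_pi_gt0 hz) mcoef_decay t).
by rewrite /multiseries (hsum_summability HL).
Qed.

Lemma multiseries_cderiv t : exists d, cderiv multiseries t d.
Proof. exact: decay_cderiv (two_pi_gt0 hz) mcoef_decay _ hsum_multiseries t. Qed.

(** Fubini on the pairs (i, m): summing over m first gives products of geometric series, summing
    over i first gives [qseries] at the lattice points. *)
Lemma hsum_lattice_qseries t : hsum (fun m => qseries t (lattice_point m)) (multiseries t).
Proof.
pose f (p : nat * {ffun 'I_r -> nat}) := qterm t (lattice_point p.2) p.1.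
have fE i m : f (i, m) = spow i t * echar i.+1 z * \prod_(k < r) echar i.+1 (omega k) ^+ m k.
  by rewrite /f /qterm /= echar_lattice; ring.
have col i : hsum (fun m => f (i, m)) (mcoef i * spow i t).
  have H := @hsum_geometric_prod (fun k => echar i.+1 (omega k))
    (fun k => le_lt_trans (nm_echar_lt1 i k) (expR_omega_lt1 k)).
  have -> : mcoef i * spow i t = spow i t * echar i.+1 z * \prod_k (1 - echar i.+1 (omega k))^-1.
    by rewrite /mcoef prodfV; ring.
  by apply: eq_hsum (hsumZ _ H) => m; rewrite fE.
have [M HM] := decay_sum_bound (two_pi_gt0 hz) (echar_decay z) (complex.Re t).
have sf : abs_summable f.
  apply: (@abs_summable_pair _ _ _ f (fun i => i.+1%:R `^ complex.Re t * nm (echar i.+1 z) * Mom) (M * Mom)).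
    move=> i B.
    have h := @abs_summable_prod R r (fun k j => echar i.+1 (omega k) ^+ j)
      (fun k => (1 - expR (- (2 * pi * complex.Im (omega k))))^-1) _ B.
    under eq_bigr do rewrite fE (nmM (_ * _)) (nmM (spow _ _)) nm_spow.
    rewrite -mulr_sumr ler_wpM2l ?mulr_ge0 ?powR_ge0 ?nm_ge0//; apply: h => k n.
    under eq_bigr do rewrite nmX.
    have e1 := nm_echar_lt1 i k; have e2 := expR_omega_lt1 k.
    apply: le_trans (geometric_bound n (nm_ge0 _) (le_lt_trans e1 e2)) _.
    rewrite lef_pV2 ?posrE ?subr_gt0//; last exact: le_lt_trans e1 e2.
    by rewrite lerD2l lerN2.
  move=> A; have [n Hn'] := fsub_exhaust A (@nat_range_cover); have Hn := Hn' n (leqnn n).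
  apply: le_trans (sum_fset_le _ Hn) _ => [i|].
    by rewrite !mulr_ge0 ?powR_ge0 ?nm_ge0.
  by rewrite sum_nat_range -mulr_suml ler_wpM2r.
apply: (hsum_exchange sf col _ (hsum_multiseries t)) => m.
exact: hsum_qseries (Im_lattice_gt0 m).
Qed.

Lemma lattice_point_bound : exists2 K : R, 0 < K & forall (n : int) m,
  1 + \sum_(k < r) (m k)%:R + `|n%:~R| <= K * nm (lattice_point m + n%:~R).
Proof.
(* The reciprocal of the sum of reciprocals is positive and below every imaginary part, for r = 0
   too. *)
pose y := ((complex.Im z)^-1 + \sum_(k < r) (complex.Im (omega k))^-1)^-1.
have sum0 : 0 <= \sum_(k < r) (complex.Im (omega k))^-1.
  by apply: sumr_ge0 => k _; rewrite invr_ge0 ltW.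
have y0 : 0 < y by rewrite invr_gt0 ltr_pwDl// invr_gt0.
have yz : y <= complex.Im z.
  rewrite -[leRHS]invrK lef_pV2 ?posrE ?invr_gt0//; first by rewrite lerDl.
  by rewrite ltr_pwDl// invr_gt0.
have yo k : y <= complex.Im (omega k).
  rewrite -[leRHS]invrK lef_pV2 ?posrE ?invr_gt0//.
    rewrite (bigD1 k)//= addrCA lerDl addr_ge0 ?invr_ge0 ?(ltW hz)//.
    by apply: sumr_ge0 => j _; rewrite invr_ge0 ltW.
  by rewrite ltr_pwDl// invr_gt0.
pose X := `|complex.Re z| + \sum_(k < r) `|complex.Re (omega k)|.
have X0 : 0 <= X by rewrite addr_ge0// sumr_ge0.
exists (1 + (X + 1) / y); first by rewrite ltr_pwDl// divr_ge0 ?(ltW y0)//; lra.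
move=> n m; have S0 : 0 <= \sum_(k < r) (m k)%:R :> R by apply: sumr_ge0.
apply: lattice_lower_bound => //.
- rewrite Im_lattice mulrDr mulr1 mulr_sumr; apply: lerD => //.
  by apply: ler_sum => k _; rewrite mulrC ler_wpM2l.
- rewrite Re_lattice; apply: le_trans (ler_normD _ _) _.
  rewrite /X mulrDl; apply: lerD; first by rewrite ler_peMr// lerDl.
  apply: le_trans (ler_norm_sum _ _ _) _; rewrite mulr_suml; apply: ler_sum => k _.
  rewrite normrM normr_nat mulrC ler_wpM2l//.
  rewrite (bigD1 k)//= addrCA lerDl addr_ge0// sumr_ge0//.
- by rewrite addr_ge0.
Qed.

Lemma lattice_term_shift (n : int) m :
  z + n%:~R + \sum_(k < r) (m k)%:R * omega k = lattice_point m + n%:~R.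
Proof. by rewrite /lattice_point addrAC. Qed.

Lemma lattice_summable s : r.+1%:R < complex.Re s ->
  abs_summable (fun nm : int * {ffun 'I_r -> nat} =>
    cpowN (z + nm.1%:~R + \sum_(k < r) (nm.2 k)%:R * omega k) s).
Proof.
move=> sr; have r0 : 0 < r.+1%:R :> R by rewrite ltr0n.
pose sg := complex.Re s; have sg0 : 0 <= sg by rewrite /sg; lra.
(* The exponent - sg is shared among r + 1 factors with exponent - p each, one for n and one for
   every m_k; sg > r + 1 says precisely that p > 1. *)
pose p := sg / r.+1%:R; have p1 : 1 < p by rewrite ltr_pdivlMr// mul1r.
have [K K0 HK] := lattice_point_bound.
pose C := expR (pi * `|complex.Im s|) * K `^ sg.
have C0 : 0 <= C by rewrite mulr_ge0 ?expR_ge0 ?powR_ge0.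
have bnd (n : int) m : nm (cpowN (z + n%:~R + \sum_(k < r) (m k)%:R * omega k) s) <=
    C * (1 + `|n|%:~R) `^ (- p) * nm (\prod_(k < r) ((1 + (m k)%:R) `^ (- p))%:Co).
  rewrite lattice_term_shift; set w := lattice_point m + n%:~R.
  have I0 : 0 < complex.Im w by rewrite Im_shift Im_lattice_gt0.
  have := HK n m; set S := 1 + _ => Sw.
  have S1 : 1 <= S by rewrite lerDl sumr_ge0.
  have Sn0 : 0 < S + `|n%:~R| by have := normr_ge0 (n%:~R : R); lra.
  apply: le_trans (nm_cpowN_le _ (ltW I0) (Im_gt0_neq0 I0)) _.
  rewrite /C -!mulrA ler_wpM2l ?expR_ge0//.
  have h : (S + `|n%:~R|) / K <= nm w by rewrite ler_pdivrMr// mulrC.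
  apply: le_trans (powRN_le _ h sg0) _; first by rewrite divr_gt0.
  rewrite powRM ?(ltW Sn0) ?invr_ge0 ?(ltW K0)//.
  rewrite -[X in _ * X `^ _ <= _]powR_inv1 ?(ltW K0)// -powRrM mulrNN mul1r mulrC.
  rewrite ler_wpM2l ?powR_ge0//.
  have -> : - sg = - p * r.+1%:R by rewrite /p mulNr divfK// gt_eqF.
  rewrite powRrM powR_mulrn ?powR_ge0// exprS nm_prod.
  have p0 : 0 <= p by lra.
  apply: ler_pM; rewrite ?exprn_ge0 ?powR_ge0//.
    by apply: (powRN_le _ _ p0); [rewrite ltr_pwDl// ler0z|rewrite intr_norm lerD2r].
  rewrite -[X in _ ^+ X]card_ord -prodr_const; apply: ler_prod => k _.
  rewrite powR_ge0 nm_real (ger0_norm (powR_ge0 _ _))/=; apply: (powRN_le _ _ p0); first by rewrite ltr_pwDl.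
  rewrite /S -addrA lerD2l (bigD1 k)//= -addrA lerDl addr_ge0 ?sumr_ge0//.
have [M HM] := bidom_summable 1 p1.
pose Q := (1 + (p - 1)^-1) ^+ r.
have Q0 : 0 <= Q by rewrite exprn_ge0// addr_ge0// invr_ge0; lra.
apply: (@abs_summable_pair _ _ _ _ (fun n => C * Q * (1 + `|n|%:~R) `^ (- p)) (C * Q * M)) => [n B|A].
  apply: le_trans (ler_sum _ (fun m _ => bnd n m)) _.
  rewrite -mulr_sumr [C * Q * _]mulrAC ler_wpM2l ?mulr_ge0 ?powR_ge0//.
  have h := @abs_summable_prod R r (fun k j => ((1 + j%:R) `^ (- p))%:Co) (fun=> 1 + (p - 1)^-1) _ B.
  apply: le_trans (h _) _; last by rewrite prodr_const card_ord.
  move=> k n'; apply: le_trans (pseries_bound n' p1); apply: ler_sum => j _.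
  by rewrite nm_real ger0_norm ?powR_ge0.
rewrite -mulr_sumr ler_wpM2l ?mulr_ge0 ?powR_ge0//.
apply: le_trans (HM A).
by apply: ler_sum => n _; rewrite nm_real mul1r (ger0_norm (powR_ge0 _ _)).
Qed.

Theorem bilateral_zeta_seriesE s : r.+1%:R < complex.Re s ->
  bilateral_zeta_series z omega s = lip_entire s * multiseries (s - 1).
Proof.
move=> sr; have s1 : 1 < complex.Re s by apply: le_lt_trans sr; rewrite ler1n.
have sf := lattice_summable sr.
have [L HL] := abs_summable_hsum sf.
rewrite /bilateral_zeta_series (hsum_summability HL) lip_entire_const//.
(* The indices are swapped to make the sum over n in Z the inner one, to which Lipschitz's formula
   applies. *)
pose sw (p : {ffun 'I_r -> nat} * int) := (p.2, p.1).
pose sw' (p : int * {ffun 'I_r -> nat}) := (p.2, p.1).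
have c1 : cancel sw sw' by case.
have c2 : cancel sw' sw by case.
have H := hsum_fubini (abs_summable_bij c1 c2 sf) (hsum_bij c1 c2 HL).
apply: (hsum_unique (H (fun m => lip_const s * qseries (s - 1) (lattice_point m)) _)).
  move=> m /=; rewrite -lipschitz_formula//; last exact: Im_lattice_gt0.
  apply: eq_hsum (hsum_biseries (Im_lattice_gt0 m) s1) => n.
  by rewrite /biterm lattice_term_shift.
exact: hsumZ (hsum_lattice_qseries _).
Qed.

End MultipleSeries.

(** * The Euler factor *)

Section EulerFactor.
Context {R : realType}.
Implicit Types (z : R[i]^o).

Lemma spowN1 (i : nat) : spow i (-1 : R[i]^o) = i.+1%:R^-1.
Proof.
have n0 : i.+1%:R != 0 :> R[i]^o by rewrite pnatr_eq0.
apply: (mulfI n0); rewrite divff// -spow1 -spowD addrN spow0 //.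
Qed.

(** Differentiation cancels the coefficient 1 / k and leaves a geometric series. The radius Im z / 2
    keeps z + h in the half plane and retains half of the exponential decay. *)
Lemma qseries_log_cderiv z : 0 < complex.Im z ->
  cderiv (qseries (-1)) z (two_pi_i * (echar 1 z / (1 - echar 1 z))).
Proof.
move=> z0; set q := echar 1 z.
pose lam (i : nat) : R[i]^o := two_pi_i * i.+1%:~R.
pose y := complex.Im z / 2; have y0 : 0 < y by rewrite divr_gt0.
have lamE i w : cexp (w * lam i) = echar i.+1 w by rewrite mulrC.
have nlam i : nm (lam i) = 2 * pi * i.+1%:R.
  rewrite /lam nmM -[_%:~R]/(i.+1%:R) nm_nat; congr (_ * _).
  by rewrite nmE /= expr0n add0r sqrtr_sqr ger0_norm ?mulr_ge0 ?pi_ge0.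
have q1 : nm q < 1.
  by rewrite /q nm_echar expR_lt1 oppr_lt0 !mulr_gt0 ?pi_gt0.
have [||e He] := @dirichlet_cderiv R _ (fun i => spow i (-1)) lam z y (qseries (-1)) y0.
- apply: (abs_summable_le _ (qterm_summable (-1) (y0 : 0 < complex.Im (0 +i* y)))) => i.
  rewrite lamE /qterm nm_real ger0_norm ?mulr_ge0 ?nm_ge0 ?expR_ge0//.
  move: (spow i (-1)) => u; rewrite (nmM u) (nmM _ u) !nm_echar nlam -mulrA -expRD mulrC.
  rewrite ler_wpM2r ?nm_ge0// ler_expR -[i.+1%:~R]/(i.+1%:R) /= /y.
  by move: (pi : R) (i.+1%:R : R) (complex.Im z) => a b c; lra.
- move=> h hy; have I0 : 0 < complex.Im (z + h).
    rewrite cImD; have := le_lt_trans (Im_le_nm h) hy.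
    by rewrite ltr_norml /y => /andP[]; move: (complex.Im z) z0 => a a0; lra.
  by apply: eq_hsum (hsum_qseries (-1) I0) => i; rewrite lamE mulrC.
move=> H; apply: (cderiv_eq H); apply: (hsum_unique He).
rewrite mulrA; apply: eq_hsum (hsumZ (two_pi_i * q) (hsum_geometric q1)) => i.
rewrite lamE spowN1 echar_nat -/q exprS /lam -[_%:~R]/(i.+1%:R).
have n0 : i.+1%:R != 0 :> R[i]^o by rewrite pnatr_eq0.
by move: i.+1%:R n0 => a a0; field.
Qed.

Lemma nm_qseries_log z : 0 < complex.Im z ->
  nm (qseries (-1) z) <= nm (echar 1 z) / (1 - nm (echar 1 z)).
Proof.
move=> z0; set q := echar 1 z.
have q1 : nm q < 1.
  by rewrite /q nm_echar expR_lt1 oppr_lt0 !mulr_gt0 ?pi_gt0.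
apply: (hsum_nm_le (hsum_qseries (-1) z0)) => A.
have [n Hn'] := fsub_exhaust A (@nat_range_cover); have Hn := Hn' n (leqnn n).
apply: le_trans (sum_fset_le _ Hn) _ => [i|]; first exact: nm_ge0.
rewrite sum_nat_range; apply: le_trans (ler_wpM2l (nm_ge0 q) (geometric_bound n (nm_ge0 q) q1)).
rewrite mulr_sumr; apply: ler_sum => i _.
rewrite /qterm spowN1 echar_nat -/q nmM nmV nm_nat nmX -exprS.
by rewrite ler_piMr ?exprn_ge0 ?nm_ge0// invf_le1 ?ltr0n// ler1n.
Qed.

(** No branch of log is involved: exp (sum of q^k / k) (1 - q) has derivative 0, so it is constant
    on the vertical ray, and it tends to 1 as Im z -> oo. *)
Lemma cexp_qseries_log z : 0 < complex.Im z ->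
  cexp (- qseries (-1) z) = 1 - echar 1 z.
Proof.
case: z => x y /= y0.
pose W (w : R[i]^o) : R[i]^o := cexp (qseries (-1) w) * (1 - echar 1 w).
have dW (w : R[i]^o) : 0 < complex.Im w -> cderiv W w 0.
  move=> w0.
  have q1 : 1 - echar 1 w != 0.
    apply/eqP => /eqP; rewrite subr_eq0 => /eqP E.
    have : nm (echar 1 w) < 1 by rewrite nm_echar expR_lt1 oppr_lt0 !mulr_gt0 ?pi_gt0.
    by rewrite -E -[1]/(1%:R) nm_nat ltxx.
  apply: cderiv_eq.
    apply: cderivM (cderiv_comp (cexp_cderiv _) (qseries_log_cderiv w0)) _.
    by apply: cderivB (cderiv_cst 1 w) (echar_cderiv 1 w).
  by rewrite /=; field.
(* The vertical ray is run as [y = exp t], so that it is defined for all real [t]. *)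
pose V (t : R[i]^o) : R[i]^o := W (x%:Co + ii * cexp t).
have path (t : R) : x%:Co + ii * cexp t%:Co = x +i* expR t :> R[i]^o.
  by rewrite cexp_real; apply: complexP; rewrite ?cReD ?cImD ?cReM ?cImM /=; ring.
have dV (t : R) : cderiv V t%:Co 0.
  apply: cderiv_eq.
    apply: (@cderiv_comp R W (fun t => x%:Co + ii * cexp t)).
      by apply: dW; rewrite path/= expR_gt0.
    exact: cderivD (cderiv_cst _ _) (cderivMl ii (cexp_cderiv _)).
  by rewrite mul0r.
have rV (t : R) : rderiv (fun t => V (0 + t%:Co * 1)) t (1 * 0).
  by apply: cderiv_rderiv; rewrite mulr1 add0r.
have cst (a b : R) : a <= b -> V a%:Co = V b%:Co.
  move=> ab; apply: complexP; apply/eqP; rewrite eq_sym -subr_eq0 -normr_le0.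
  - have := @mean_value_bound R (fun t => complex.Re (V (0 + t%:Co * 1))) (fun=> 0) a b 0 ab.
    rewrite mul0r !mulr1 !add0r; apply => [t|t _]; last by rewrite normr0.
    by have [] := rV t; rewrite mulr0.
  - have := @mean_value_bound R (fun t => complex.Im (V (0 + t%:Co * 1))) (fun=> 0) a b 0 ab.
    rewrite mul0r !mulr1 !add0r; apply => [t|t _]; last by rewrite normr0.
    by have [] := rV t; rewrite mulr0.
suff W1 : W (x +i* y) = 1.
  apply: (mulfI (cexp_neq0 (qseries (-1) (x +i* y)))); rewrite -cexpD subrr cexp0.
  exact/esym.
apply/eqP; rewrite -subr_eq0; apply/eqP/nm_le_eps => e e0.
have [D D0 HD] := cderiv_cont (cexp_cderiv (0 : R[i]^o)) (divr_gt0 e0 (ltr0n _ 4)).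
(* With |q| < 1/2 the series is at most |q| / (1 - |q|) <= 2 |q| < D, and the total error is at most
   2 e / 4 + e / 4. *)
pose c := Num.min (2^-1) (Num.min (D / 4) (e / 4)).
have c0 : 0 < c by rewrite !lt_min !divr_gt0// invr_gt0 ltr0n.
have [N HN] := expR_neg_lt (mulr_gt0 (ltr0n _ 2 : 0 < 2 :> R) (pi_gt0 R)) c0.
pose T := Num.max (ln y) (ln N.+1%:R).
have eT : N%:R <= expR T.
  have : ln N.+1%:R <= T by rewrite le_max lexx orbT.
  rewrite -ler_expR lnK ?posrE ?ltr0n//; apply: le_trans; by rewrite ler_nat.
have <- : V (ln y)%:Co = W (x +i* y) by rewrite /V path lnK.
rewrite (cst (ln y) T); last by rewrite le_max lexx.
rewrite /V path; set w : R[i]^o := x +i* expR T; set q := echar 1 w.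
have w0 : 0 < complex.Im w by rewrite /= expR_gt0.
have qc : nm q < c.
  apply: le_lt_trans HN; rewrite /q nm_echar ler_expR lerN2 /= mulr1 mulrC.
  by rewrite ler_wpM2l ?mulr_ge0 ?pi_ge0.
have [qa qb qd] : [/\ nm q < 2^-1, nm q < D / 4 & nm q < e / 4].
  by move: qc; rewrite !lt_min => /andP[? /andP[]].
have q2 : 0 < 1 - nm q by lra.
have PD : nm (qseries (-1) w) < D.
  apply: le_lt_trans (nm_qseries_log w0) _; rewrite -/q ltr_pdivrMr//.
  by have := nm_ge0 q; nra.
have := HD _ PD; rewrite add0r cexp0 => h.
have -> : W w - 1 = (cexp (qseries (-1) w) - 1) * (1 - q) + (- q) by rewrite /W -/q; ring.
apply: le_trans (ler_nmD _ _) _; rewrite nmN nmM.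
have : nm (1 - q) <= 2.
  apply: le_trans (ler_nmB _ _) _; rewrite -[1]/(1%:R) nm_nat; lra.
have := nm_ge0 (cexp (qseries (-1) w) - 1); have := nm_ge0 (1 - q).
move: h qd; move: (nm (_ - 1)) (nm (1 - q)) (nm q) => a b d.
move=> *; nra.
Qed.

End EulerFactor.

(** * The continuation of the bilateral zeta function *)

Section Continuation.
Context {R : realType} {r : nat} (z : R[i]^o) (omega : 'I_r -> R[i]^o).
Hypothesis hz : 0 < complex.Im z.
Hypothesis homega : forall k, 0 < complex.Im (omega k).
Implicit Types (s : R[i]^o) (f g : R[i]^o -> R[i]^o).

Lemma entire_cderiv f : entire f -> exists f', forall s, cderiv f s (f' s).
Proof.
move=> ef; exists (fun s => 'D_1 f s) => s; apply/cderivP.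
by apply: DeriveDef => //; exact: ef.
Qed.

Lemma multiseries_shift_cderiv s :
  exists d, cderiv (fun s => multiseries z omega (s - 1)) s d.
Proof.
have [d Hd] := multiseries_cderiv hz homega (s - 1).
have shift : cderiv (fun s : R[i]^o => s - 1) s (1 - 0) := cderivB (cderiv_id s) (cderiv_cst 1 s).
by exists (d * (1 - 0)); exact: (cderiv_comp (g := fun s => s - 1)).
Qed.

Lemma bilateral_continuation_cderiv s :
  exists d, cderiv (fun s => lip_entire s * multiseries z omega (s - 1)) s d.
Proof.
have [d Hd] := lip_entire_cderiv s.
have [d' Hd'] := multiseries_shift_cderiv s.
by eexists; exact: cderivM Hd Hd'.
Qed.

(** The product is one admissible choice; any other differs from it by an entire function that
    vanishes for Re s > r + 1. *)
Lemma bilateral_zetaE :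
  bilateral_zeta z omega = fun s => lip_entire s * multiseries z omega (s - 1).
Proof.
pose Phi s := lip_entire s * multiseries z omega (s - 1).
have HPhi : is_bilateral_zeta z omega Phi.
  split=> s.
    by have [d /cderivP Hd] := bilateral_continuation_cderiv s; exact: ex_derive.
  by move=> sr; rewrite /Phi bilateral_zeta_seriesE.
rewrite /bilateral_zeta; case: xgetP => [xi _ [exi xiE]|/(_ Phi)]; last by move/(_ HPhi).
apply: funext => s; rewrite -/(Phi s).
have [d Hd] := entire_cderiv exi; have [d' Hd'] := entire_cderiv HPhi.1.
apply/eqP; rewrite -subr_eq0; apply/eqP.
apply: (@entire_vanishing R (fun s => xi s - Phi s) (fun s => d s - d' s) r.+1%:R) => t.
  exact: cderivB.
by move=> tr; rewrite xiE// HPhi.2// subrr.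
Qed.

Lemma bilateral_zeta_derivative (n : nat) :
  is_derive (- n%:R : R[i]^o) 1 (bilateral_zeta z omega)
    (n`!%:R / two_pi_i ^+ n * multiseries z omega (- n.+1%:R)).
Proof.
have [d' Hd'] := multiseries_shift_cderiv (- n%:R).
rewrite bilateral_zetaE; apply/cderivP.
apply: cderiv_eq (cderivM (lip_entire_derivative n) Hd') _.
by rewrite lip_entire_zero mul0r add0r mulrC -opprD natr1.
Qed.

Lemma multiseriesE (m : nat) : multiseries z omega (- m%:R) =
  \big[+%R/0]_(1 <= n <oo)
    (cexp (two_pi_i * n%:R * z) /
      (n%:R ^+ m * \prod_(k < r) (1 - cexp (two_pi_i * n%:R * omega k))) : R[i]^o).
Proof.
apply/esym/cvg_lim; first exact: norm_hausdorff.
apply/cvgrPdist_le => -[e e'] /=; rewrite ltcE/= => /andP[/eqP -> e0].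
have [N HN] := hsum_nat (hsum_multiseries hz homega (- m%:R)) e0.
(* The ordered sum starts at 1 while [mcoef] is indexed from 0, hence the shift. *)
exists N.+1 => // -[//|n] nN; rewrite distrC big_add1 /=.
have -> : \sum_(0 <= i < n) (cexp (two_pi_i * i.+1%:R * z) /
      (i.+1%:R ^+ m * \prod_(k < r) (1 - cexp (two_pi_i * i.+1%:R * omega k))) : R[i]^o) =
    \sum_(0 <= i < n) mcoef z omega i * spow i (- m%:R).
  apply: eq_bigr => i _; rewrite /mcoef invfM mulrCA [RHS]mulrC; congr (_ * _).
  apply: (mulfI (_ : i.+1%:R ^+ m != 0)); first by rewrite expf_neq0// pnatr_eq0.
  by rewrite divff ?expf_neq0 ?pnatr_eq0// -spow_nat -spowD subrr spow0.
by have := HN n nN; rewrite -lecR.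
Qed.

(** Each finite product is the exponential of a finite sum of values of - [qseries (-1)], so
    continuity of exp carries convergence from sums to products. *)
Lemma q_shifted_factorialE :
  q_shifted_factorial (cexp (two_pi_i * z)) (fun k => cexp (two_pi_i * omega k)) =
  cexp (- multiseries z omega (-1)).
Proof.
have e1 w : cexp (two_pi_i * w) = echar 1 w by rewrite /echar mulr1.
apply: uprod_eq => e e0.
have [D D0 HD] := cderiv_cont (cexp_cderiv (- multiseries z omega (-1))) e0.
have D2 : 0 < D / 2 by rewrite divr_gt0.
have [A0 HA] := hsum_lattice_qseries hz homega (-1) D2.
exists A0 => A /HA h.
have -> : \prod_(m <- A) (1 - (\prod_(k < r) cexp (two_pi_i * omega k) ^+ m k) * cexp (two_pi_i * z)) =
    cexp (- multiseries z omega (-1) - (\sum_(m <- A) qseries (-1) (lattice_point z omega m) - multiseries z omega (-1))).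
  rewrite opprB addKr -sumrN cexp_sum; apply: eq_bigr => m _.
  rewrite cexp_qseries_log ?Im_lattice_gt0// echar_lattice mulrC e1.
  by under [in RHS]eq_bigr do rewrite -e1.
by apply: HD; rewrite nmN; apply: le_lt_trans h _; lra.
Qed.

End Continuation.

Theorem corollary4p9 (R : realType) (r : nat) (z : R[i]^o)
    (omega : 'I_r -> R[i]^o)
    (hz : 0 < complex.Im z) (homega : forall k, 0 < complex.Im (omega k)) :
  (forall m : nat, (1 <= m)%N ->
     is_derive (1 - m%:R : R[i]^o) 1 (bilateral_zeta z omega)
       ((m.-1)`!%:R / two_pi_i ^+ m.-1 *
        \big[+%R/0]_(1 <= n <oo)
          (cexp (two_pi_i * n%:R * z) /
           (n%:R ^+ m *
            \prod_(k < r) (1 - cexp (two_pi_i * n%:R * omega k))) : R[i]^o)))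
  /\
  cexp (- (bilateral_zeta z omega)^`()%classic 0) =
    q_shifted_factorial (cexp (two_pi_i * z))
                        (fun k => cexp (two_pi_i * omega k)).
Proof.
have H n := bilateral_zeta_derivative hz homega n.
split=> [[//|m] _|].
  have -> : 1 - m.+1%:R = - m%:R :> R[i]^o by rewrite -natr1; ring.
  by rewrite -multiseriesE//; exact: H.
rewrite q_shifted_factorialE// derive1E; congr (cexp (- _)).
by have := H 0%N; rewrite oppr0 expr0 fact0 divr1 mul1r => -[_ ->].
Qed.
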